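(* Let $V$ be a nontrivial coreduced representation of $\mathrm{SL}_2=\mathrm{SL}_2(\mathbb{C})$ with $V^{\mathrm{SL}_2}=(0)$. Then $V$ is isomorphic to $R_2$, $R_3$, $R_4$ or $kR_1$ for some $k\geq 1$.
   Context: $R_m$ denotes the irreducible representation of $\mathrm{SL}_2$ of dimension $m+1$ (binary forms of degree $m$), and $kR_1$ is the direct sum of $k$ copies of $R_1=\mathbb{C}^2$. For a complex reductive group $G$ and a finite-dimensional rational $G$-module $V$, $\pi\colon V\to V/\!\!/G$ is the categorical quotient (dual to $\mathcal{O}(V)^G\subset\mathcal{O}(V)$) and $\mathcal{N}(V)=\pi^{-1}(\pi(0))$ is the null cone. $V$ is called coreduced if the scheme-theoretic fiber $\pi^{-1}(\pi(0))$ is reduced, i.e. if the ideal $I(\mathcal{N}(V))\subset\mathcal{O}(V)$ of functions vanishing on $\mathcal{N}(V)$ is generated by the homogeneous maximal ideal of $\mathcal{O}(V)^G$ (the invariants vanishing at $0$). *)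

(* Defs.v *)
From HB Require Import structures.
From mathcomp Require Import all_boot all_order all_algebra.
From mathcomp Require Export reals complex.
From mathcomp.multinomials Require Export mpoly.

Set Implicit Arguments.
Unset Strict Implicit.
Unset Printing Implicit Defensive.

Import GRing.Theory.

Local Open Scope ring_scope.

Record SL2 (C : closedFieldType) :=
  MkSL2 { SL2_mx :> 'M[C]_2; SL2_det : \det SL2_mx == 1 }.

Section SL2Group.
Variable C : closedFieldType.

HB.instance Definition _ := [isSub for @SL2_mx C].
HB.instance Definition _ := [Choice of SL2 C by <:].

Fact SL2_one_det : \det (1%:M : 'M[C]_2) == 1.
Proof. by rewrite det1. Qed.

Fact SL2_mul_det (g h : SL2 C) : \det (g *m h) == 1.
Proof. by rewrite det_mulmx (eqP (SL2_det g)) (eqP (SL2_det h)) mul1r. Qed.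

Fact SL2_inv_det (g : SL2 C) : \det (invmx g) == 1.
Proof. by rewrite det_inv (eqP (SL2_det g)) invr1. Qed.

Fact SL2_unitmx (g : SL2 C) : (g : 'M_2) \in unitmx.
Proof. by rewrite unitmxE (eqP (SL2_det g)) unitr1. Qed.

Definition SL2_one : SL2 C := MkSL2 SL2_one_det.
Definition SL2_mul (g h : SL2 C) : SL2 C := MkSL2 (SL2_mul_det g h).
Definition SL2_inv (g : SL2 C) : SL2 C := MkSL2 (SL2_inv_det g).

Fact SL2_mulA : associative SL2_mul.
Proof. by move=> g h k; apply/val_inj; rewrite /= mulmxA. Qed.
Fact SL2_mul1 : left_id SL2_one SL2_mul.
Proof. by move=> g; apply/val_inj; rewrite /= mul1mx. Qed.
Fact SL2_mulr1 : right_id SL2_one SL2_mul.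
Proof. by move=> g; apply/val_inj; rewrite /= mulmx1. Qed.
Fact SL2_mulV : left_inverse SL2_one SL2_inv SL2_mul.
Proof. by move=> g; apply/val_inj; rewrite /= mulVmx ?SL2_unitmx. Qed.
Fact SL2_mulrV : right_inverse SL2_one SL2_inv SL2_mul.
Proof. by move=> g; apply/val_inj; rewrite /= mulmxV ?SL2_unitmx. Qed.

HB.instance Definition _ := isGroup.Build (SL2 C)
  SL2_mulA SL2_mul1 SL2_mulr1 SL2_mulV SL2_mulrV.

End SL2Group.

Record SL2rep (C : closedFieldType) (V : vectType C) := MkSL2rep {
  rep_act :> SL2 C -> 'End(V);
  rep_act1 : rep_act 1%g = \1%VF;
  rep_actM : forall g h : SL2 C, rep_act (g * h)%g = (rep_act g \o rep_act h)%VF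
}.

Section Representations.
Variable C : closedFieldType.
Implicit Types V W : vectType C.

(* Every matrix coefficient g |-> l (g v) is a regular function on SL2, that   *)
(* is, the restriction of a polynomial function on the 2 x 2 matrices.         *)
Definition rational_rep V (rho : SL2rep V) : Prop :=
  forall (v : V) (l : 'Hom(V, C^o)),
  exists p : {mpoly C[2 * 2]}, forall g : SL2 C,
    l (rho g v) = p.@[fun k => mxvec (SL2_mx g) 0 k].

Definition trivial_rep V (rho : SL2rep V) : Prop :=
  forall (g : SL2 C) (v : V), rho g v = v.

Definition fixed_point V (rho : SL2rep V) (v : V) : Prop :=
  forall g : SL2 C, rho g v = v.

Definition isomorphic_rep V W (rho : SL2rep V) (sigma : SL2rep W) : Prop :=
  exists f : 'Hom(V, W),
    bijective f /\ forall (g : SL2 C) (v : V), f (rho g v) = sigma g (f v).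

(* O(V), written in the coordinates of V with respect to vbasis {:V}.          *)
Definition coord_ring V := {mpoly C[\dim {:V}]}.

Definition eval_at V (v : V) (f : coord_ring V) : C :=
  f.@[fun i => coord (vbasis {:V}) i v].

Definition invariant V (rho : SL2rep V) (f : coord_ring V) : Prop :=
  forall (g : SL2 C) (v : V), eval_at (rho g v) f = eval_at v f.

(* A point of V // SL2 is a C-algebra morphism O(V)^SL2 -> C, and pi sends v   *)
(* to the evaluation at v; the condition below is thus pi v = pi 0.            *)
Definition null_cone V (rho : SL2rep V) (v : V) : Prop :=
  forall f : coord_ring V, invariant rho f -> eval_at v f = eval_at 0 f.

Definition ideal_gen (A : comNzRingType) (S : A -> Prop) (f : A) : Prop :=
  exists s : seq (A * A),
    (forall x, x \in s -> S x.2) /\ f = \sum_(x <- s) x.1 * x.2.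

Definition coreduced V (rho : SL2rep V) : Prop :=
  forall f : coord_ring V,
    (forall v : V, null_cone rho v -> eval_at v f = 0) <->
    ideal_gen (fun h : coord_ring V => invariant rho h /\ eval_at 0 h = 0) f.

End Representations.

Section BinaryForms.
Variable C : closedFieldType.

(* g acts on linear forms by g X_i = \sum_j g_ji X_j, so that R_1 is C^2 with  *)
(* the action of SL2 on column vectors, and R_m is its m-th symmetric power.   *)
Definition SL2_subst (g : SL2 C) : 2.-tuple {mpoly C[2]} :=
  [tuple \sum_(j < 2) SL2_mx g j i *: 'X_j | i < 2].

Fact SL2_subst_homog (m : nat) (g : SL2 C) (p : dhomog 2 C m) :
  (p : {mpoly C[2]}) \mPo SL2_subst g \is m.-homog.
Proof.
rewrite comp_mpolyEX big_seq; apply: rpred_sum => /= mm hmm.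
have mmE : mdeg mm = m by exact: (dhomog_mf (dhomog_is_dhomog p)).
apply: rpredZ; rewrite comp_mpolyX.
suff: \prod_(i < 2) tnth (SL2_subst g) i ^+ mm i \is (mdeg mm).-homog.
  by rewrite mmE.
rewrite mdegE.
elim/big_ind2: _ => [|d p1 e p2 h1 h2|i _]; first exact: dhomog1.
  exact: dhomogM.
rewrite tnth_mktuple.
suff h : \sum_(j < 2) SL2_mx g j i *: 'X_j \is [in C[2], 1.-homog].
  by have := dhomogMn (mm i) h; rewrite mul1n.
by apply: rpred_sum => j _; apply: rpredZ; rewrite dhomogX /= mdeg1.
Qed.

Definition binary_act m (g : SL2 C) (p : dhomog 2 C m) : dhomog 2 C m :=
  DHomog (SL2_subst_homog g p).

Fact binary_act_is_linear m g : linear (@binary_act m g).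
Proof. by move=> a p q; apply/val_inj; rewrite /= linearP. Qed.

HB.instance Definition _ m g := GRing.isLinear.Build C _ _ _
  (@binary_act m g) (@binary_act_is_linear m g).

Fact binary_act1 m : linfun (@binary_act m 1%g) = \1%VF.
Proof.
apply/lfunP => p; rewrite lfunE id_lfunE; apply/val_inj => /=.
rewrite -[RHS]comp_mpoly_id; congr comp_mpoly; apply: eq_from_tnth => i.
rewrite !tnth_mktuple (bigD1 i) //= big1 ?addr0 => [|j /negPf ji].
  by rewrite mxE eqxx scale1r.
by rewrite mxE ji scale0r.
Qed.

Fact binary_actM m (g h : SL2 C) :
  linfun (@binary_act m (g * h)%g) =
  (linfun (@binary_act m g) \o linfun (@binary_act m h))%VF.
Proof.
apply/lfunP => p; rewrite comp_lfunE !lfunE; apply/val_inj => /=.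
rewrite [in RHS](comp_mpolyEX p (SL2_subst h)) raddf_sum /= comp_mpolyEX.
apply: eq_bigr => mm _; rewrite linearZ /= !comp_mpolyX rmorph_prod /=.
congr (_ *: _); apply: eq_bigr => i _; rewrite rmorphXn /=; congr (_ ^+ _).
rewrite !tnth_mktuple raddf_sum /=.
under [RHS]eq_bigr => k _.
  rewrite linearZ /= comp_mpolyXU -tnth_nth tnth_mktuple scaler_sumr; over.
rewrite exchange_big /=; apply: eq_bigr => j _.
rewrite mxE scaler_suml; apply: eq_bigr => k _.
by rewrite scalerA mulrC.
Qed.

Definition Rrep (m : nat) : SL2rep (dhomog 2 C m) :=
  MkSL2rep (@binary_act1 m) (@binary_actM m).

End BinaryForms.

Section Copies.
Variables (C : closedFieldType) (V : vectType C) (rho : SL2rep V) (k : nat).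

Definition copies_act (g : SL2 C) (v : {ffun 'I_k -> V}) : {ffun 'I_k -> V} :=
  [ffun i => rho g (v i)].

Fact copies_act_is_linear g : linear (copies_act g).
Proof. by move=> a u v; apply/ffunP => i; rewrite !ffunE linearP. Qed.

HB.instance Definition _ g := GRing.isLinear.Build C _ _ _
  (copies_act g) (copies_act_is_linear g).

Fact copies_act1 : linfun (copies_act 1%g) = \1%VF.
Proof.
apply/lfunP => v; rewrite lfunE id_lfunE; apply/ffunP => i.
by rewrite /= ffunE rep_act1 id_lfunE.
Qed.

Fact copies_actM (g h : SL2 C) :
  linfun (copies_act (g * h)%g) =
  (linfun (copies_act g) \o linfun (copies_act h))%VF.
Proof.
apply/lfunP => v; rewrite comp_lfunE !lfunE; apply/ffunP => i.
by rewrite /= !ffunE rep_actM comp_lfunE.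
Qed.

Definition copies : SL2rep {ffun 'I_k -> V} := MkSL2rep copies_act1 copies_actM.

End Copies.

(* Main.v *)
(* Write V as a sum of R_(m i) by means of the Lie algebra action, with        *)
(* coordinates Y i j, the coefficients of the binary forms.  The maximal ideal *)
(* of the invariants consists of the polynomials vanishing at 0 and killed by  *)
(* the derivations opE and opF that generate the action of the unipotents.     *)
(* If a highest weight covariant P of positive weight c does not vanish at a   *)
(* null point x, a root of a one-variable polynomial moves x, within the null  *)
(* cone, to a point where F^c P also vanishes.  When this forces all F^j P,    *)
(* j > 0, to vanish there, pairing P with the lowest weight vectors quadratic  *)
(* in Y i shows that x lies in the sum of the positive weight spaces.          *)
(* Transvectants of the coordinates provide in this way covariants vanishing   *)
(* on the null cone as soon as some m i >= 5, or m i >= 2 and there are at     *)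
(* least two summands, and a specialization of the coordinates to powers of a  *)
(* variable shows that these covariants are not in the ideal of invariants.    *)

From HB Require Import structures.
Require Import Defs.
From mathcomp Require Import all_boot all_order all_algebra.
From mathcomp Require Import ring zify.

Set Implicit Arguments.
Unset Strict Implicit.
Unset Printing Implicit Defensive.

Import Order.TTheory GRing.Theory Num.Theory.

Local Open Scope ring_scope.

(** * Derivations of polynomial rings *)

(** The representation splits as a sum of spaces of binary forms of degrees [m i], all positive
    because there is no nonzero fixed vector ([rep_decomposition], [no_fixed_degree]). On
    polynomials in the coordinates [Y i j] the two unipotent subgroups act as exponentials of the
    derivations [opE] and [opF]. Since these subgroups generate the group, a polynomial is invariant
    exactly when both derivations kill it. Coreducedness then says that a polynomial vanishing on
    the null cone lies in the ideal generated by such invariants without constant term. To exclude a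
    list of degrees it is enough to produce one polynomial that vanishes on the null cone but is not
    in this ideal.

    Vanishing. By the Hilbert-Mumford criterion the null cone consists of the translates of the sum
    of the positive weight spaces. A weak form of this suffices and is proved directly. Let P be a
    highest weight vector of weight c > 0 with P nonzero at a null point x. Along the orbit of x
    under the flow of [opE], the function F^c P is a nonconstant polynomial in the time, so it has a
    root, while P keeps its value ([null_move]). If the vanishing of F^c P forces that of all F^j P
    with j > 0, as it does for c at most 2 and for the Hessian of a covariant of order 4, then
    invariants built from P and lowest weight vectors show that all coordinates of nonpositive
    weight vanish at the moved point ([Y_vanish], [null_positive]). So P only has to be evaluated at
    such positive points, where most products of coordinates are zero by their indices.

    Non-membership. An invariant without constant term involves only monomials of weight 0 and
    degree at least 2. Send a few well chosen coordinates to powers of one variable and the others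
    to 0. If the surviving monomials of this kind have large exponent, the whole ideal goes to
    multiples of X^(D+1), while the covariant goes to a nonzero multiple of X^D ([test_ideal],
    [not_coreduced]).

    Transvectants and Hessians of the coordinate forms provide the covariants. Pairs of summands are
    excluded by [no_consecutive], [no_even_pair], [no_three_one], [no_three_three] and
    [no_four_one], and degrees at least 5 by [no_large_even] and [no_large_odd]. The surviving lists
    of degrees are realised by explicit equivariant maps to binary forms ([single_summand],
    [linear_summands]). *)

Section Derivations.
Variable A : comNzRingType.

Definition derivation (D : A -> A) : Prop :=
  (forall p q, D (p + q) = D p + D q) /\
  (forall p q, D (p * q) = D p * q + p * D q).

Variable D : A -> A.
Hypothesis derD : derivation D.

Lemma derivation0 : D 0 = 0.
Proof.
by have := derD.1 0 0; rewrite addr0 => /eqP; rewrite -subr_eq0 opprD addrA subrr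
  sub0r oppr_eq0 => /eqP.
Qed.

Lemma derivation1 : D 1 = 0.
Proof.
have := derD.2 1 1; rewrite !mulr1 mul1r => /eqP.
by rewrite -subr_eq0 opprD addrA subrr sub0r oppr_eq0 => /eqP.
Qed.

Lemma derivationN p : D (- p) = - D p.
Proof.
by apply/eqP; rewrite -subr_eq0 opprK -derD.1 addNr derivation0.
Qed.

Lemma derivationB p q : D (p - q) = D p - D q.
Proof. by rewrite derD.1 derivationN. Qed.

Lemma derivation_sum (I : Type) (r : seq I) (P : pred I) (f : I -> A) :
  D (\sum_(i <- r | P i) f i) = \sum_(i <- r | P i) D (f i).
Proof. by apply: big_morph; [exact: derD.1 | exact: derivation0]. Qed.

Lemma derivationMn p k : D (p *+ k) = D p *+ k.
Proof.
by elim: k => [|k IH]; rewrite ?mulr0n ?derivation0 // !mulrS derD.1 IH.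
Qed.

Lemma derivation_nat k : D k%:R = 0.
Proof. by rewrite derivationMn derivation1 mul0rn. Qed.

Lemma derivation_natM k p : D (k%:R * p) = k%:R * D p.
Proof. by rewrite derD.2 derivation_nat mul0r add0r. Qed.

Lemma derivation_signM k p : D ((-1) ^+ k * p) = (-1) ^+ k * D p.
Proof. by rewrite -signr_odd; case: (odd k); rewrite ?expr0 ?expr1 ?mul1r // !mulN1r derivationN. Qed.

Lemma derivationX p k : D (p ^+ k.+1) = k.+1%:R * p ^+ k * D p.
Proof.
elim: k => [|k IH]; first by rewrite expr1 expr0 !mul1r.
by rewrite exprS derD.2 IH -[k.+2]addn1 natrD exprS; ring.
Qed.

Lemma iter_derivation0 k : iter k D 0 = 0.
Proof. by elim: k => //= k ->; rewrite derivation0. Qed.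

Lemma iter_derivationD k p q : iter k D (p + q) = iter k D p + iter k D q.
Proof. by elim: k => //= k ->; rewrite derD.1. Qed.

Lemma iter_derivationM k p q :
  iter k D (p * q) =
  \sum_(i < k.+1) (iter i D p * iter (k - i) D q) *+ 'C(k, i).
Proof.
elim: k => [|k IH] /=; first by rewrite big_ord1 bin0.
rewrite IH derivation_sum.
under [LHS]eq_bigr => i _ do rewrite derivationMn derD.2 mulrnDl.
rewrite big_split /= [in RHS]big_ord_recl /= bin0 ?subn0.
under [in RHS]eq_bigr => i _ do rewrite /bump /= add1n binS mulrnDr subSS.
rewrite [in RHS]big_split /= addrA [LHS]addrC; congr (_ + _).
rewrite [in LHS]big_ord_recl [in RHS]big_ord_recr /= ?subn0 ?bin0 bin_small //.
rewrite mulr0n addr0; congr (_ + _).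
by apply: eq_bigr => i _; rewrite /bump /= -[in RHS](subnSK (ltn_ord i)).
Qed.

End Derivations.


Section MpolyDerivations.
Variables (R : comNzRingType) (n : nat).
Implicit Types (p q : {mpoly R[n]}) (d : 'I_n -> {mpoly R[n]}).

Definition mder d p := \sum_i p^`M(i) * d i.

Lemma mder_is_linear d : linear (mder d).
Proof.
move=> c p q; rewrite scaler_sumr -big_split; apply: eq_bigr => i _ /=.
by rewrite mderivD mderivZ mulrDl scalerAl.
Qed.

HB.instance Definition _ d := GRing.isLinear.Build R _ _ _ (mder d) (mder_is_linear d).

Lemma mderZ d c p : mder d (c *: p) = c *: mder d p.
Proof. exact: linearZ. Qed.

Lemma mder_derivation d : derivation (mder d).
Proof.
split=> p q; rewrite /mder.
  by rewrite -big_split; apply: eq_bigr => i _; rewrite mderivD mulrDl.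
rewrite mulr_suml mulr_sumr -big_split; apply: eq_bigr => i _ /=.
by rewrite mderivM; ring.
Qed.

Lemma mderX d i : mder d 'X_i = d i.
Proof.
rewrite /mder (bigD1 i) //= big1 ?addr0 => [|j /negPf ji].
  have -> : 'X_i^`M(i) = 1 :> {mpoly R[n]}; last by rewrite mul1r.
  rewrite mderivX mnm1E eqxx scale1r -mpolyX0; congr mpolyX.
  by apply/mnmP => k; rewrite mnmBE subnn mnm0E.
by rewrite mderivX mnm1E eq_sym ji scale0r mul0r.
Qed.

Lemma mpoly_ring_ind (P : {mpoly R[n]} -> Prop) :
  (forall c, P c%:MP) -> (forall i, P 'X_i) ->
  (forall p q, P p -> P q -> P (p + q)) ->
  (forall p q, P p -> P q -> P (p * q)) -> forall p, P p.
Proof.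
move=> hC hX hD hM p; rewrite [p]mpolyE.
apply: big_ind => [||m _]; [by rewrite -mpolyC0 | exact: hD |].
rewrite -mul_mpolyC; apply: (hM) => //; rewrite mpolyXE_id.
apply: big_ind => [||i _]; [by rewrite -mpolyC1 | exact: hM |].
by elim: (m i) => [|k IH]; rewrite ?expr0 -?mpolyC1 // exprS; apply: (hM).
Qed.

Lemma mder_unique d (D : {mpoly R[n]} -> {mpoly R[n]}) :
  derivation D -> (forall c p, D (c *: p) = c *: D p) ->
  (forall i, D 'X_i = d i) -> D =1 mder d.
Proof.
move=> dD hZ hX; apply: mpoly_ring_ind => [c|i|p q hp hq|p q hp hq].
- by rewrite -[c%:MP]mulr1 mul_mpolyC hZ mderZ !derivation1 //; apply: mder_derivation.
- by rewrite hX mderX.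
- by rewrite dD.1 (mder_derivation d).1 hp hq.
- by rewrite dD.2 (mder_derivation d).2 hp hq.
Qed.

(** A commutator of derivations is again a derivation, hence determined by its values on the
    variables. This reduces the sl2 relations for [opE] and [opF] to a check on coordinates. *)
Lemma mder_commutator d d' p :
  mder d (mder d' p) - mder d' (mder d p) =
  mder (fun i => mder d (d' i) - mder d' (d i)) p.
Proof.
have [hD hM] := mder_derivation d; have [hD' hM'] := mder_derivation d'.
apply: (@mder_unique _ (fun p => mder d (mder d' p) - mder d' (mder d p))).
- by split=> a b; rewrite ?hD ?hD' ?hM ?hM' ?hD ?hD' ?hM ?hM'; ring.
- by move=> c a; rewrite !mderZ scalerBr.
- by move=> i; rewrite !mderX.
Qed.

Lemma mder_monomial (w : 'I_n -> R) m :
  mder (fun i => w i *: 'X_i) 'X_[m] = (\sum_i w i *+ m i) *: 'X_[m].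
Proof.
rewrite scaler_suml; apply: eq_bigr => i _.
rewrite mderivX; case: (m i =P 0)%N => [->|/eqP mi].
  by rewrite mulr0n !scale0r mul0r.
rewrite -scalerAl -scalerAr -mpolyXD scalerA mulr_natl submK //.
by rewrite lep1mP.
Qed.

Lemma mcoeff_mder_diag (w : 'I_n -> R) p m :
  (mder (fun i => w i *: 'X_i) p)@_m = (\sum_i w i *+ m i) * p@_m.
Proof.
rewrite {1}[p]mpolyE (derivation_sum (mder_derivation _)) raddf_sum /=.
under eq_bigr => i _ do rewrite mderZ mder_monomial !mcoeffZ mcoeffX.
have [pm|pm] := boolP (m \in msupp p); last first.
  rewrite big_seq big1 ?(memN_msupp_eq0 pm) ?mulr0 // => i ip.
  by case: eqP ip pm => [->->//|_ _ _]; rewrite !mulr0.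
rewrite (bigD1_seq m) ?msupp_uniq //= eqxx mulr1 [X in _ + X]big1 ?addr0 1?mulrC // => i /negPf->.
by rewrite !mulr0.
Qed.

Lemma meval0_mder d p : (forall i, (d i).@[fun=> 0] = 0) -> (mder d p).@[fun=> 0] = 0.
Proof.
move=> hd; rewrite /mder raddf_sum big1 // => i _ /=.
by rewrite mevalM hd mulr0.
Qed.

(* [P] is the formal series of [exp (t D) p]. *)
Definition exp_series (D : {mpoly R[n]} -> {mpoly R[n]}) p (P : {poly {mpoly R[n]}}) :=
  forall k, P`_k *+ k`! = iter k D p.

Lemma exp_seriesC d c : exp_series (mder d) c%:MP c%:MP%:P.
Proof.
move=> [|k]; rewrite coefC //; rewrite [_ == _]/= mul0rn.
rewrite iterSr -[c%:MP]mulr1 mul_mpolyC mderZ derivation1; last exact: mder_derivation.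
by rewrite scaler0 iter_derivation0 //; apply: mder_derivation.
Qed.

Lemma exp_seriesD d p q P Q : exp_series (mder d) p P -> exp_series (mder d) q Q ->
  exp_series (mder d) (p + q) (P + Q).
Proof.
move=> hp hq k; rewrite coefD mulrnDl hp hq iter_derivationD //.
exact: mder_derivation.
Qed.

Lemma exp_seriesM d p q P Q : exp_series (mder d) p P -> exp_series (mder d) q Q ->
  exp_series (mder d) (p * q) (P * Q).
Proof.
move=> hp hq k; rewrite iter_derivationM; last exact: mder_derivation.
rewrite coefM -sumrMnl; apply: eq_bigr => i _.
rewrite -hp -hq mulrnAr mulrnAl -!mulrnA; congr (_ *+ _).
by rewrite -(bin_fact (leq_ord i)) mulnC -mulnA.
Qed.

(** By the Leibniz rule the exponential of a derivation is multiplicative, so it agrees with a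
    substitution as soon as both agree on the variables. *)
Lemma exp_comp d (s : R -> n.-tuple {mpoly R[n]}) :
  (forall i, exists P, exp_series (mder d) 'X_i P /\
    forall t, tnth (s t) i = P.[t%:MP]) ->
  forall p, exists P, exp_series (mder d) p P /\ forall t, p \mPo s t = P.[t%:MP].
Proof.
move=> hs; apply: mpoly_ring_ind => [c|i|p q [P [hp eP]] [Q [hq eQ]]|p q [P [hp eP]] [Q [hq eQ]]].
- by exists c%:MP%:P; split=> [|t]; [exact: exp_seriesC | rewrite comp_mpolyC hornerC].
- have [P [hP eP]] := hs i; exists P; split=> // t.
  by rewrite comp_mpolyXU -tnth_nth eP.
- exists (P + Q); split=> [|t]; first exact: exp_seriesD.
  by rewrite comp_mpolyD eP eQ hornerD.
- exists (P * Q); split=> [|t]; first exact: exp_seriesM.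
  by rewrite rmorphM /= eP eQ hornerM.
Qed.

End MpolyDerivations.

(** * Polynomial identities and Taylor series in characteristic zero *)

Section NumField.
Variable C : numFieldType.

Lemma fact_neq0 k : (k`!%:R != 0 :> C).
Proof. by rewrite pnatr_eq0 -lt0n fact_gt0. Qed.

(** If p * q were nonzero, the natural numbers would give it more roots than its size allows. The
    factor [q] is what later permits clearing denominators. *)
Lemma poly_vanish (p q : {poly C}) :
  q != 0 -> (forall t, q.[t] != 0 -> p.[t] = 0) -> p = 0.
Proof.
move=> q0 hp; apply/eqP; apply: contraT => p0.
have pq0 : p * q != 0 by rewrite mulf_neq0.
have := max_poly_roots pq0 (rs := [seq i%:R | i <- iota 0 (size (p * q))]).
rewrite size_map size_iota ltnn => -> //.
  apply/allP => _ /mapP[i _ ->]; rewrite rootM; apply/orP.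
  by have [h|/hp h] := eqVneq q.[i%:R] 0; [right | left]; apply/eqP.
by rewrite map_inj_uniq ?iota_uniq // => i j /eqP; rewrite eqr_nat => /eqP.
Qed.

Lemma poly_vanish0 (p : {poly C}) : (forall t, p.[t] = 0) -> p = 0.
Proof. by move=> hp; apply: (@poly_vanish _ 1) => //; apply: oner_neq0. Qed.

Lemma meval_map_horner n (x : 'I_n -> C) (P : {poly {mpoly C[n]}}) t :
  P.[t%:MP].@[x] = (map_poly (meval x) P).[t].
Proof. by rewrite -[t in RHS](mevalC x) horner_map. Qed.

(** This passes from invariance under a one-parameter group to being killed by its infinitesimal
    generator. *)
Lemma exp_series_const n d (p : {mpoly C[n]}) P x c k :
  exp_series (mder d) p P -> (forall t, P.[t%:MP].@[x] = c) ->
  (iter k.+1 (mder d) p).@[x] = 0.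
Proof.
move=> hP hc; rewrite -hP mevalMn.
have /(congr1 (fun q : {poly C} => q`_k.+1)) : map_poly (meval x) P - c%:P = 0.
  by apply: poly_vanish0 => t; rewrite hornerD hornerN hornerC -meval_map_horner hc subrr.
by rewrite coefB coefC coef_map coef0 subr0 => ->; rewrite mul0rn.
Qed.

Lemma meval_zero n (p : {mpoly C[n]}) : p.@[fun=> 0] = p@_0%MM.
Proof.
rewrite mevalE; have h m : m != 0%MM -> \prod_(i < n) (0 : C) ^+ m i = 0.
  move=> m0; have /existsP[i mi] : [exists i, m i != 0%N].
    apply: contraR m0 => /existsPn m0; apply/eqP/mnmP => i; rewrite mnm0E.
    by have := m0 i; rewrite negbK => /eqP.
  by rewrite (bigD1 i) //= expr0n (negPf mi) mul0r.
have [pm|pm] := boolP (0%MM \in msupp p); last first.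
  rewrite (memN_msupp_eq0 pm) big_seq big1 // => m mp.
  by rewrite h ?mulr0 //; apply: contraNneq pm => <-.
rewrite (bigD1_seq 0%MM) ?msupp_uniq //= big1 => [|i _]; last by rewrite mnm0E.
by rewrite mulr1 big1 ?addr0 // => m m0; rewrite h ?mulr0.
Qed.

(** Induction on the degree of the monomial: the partial derivatives of p also vanish everywhere,
    and in characteristic zero they determine every nonconstant coefficient. *)
Lemma mpoly_vanish n (p : {mpoly C[n]}) : (forall x, p.@[x] = 0) -> p = 0.
Proof.
move=> hp; apply/mpolyP => m; rewrite mcoeff0.
have [d] := ubnP (mdeg m); elim: d => // d IH in p m hp *.
have [->|m0] := eqVneq m 0%MM; first by rewrite -meval_zero hp.
have /existsP[i mi] : [exists i, m i != 0%N].
  apply: contraR m0 => /existsPn m0; apply/eqP/mnmP => i; rewrite mnm0E.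
  by have := m0 i; rewrite negbK => /eqP.
have mE : m = (m - U_(i) + U_(i))%MM by rewrite submK // lep1mP.
rewrite mE mdegD mdeg1 addn1 ltnS => /IH{}IH.
have dp : (forall x, p^`M(i).@[x] = 0).
  (* Translation by t in the i-th variable, which is the flow of the i-th partial derivative. *)
  pose s t := [tuple 'X_j + (j == i)%:R * t%:MP_[n] | j < n] : n.-tuple {mpoly C[n]}.
  have [j|P [hP eP] x] := @exp_comp _ _ (fun j => (j == i)%:R) s _ p.
    exists (('X_j)%:P + (j == i)%:R * 'X); split=> [k|t]; last first.
      by rewrite tnth_mktuple !hornerE; case: (j == i); rewrite ?hornerE.
    case: k => [|[|k]]; rewrite coefD coefC coefMX /= ?addr0 ?add0r ?mulr1n.
    - by [].
    - by rewrite mderX; case: (j == i); rewrite ?coefC // coef0.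
    - rewrite (_ : _`_k.+1 = 0) ?mul0rn; last by case: (j == i); rewrite ?coefC // coef0.
      rewrite -!iterS !iterSr mderX derivation_nat ?iter_derivation0 //; exact: mder_derivation.
  have /= := @exp_series_const _ _ _ _ x 0 0 hP; rewrite /mder.
  rewrite (bigD1 i) //= eqxx mulr1 big1 ?addr0 => [->// t|j /negPf ->].
    by rewrite -eP comp_mpoly_meval hp.
  by rewrite mulr0.
by have := IH _ dp; rewrite mcoeff_deriv => /eqP; rewrite mulrn_eq0 /= => /eqP.
Qed.
End NumField.

(** * Highest weight vectors *)

Section Sl2Modules.
Variables (C : numFieldType) (W : lmodType C) (e f : {linear W -> W}).

Definition lie_h v := e (f v) - f (e v).

Hypothesis he : forall v, lie_h (e v) = e (lie_h v) + 2%:R *: e v.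
Hypothesis hf : forall v, lie_h (f v) = f (lie_h v) - 2%:R *: f v.

Lemma lie_h_iter_f c v j : lie_h v = c *: v ->
  lie_h (iter j f v) = (c - (2 * j)%:R) *: iter j f v.
Proof.
move=> hv; elim: j => [|j IH]; first by rewrite subr0.
rewrite iterS hf IH linearZ /= -scalerBl; congr (_ *: _).
by rewrite mulnS natrD; ring.
Qed.

Lemma lie_h_iter_e c v j : lie_h v = c *: v ->
  lie_h (iter j e v) = (c + (2 * j)%:R) *: iter j e v.
Proof.
move=> hv; elim: j => [|j IH]; first by rewrite addr0.
rewrite iterS he IH linearZ /= -scalerDl; congr (_ *: _).
by rewrite mulnS natrD; ring.
Qed.

Lemma e_iter_f c v j : e v = 0 -> lie_h v = c *: v ->
  e (iter j.+1 f v) = (j.+1%:R * (c - j%:R)) *: iter j f v.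
Proof.
move=> ev hv; elim: j => [|j IH].
  by have := hv; rewrite /lie_h ev linear0 !subr0 mul1r.
have := lie_h_iter_f j.+1 hv; rewrite {1}/lie_h IH => /(canRL (subrK _)).
rewrite -!iterS => ->; rewrite linearZ /= -scalerDl; congr (_ *: _).
by rewrite mulnS natrD -!natr1 natrM; ring.
Qed.

(** Since e f^(K+1) v = (K+1)(c - K) f^K v, the vanishing of f^(K+1) v propagates down to v when c
    is not a natural number. *)
Lemma hw_eq0 c v : (exists K, iter K f v = 0) -> e v = 0 -> lie_h v = c *: v ->
  (forall j : nat, c != j%:R) -> v = 0.
Proof.
move=> [K]; elim: K => // K IH fv ev hv hc; apply: IH => //.
apply/eqP; have := e_iter_f K ev hv; rewrite fv linear0 => /esym/eqP.
by rewrite scaler_eq0 mulf_eq0 pnatr_eq0 subr_eq0 (negPf (hc K)).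
Qed.

(** The vector f^(r+1) v is again killed by e and has the negative weight - r - 2, so [hw_eq0]
    applies to it. *)
Lemma hw_iter_f_eq0 r v : (exists K, iter K f v = 0) -> e v = 0 ->
  lie_h v = r%:R *: v -> iter r.+1 f v = 0.
Proof.
move=> [K fv] ev hv; apply: (@hw_eq0 (r%:R - (2 * r.+1)%:R)).
- by exists K; rewrite -iterD addnC iterD fv; elim: (r.+1) => //= j ->; rewrite linear0.
- by rewrite (e_iter_f _ ev hv) subrr mulr0 scale0r.
- exact: lie_h_iter_f.
- move=> j; rewrite subr_eq -natrD eqr_nat; lia.
Qed.

(** The eigenvalue of e^j f^j on a highest weight vector of weight c. *)
Definition hw_coef (c : C) j := \prod_(i < j) (i.+1%:R * (c - i%:R)).

Lemma iter_e_iter_f c v j : e v = 0 -> lie_h v = c *: v ->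
  iter j e (iter j f v) = hw_coef c j *: v.
Proof.
move=> ev hv; elim: j => [|j IH]; first by rewrite /hw_coef big_ord0 scale1r.
rewrite iterSr (e_iter_f _ ev hv) /hw_coef big_ord_recr /=.
have -> : forall a w, iter j e (a *: w) = a *: iter j e w.
  by move=> a w; elim: j {IH} => //= j ->; rewrite linearZ.
by rewrite IH scalerA mulrC.
Qed.

Lemma hw_coef_neq0 r j : (j <= r)%N -> hw_coef r%:R j != 0.
Proof.
move=> jr; apply/prodf_neq0 => i _; rewrite mulf_neq0 ?pnatr_eq0 //.
by rewrite subr_eq0 eqr_nat; have := ltn_ord i; lia.
Qed.

End Sl2Modules.

(** * Coefficients of binary forms *)

Section BinaryForms.
Variables (C : numClosedFieldType) (k : nat) (m : 'I_k -> nat).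

Definition coef_index := {i : 'I_k & 'I_(m i).+1}.
Notation n := #|{: coef_index}|.
Notation A := {mpoly C[n]}.

Definition coef_rank i j : 'I_n := enum_rank (Tagged (fun i => 'I_(m i).+1) (inord j : 'I_(m i).+1)).

(* The coefficients of the forms, scaled so that [opE] and [opF] below act on  *)
(* them as [x d/dy] and [y d/dx] act on the monomials [x^(m i - j) y^j].       *)
Definition Y i j : A := if (j <= m i)%N then 'X_(coef_rank i j) else 0.

Definition genE (a : 'I_n) : A :=
  let u := enum_val a in (tagged u)%:R * Y (tag u) (tagged u).-1.
Definition genF (a : 'I_n) : A :=
  let u := enum_val a in (m (tag u) - tagged u)%:R * Y (tag u) (tagged u).+1.

Definition opE : A -> A := mder genE.
Definition opF : A -> A := mder genF.
HB.instance Definition _ := GRing.Linear.on opE.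
HB.instance Definition _ := GRing.Linear.on opF.

Lemma opE_der : derivation opE. Proof. exact: mder_derivation. Qed.
Lemma opF_der : derivation opF. Proof. exact: mder_derivation. Qed.

Lemma opE_natM j p : opE (j%:R * p) = j%:R * opE p.
Proof. exact: derivation_natM opE_der _ _. Qed.
Lemma opF_natM j p : opF (j%:R * p) = j%:R * opF p.
Proof. exact: derivation_natM opF_der _ _. Qed.

Lemma Y_large i j : (m i < j)%N -> Y i j = 0.
Proof. by rewrite /Y ltnNge => /negPf ->. Qed.

Lemma coef_rank_enum (a : 'I_n) :
  coef_rank (tag (enum_val a)) (tagged (enum_val a)) = a.
Proof. by rewrite /coef_rank inord_val; case: (enum_val a) (enum_valK a) => i j /= <-. Qed.

Lemma Y_var (a : 'I_n) : Y (tag (enum_val a)) (tagged (enum_val a)) = 'X_a.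
Proof. by rewrite /Y leq_ord coef_rank_enum. Qed.

Lemma coef_rankK i j : (j <= m i)%N ->
  enum_val (coef_rank i j) = Tagged (fun i => 'I_(m i).+1) (inord j : 'I_(m i).+1).
Proof. by rewrite enum_rankK. Qed.

Definition coef_pos (a : 'I_n) : 'I_k * nat :=
  (tag (enum_val a), nat_of_ord (tagged (enum_val a))).

Lemma coef_rank_pos i j : (j <= m i)%N -> coef_pos (coef_rank i j) = (i, j).
Proof. by move=> jm; rewrite /coef_pos coef_rankK //= inordK. Qed.

Lemma opE_Y i j : (j <= m i)%N -> opE (Y i j) = j%:R * Y i j.-1.
Proof.
by move=> jm; rewrite {1}/Y jm /opE mderX /genE coef_rankK //= inordK.
Qed.

Lemma opF_Y i j : opF (Y i j) = (m i - j)%:R * Y i j.+1.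
Proof.
have [jm|jm] := leqP j (m i); last by rewrite !Y_large ?linear0 ?mulr0 // leqW.
by rewrite {1}/Y jm /opF mderX /genF coef_rankK //= inordK.
Qed.

Definition opH p := opE (opF p) - opF (opE p).

Lemma opH_Y i j : opH (Y i j) = ((m i)%:R - (2 * j)%:R) * Y i j.
Proof.
have [jm|jm] := leqP j (m i); last first.
  by rewrite !Y_large // /opH !linear0 addr0 mulr0.
rewrite /opH opF_Y opE_Y // opE_natM opF_natM opF_Y.
case: j jm => [|j] jm /=.
  rewrite !mul0r !subr0; have [m0|m0] := posnP (m i); first by rewrite m0 !mul0r.
  by rewrite subn0 opE_Y // mul1r.
have [l ml] : exists l, (m i = l + j.+1)%N by exists (m i - j.+1)%N; rewrite subnK.
rewrite ml addnK (_ : l + j.+1 - j = l.+1)%N; last by lia.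
case: l ml => [|l] ml.
  by rewrite mul0r; ring.
by rewrite opE_Y ?ml ?addSn ?ltnS ?leq_addl //=; ring.
Qed.

Definition weight (a : 'I_n) : C :=
  (m (tag (enum_val a)))%:R - (2 * tagged (enum_val a))%:R.

Lemma opH_mder : opH =1 mder (fun a => weight a *: 'X_a).
Proof.
move=> p; rewrite /opH mder_commutator; apply: eq_bigr => a _; congr (_ * _).
rewrite -[genF a](mderX genF) -[genE a](mderX genE) -/opE -/opF.
by rewrite -Y_var -/(opH _) opH_Y -mul_mpolyC mpolyCB !mpolyC_nat.
Qed.

Lemma opH_der : derivation opH.
Proof.
by split=> p q; rewrite !opH_mder; [apply: (mder_derivation _).1 | apply: (mder_derivation _).2].
Qed.

Lemma opHZ c p : opH (c *: p) = c *: opH p.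
Proof. by rewrite !opH_mder mderZ. Qed.

Lemma opH_natM j p : opH (j%:R * p) = j%:R * opH p.
Proof. exact: derivation_natM opH_der _ _. Qed.

Lemma opHE p : opH (opE p) = opE (opH p) + 2%:R *: opE p.
Proof.
apply/eqP; rewrite addrC -subr_eq; apply/eqP.
rewrite !opH_mder mder_commutator scaler_sumr; apply: eq_bigr => a _.
rewrite scalerAr; congr (_ * _); rewrite -opH_mder -[weight a *: _](mderX (fun a => weight a *: 'X_a)).
rewrite -opH_mder -/opE -[genE a](mderX genE) -/opE -Y_var opH_Y.
have /= := leq_ord (tagged (enum_val a)).
set i := tag _; set j := nat_of_ord _ => jm.
rewrite opE_Y // opH_natM opH_Y.
have -> : (m i)%:R - (2 * j)%:R = ((m i)%:R - (2 * j)%:R)%:MP_[n] :> A.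
  by rewrite mpolyCB !mpolyC_nat.
rewrite mul_mpolyC linearZ /= opE_Y // -!mul_mpolyC mpolyCB !mpolyC_nat.
by case: j jm => [|j] jm /=; ring.
Qed.

Lemma opHF p : opH (opF p) = opF (opH p) - 2%:R *: opF p.
Proof.
apply/eqP; rewrite addrC -subr_eq -scaleNr; apply/eqP.
rewrite !opH_mder mder_commutator scaler_sumr; apply: eq_bigr => a _.
rewrite scalerAr; congr (_ * _); rewrite -opH_mder -[weight a *: _](mderX (fun a => weight a *: 'X_a)).
rewrite -opH_mder -/opF -[genF a](mderX genF) -/opF -Y_var opH_Y.
set i := tag _; set j := nat_of_ord _.
rewrite opF_Y opH_natM opH_Y.
have -> : (m i)%:R - (2 * j)%:R = ((m i)%:R - (2 * j)%:R)%:MP_[n] :> A.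
  by rewrite mpolyCB !mpolyC_nat.
rewrite mul_mpolyC linearZ /= opF_Y // -!mul_mpolyC mpolyCB mpolyCN !mpolyC_nat.
by ring.
Qed.

Lemma iter_opE_Y l i j : (j <= m i)%N -> iter l opE (Y i j) = (j ^_ l)%:R * Y i (j - l).
Proof.
move=> jm; elim: l => [|l IH]; first by rewrite subn0 mul1r.
rewrite iterS IH opE_natM opE_Y ?(leq_trans (leq_subr _ _)) //.
by rewrite mulrA -natrM ffactnSr subnS.
Qed.

Lemma iter_opF_Y l i j : iter l opF (Y i j) = ((m i - j) ^_ l)%:R * Y i (j + l).
Proof.
elim: l => [|l IH]; first by rewrite addn0 mul1r.
by rewrite iterS IH opF_natM opF_Y mulrA -natrM ffactnSr subnDA addnS.
Qed.

(** Closed form of exp(t E) on a coordinate, as a polynomial in t; [serF] is its analogue for F. *)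
Definition serE (a : 'I_n) : {poly A} :=
  let u := enum_val a in
  \poly_(l < (tagged u).+1) ('C(tagged u, l)%:R * Y (tag u) (tagged u - l)).
Definition serF (a : 'I_n) : {poly A} :=
  let u := enum_val a in
  \poly_(l < (m (tag u)).+1) ('C(m (tag u) - tagged u, l)%:R * Y (tag u) (tagged u + l)).

Lemma serEP a : exp_series opE 'X_a (serE a).
Proof.
move=> l; rewrite -Y_var iter_opE_Y ?leq_ord // /serE coef_poly ltnS.
case: leqP => [_|jl]; first by rewrite -mulrnAl -mulrnA bin_ffact.
by rewrite mul0rn ffact_small // mul0r.
Qed.

Lemma serFP a : exp_series opF 'X_a (serF a).
Proof.
move=> l; rewrite -Y_var iter_opF_Y /serF coef_poly ltnS.
case: leqP => [_|ml]; first by rewrite -mulrnAl -mulrnA bin_ffact.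
by rewrite mul0rn ffact_small ?mul0r // (leq_ltn_trans (leq_subr _ _)).
Qed.

Definition flowE t (x : 'I_n -> C) a := (serE a).[t%:MP].@[x].
Definition flowF t (x : 'I_n -> C) a := (serF a).[t%:MP].@[x].

Lemma flowEP p : exists P, exp_series opE p P /\
  forall t x, p.@[flowE t x] = P.[t%:MP].@[x].
Proof.
have [a|P [hP eP]] := @exp_comp _ _ genE (fun t => [tuple (serE a).[t%:MP] | a < n]) _ p.
  by exists (serE a); split=> [|t]; [exact: serEP | rewrite tnth_mktuple].
exists P; split=> // t x; rewrite -eP comp_mpoly_meval.
by apply: meval_eq => a; rewrite tnth_mktuple.
Qed.

Lemma flowFP p : exists P, exp_series opF p P /\
  forall t x, p.@[flowF t x] = P.[t%:MP].@[x].
Proof.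
have [a|P [hP eP]] := @exp_comp _ _ genF (fun t => [tuple (serF a).[t%:MP] | a < n]) _ p.
  by exists (serF a); split=> [|t]; [exact: serFP | rewrite tnth_mktuple].
exists P; split=> // t x; rewrite -eP comp_mpoly_meval.
by apply: meval_eq => a; rewrite tnth_mktuple.
Qed.

Lemma opE_nil p : exists K, iter K opE p = 0.
Proof.
by have [P [hP _]] := flowEP p; exists (size P); rewrite -hP nth_default ?mul0rn.
Qed.

Lemma opF_nil p : exists K, iter K opF p = 0.
Proof.
by have [P [hP _]] := flowFP p; exists (size P); rewrite -hP nth_default ?mul0rn.
Qed.

Definition hw (c : C) p := opE p = 0 /\ opH p = c *: p.
(** Here [c] is the opposite of the weight, so that highest and lowest weight vectors of dual type
    carry the same natural number. *)
Definition lw (c : C) p := opF p = 0 /\ opH p = - c *: p.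

Let swapF v : lie_h opF opE (opE v) = opE (lie_h opF opE v) - 2%:R *: opE v.
Proof.
by rewrite /lie_h -[LHS]opprB -/(opH _) opHE opprD -[opF (opE v) - _]opprB linearN.
Qed.

Let swapH v : lie_h opF opE v = - opH v. Proof. by rewrite opprB. Qed.

Lemma hw_iter_opF r p : hw r%:R p -> iter r.+1 opF p = 0.
Proof. by case=> Ep Hp; apply: (hw_iter_f_eq0 opHF (opF_nil p)). Qed.

Lemma lw_iter_opE r p : lw r%:R p -> iter r.+1 opE p = 0.
Proof.
case=> Fp Hp; apply: (hw_iter_f_eq0 swapF (opE_nil p)) => //.
by rewrite swapH Hp scaleNr opprK.
Qed.

Lemma hw0_opF p : hw 0 p -> opF p = 0.
Proof. exact: (@hw_iter_opF 0). Qed.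

Lemma lw0_opE p : lw 0 p -> opE p = 0.
Proof. exact: (@lw_iter_opE 0). Qed.

Lemma opE_iter_opF c p j : hw c p ->
  opE (iter j.+1 opF p) = (j.+1%:R * (c - j%:R)) *: iter j opF p.
Proof. by case=> Ep Hp; apply: (e_iter_f opHF). Qed.

Lemma opH_iter_opF c p j : hw c p -> opH (iter j opF p) = (c - (2 * j)%:R) *: iter j opF p.
Proof. by case=> _; apply: (lie_h_iter_f opHF). Qed.

Lemma opH_iter_opE c p j : lw c p -> opH (iter j opE p) = ((2 * j)%:R - c) *: iter j opE p.
Proof. by case=> _ /(lie_h_iter_e opHE j); rewrite addrC. Qed.

Lemma iter_opE_iter_opF c p j : hw c p -> iter j opE (iter j opF p) = hw_coef c j *: p.
Proof. by case=> Ep Hp; apply: (iter_e_iter_f opHF). Qed.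

Lemma hwM c d p q : hw c p -> hw d q -> hw (c + d) (p * q).
Proof.
move=> [Ep Hp] [Eq Hq]; split; first by rewrite opE_der.2 Ep Eq mul0r mulr0 addr0.
by rewrite opH_der.2 Hp Hq scalerDl scalerAl scalerAr.
Qed.

Lemma lwM c d p q : lw c p -> lw d q -> lw (c + d) (p * q).
Proof.
move=> [Fp Hp] [Fq Hq]; split; first by rewrite opF_der.2 Fp Fq mul0r mulr0 addr0.
by rewrite opH_der.2 Hp Hq opprD scalerDl scalerAl scalerAr.
Qed.

Lemma hwX c p j : hw c p -> hw (c *+ j) (p ^+ j).
Proof.
move=> hp; elim: j => [|j IH]; last by rewrite mulrS exprS; apply: hwM.
by split; rewrite ?expr0 ?mulr0n ?scale0r derivation1 //; [apply: opE_der | apply: opH_der].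
Qed.

Lemma lwX c p j : lw c p -> lw (c *+ j) (p ^+ j).
Proof.
move=> hp; elim: j => [|j IH]; last by rewrite mulrS exprS; apply: lwM.
by split; rewrite ?expr0 ?mulr0n ?oppr0 ?scale0r derivation1 //; [apply: opF_der | apply: opH_der].
Qed.

Lemma Y_zero i j : (Y i j).@[fun=> 0] = 0.
Proof. by rewrite /Y; case: ifP => _; rewrite ?mevalXU ?meval0. Qed.

Lemma opE_zero p : (opE p).@[fun=> 0] = 0.
Proof. by apply: meval0_mder => a; rewrite mevalM Y_zero mulr0. Qed.

Lemma opF_zero p : (opF p).@[fun=> 0] = 0.
Proof. by apply: meval0_mder => a; rewrite mevalM Y_zero mulr0. Qed.

Lemma opH_zero p : (opH p).@[fun=> 0] = 0.
Proof. by rewrite mevalB opE_zero opF_zero subrr. Qed.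

Lemma hw_zero c p : c != 0 -> hw c p -> p.@[fun=> 0] = 0.
Proof.
move=> c0 [_ Hp]; have := opH_zero p; rewrite Hp mevalZ => /eqP.
by rewrite mulf_eq0 (negPf c0) => /eqP.
Qed.

(* The invariant pairing of two copies of the irreducible representation of   *)
(* dimension [r + 1], one spanned by the [F^j X], the other by the [E^j Z].   *)
Definition pairing r (X Z : A) : A :=
  \sum_(j < r.+1) (\prod_(i < j) - (i.+1%:R * (r%:R - i%:R : C))^-1) *:
    (iter j opF X * iter j opE Z).

(** The coefficients of [pairing] make the sum telescope under [opE]. The two contributions to each
    product F^j X * E^(j+1) Z cancel, and the end terms vanish because E X = 0 and E^(r+1) Z = 0. *)
Lemma pairing_hw r X Z : hw r%:R X -> lw r%:R Z -> hw 0 (pairing r X Z).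
Proof.
move=> hX hZ; split; last first.
  rewrite scale0r (derivation_sum opH_der) big1 // => j _.
  rewrite opHZ opH_der.2 (opH_iter_opF _ hX) (opH_iter_opE _ hZ).
  by rewrite -scalerAl -scalerAr -scalerDl addrC subrKA subrr scale0r scaler0.
pose a j := \prod_(i < j) - (i.+1%:R * (r%:R - i%:R : C))^-1.
rewrite -[pairing r X Z]/(\sum_(j < r.+1) a j *: (iter j opF X * iter j opE Z)).
rewrite (derivation_sum opE_der).
pose g j := a j *: (iter j opF X * iter j.+1 opE Z).
under eq_bigr => j _ do rewrite linearZ /= opE_der.2 scalerDr.
rewrite big_split /= -[X in _ + X]/(\sum_(j < r.+1) g j) [X in _ + X]big_ord_recr /=.
rewrite [X in _ + (_ + X)]/g (lw_iter_opE hZ) mulr0 scaler0 addr0.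
rewrite big_ord_recl /= hX.1 mul0r scaler0 add0r -big_split big1 // => j _ /=.
rewrite -iterS (opE_iter_opF _ hX) /g /a /bump /= add1n big_ord_recr /=.
set b := \prod_(_ < _) _; set c := j.+1%:R * _.
have c0 : c != 0.
  rewrite mulf_neq0 ?pnatr_eq0 // subr_eq0 eqr_nat gtn_eqF //.
rewrite -scalerAl scalerA mulrN mulNr mulfVK // scaleNr addNr //.
Qed.

Lemma exp_series_killed (d : A -> A) p P : derivation d -> exp_series d p P -> d p = 0 ->
  P = p%:P.
Proof.
move=> dd hP dp; apply/polyP => j; rewrite coefC; have := hP j.
case: j => [|j]; first by rewrite mulr1n.
rewrite iterSr dp iter_derivation0 //.
by move/eqP; rewrite -mulr_natl mulf_eq0 -mpolyC_nat mpolyC_eq0 (negPf (fact_neq0 _ _)) => /eqP.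
Qed.

Lemma flowE_const p t x : opE p = 0 -> p.@[flowE t x] = p.@[x].
Proof.
by move=> Ep; have [P [hP ->]] := flowEP p; rewrite (exp_series_killed opE_der hP Ep) hornerC.
Qed.

Lemma flowF_const p t x : opF p = 0 -> p.@[flowF t x] = p.@[x].
Proof.
by move=> Fp; have [P [hP ->]] := flowFP p; rewrite (exp_series_killed opF_der hP Fp) hornerC.
Qed.

(** The sum telescopes by the relation between consecutive binomial coefficients. It serves for
    [opE] on the first coefficients of two forms and for [opF] on the coefficients read from the
    other end. *)
Lemma transvectant_der (D : A -> A) K (a b : nat -> A) : derivation D ->
  (forall l, (l <= K)%N -> D (a l) = l%:R * a l.-1) ->
  (forall l, (l <= K)%N -> D (b l) = l%:R * b l.-1) ->
  D (\sum_(l < K.+1) (-1) ^+ l * ('C(K, l)%:R * (a l * b (K - l)%N))) = 0.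
Proof.
move=> dD ha hb; rewrite (derivation_sum dD).
pose g l := (-1) ^+ l * ('C(K, l)%:R * ((K - l)%:R * (a l * b (K - l).-1))).
under eq_bigr => l _ do
  rewrite (derivation_signM dD) (derivation_natM dD) dD.2 ha ?leq_ord //
    hb ?leq_subr // mulrDr mulrDr.
rewrite big_split /= [X in _ + X](_ : _ = \sum_(l < K.+1) g l); last first.
  by apply: eq_bigr => l _; rewrite /g; ring.
rewrite [X in _ + X]big_ord_recr /= [g K]/g subnn mul0r !mulr0 addr0.
rewrite big_ord_recl /= !mul0r !mulr0 add0r -big_split big1 // => l _ /=.
rewrite /bump /= add1n /g exprS subnS.
have : 'C(K, l.+1)%:R * l.+1%:R = 'C(K, l)%:R * (K - l)%:R :> A.
  by rewrite -!natrM mulnC mul_bin_left mulnC.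
move: ('C(K, l.+1)%:R) (l.+1%:R) => u v uv.
have -> : -1 * (-1) ^+ l * (u * (v * a l * b (K - l).-1)) =
  - ((-1) ^+ l * ((u * v) * (a l * b (K - l).-1))) by ring.
by rewrite uv; ring.
Qed.

(** The leading coefficient of the K-th transvectant of the forms i and i'. *)
Definition transvectant K i i' : A :=
  \sum_(l < K.+1) (-1) ^+ l * ('C(K, l)%:R * (Y i l * Y i' (K - l))).

Lemma hw_transvectant K i i' : (K <= m i)%N -> (K <= m i')%N ->
  hw (m i + m i' - 2 * K)%:R (transvectant K i i').
Proof.
move=> Ki Ki'; split.
  by apply: transvectant_der opE_der _ _ => l lK; apply: opE_Y; apply: leq_trans lK _.
rewrite (derivation_sum opH_der) scaler_sumr; apply: eq_bigr => l _.
rewrite (derivation_signM opH_der) (derivation_natM opH_der) opH_der.2 !opH_Y.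
rewrite -mul_mpolyC mpolyC_nat; have lK : (l <= K)%N by rewrite -ltnS.
by rewrite !natrM !natrB ?natrD ?natrM; [ring | lia..].
Qed.

(** The trailing counterpart of the (2K)-th transvectant of the form i with itself. Its middle term
    is a nonzero multiple of the square of [Y i (m i - K)], which is why it detects that
    coordinate. *)
Definition low_square K i : A :=
  \sum_(l < (2 * K).+1) (-1) ^+ l *
    ('C(2 * K, l)%:R * (Y i (m i - l) * Y i (m i - (2 * K - l)))).

Lemma lw_low_square K i : (2 * K <= m i)%N -> lw (2 * m i - 4 * K)%:R (low_square K i).
Proof.
move=> Ki; have h l : (l <= 2 * K)%N -> opF (Y i (m i - l)) = l%:R * Y i (m i - l.-1).
  move=> lK; rewrite opF_Y subKn ?(leq_trans lK) //.
  by case: l lK => [|l] lK; rewrite ?mul0r // subnSK // (leq_trans lK).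
split; first exact: (@transvectant_der opF _ (fun l => Y i (m i - l)) (fun l => Y i (m i - l)) opF_der h h).
rewrite (derivation_sum opH_der) scaler_sumr; apply: eq_bigr => l _.
rewrite (derivation_signM opH_der) (derivation_natM opH_der) opH_der.2 !opH_Y.
rewrite -mul_mpolyC mpolyCN mpolyC_nat.
have lK : (l <= 2 * K)%N by rewrite -ltnS.
by rewrite !natrM !natrB ?natrM; [ring | lia..].
Qed.

Lemma low_square_zero K i : (low_square K i).@[fun=> 0] = 0.
Proof.
rewrite raddf_sum big1 // => l _ /=.
by rewrite !mevalM Y_zero mul0r !mulr0.
Qed.

End BinaryForms.

Arguments opE {C k m} p.
Arguments opF {C k m} p.
Arguments opH {C k m} p.
Arguments coef_pos {k m} a.
Arguments opE_der {C k m}.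
Arguments opF_der {C k m}.
Arguments opH_der {C k m}.

(** * Null points *)

Section NullPoints.
Variables (C : numClosedFieldType) (k : nat) (m : 'I_k -> nat).
Notation n := #|{: coef_index m}|.
Notation A := {mpoly C[n]}.
Notation Y := (@Y C k m).

(** All that is retained of the null cone: stability under both unipotent flows, and constancy of
    the invariants. *)
Definition null_closed (N : ('I_n -> C) -> Prop) :=
  (forall t x, N x -> N (flowE t x) /\ N (flowF t x)) /\
  (forall x h, N x -> opE h = 0 -> opF h = 0 -> h.@[x] = h.@[fun=> 0]).

Variable N : ('I_n -> C) -> Prop.
Hypothesis nullN : null_closed N.

Lemma null_hw0 x h : N x -> hw 0 h -> h.@[x] = h.@[fun=> 0].
Proof. by move=> Nx hh; apply: nullN.2 => //; [apply: hh.1 | apply: hw0_opF]. Qed.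

Lemma iter_opF_vanishX (P : A) x r :
  (forall j, (iter j.+1 opF P).@[x] = 0) -> forall j, (iter j.+1 opF (P ^+ r)).@[x] = 0.
Proof.
move=> hP; elim: r => [|r IH] j.
  by rewrite iterSr derivation1 ?iter_derivation0 ?meval0 //; apply: opF_der.
rewrite exprS iter_derivationM; last exact: opF_der.
rewrite raddf_sum big1 // => -[[|l] lj] _ /=; rewrite mevalMn mevalM -!iterS.
  by rewrite ?subn0 IH mulr0 mul0rn.
by rewrite hP mul0r mul0rn.
Qed.

Lemma pairing_eval r (X Z : A) x : (forall j, (iter j.+1 opF X).@[x] = 0) ->
  (pairing r X Z).@[x] = X.@[x] * Z.@[x].
Proof.
move=> hX; rewrite raddf_sum big_ord_recl [X in _ + X]big1 => [|j _].
  by rewrite /= big_ord0 addr0 scale1r mevalM.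
by rewrite /= mevalZ mevalM -iterS hX mul0r mulr0.
Qed.

(* At [x] the pairing of the powers [P ^+ r] and [s ^+ c], which is invariant, *)
(* reduces to its first term [P ^+ r * s ^+ c].                                *)
Lemma low_vanish c r (P s : A) x : N x -> (0 < c)%N -> hw c%:R P -> P.@[x] != 0 ->
  (forall j, (iter j.+1 opF P).@[x] = 0) ->
  lw r%:R s -> s.@[fun=> 0] = 0 -> s.@[x] = 0.
Proof.
move=> Nx c0 hP Px hF hs s0.
have [r0|r0] := posnP r.
  move: hs; rewrite r0 => hs; rewrite -s0; apply: (nullN.2) => //; last exact: hs.1.
  exact: lw0_opE.
have hX := hwX r hP; have hZ := lwX c hs; rewrite -mulrnA in hX; rewrite -mulrnA mulnC in hZ.
have := null_hw0 Nx (pairing_hw hX hZ).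
rewrite (pairing_eval _ _ (iter_opF_vanishX _ hF)) pairing_eval; last first.
  by move=> j; rewrite iterS opF_zero.
rewrite !rmorphXn /= s0 [0 ^+ c]expr0n gtn_eqF // mulr0 => /eqP.
by rewrite mulf_eq0 !expf_eq0 (negPf Px) andbF c0 => /eqP.
Qed.

(** Induction from the lowest weight upwards. By [low_vanish] the function [low_square K i] vanishes
    at x; each of its terms other than the middle one contains a coordinate already known to vanish,
    so the square of [Y i (m i - K)] vanishes too. *)
Lemma Y_vanish c (P : A) x : N x -> (0 < c)%N -> hw c%:R P -> P.@[x] != 0 ->
  (forall j, (iter j.+1 opF P).@[x] = 0) ->
  forall i j, (m i <= 2 * j)%N -> (Y i j).@[x] = 0.
Proof.
move=> Nx c0 hP Px hF i j mj.
have [jm|jm] := leqP j (m i); last by rewrite Y_large // meval0.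
suff h K : (2 * K <= m i)%N -> (Y i (m i - K)).@[x] = 0.
  by rewrite -(subKn jm) h //; lia.
elim/ltn_ind: K => K IH Km.
have := low_vanish Nx c0 hP Px hF (lw_low_square _ Km) (low_square_zero _ _ _ _).
rewrite raddf_sum (bigD1 (inord K)) //= big1 => [|l lK]; last first.
  rewrite !mevalM; have [lK'|lK'] := ltnP l K; first by rewrite IH ?mul0r ?mulr0 //; lia.
  have lK2 : (K < l)%N.
    rewrite ltn_neqAle lK' andbT eq_sym.
    by apply: contra lK => /eqP lK; apply/eqP/val_inj; rewrite /= inordK //; lia.
  by have ll := ltn_ord l; rewrite [(Y i (m i - (2 * K - l))).@[x]]IH ?mulr0 //; lia.
rewrite addr0 inordK; last by lia.
rewrite mevalM (_ : (2 * K - K = K)%N); last by lia.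
move/eqP; rewrite mulf_eq0 -[(-1) ^+ K]signr_odd.
have -> : (((-1) ^+ odd K).@[x] == 0) = false.
  by case: (odd K); rewrite ?expr0 ?expr1 ?mevalN meval1 ?oppr_eq0 oner_eq0.
rewrite !mevalM mulf_eq0 -mpolyC_nat mevalC pnatr_eq0 -leqn0 leqNgt bin_gt0.
by rewrite (_ : K <= 2 * K)%N /= ?mulf_eq0 ?orbb; [move/eqP | lia].
Qed.

(** Moving x along the flow of E makes F^c P a polynomial in the time whose coefficient of degree c
    is a nonzero multiple of P at x. As c > 0 it is nonconstant and has a root. *)
Lemma null_move c (P : A) x : N x -> (0 < c)%N -> hw c%:R P -> P.@[x] != 0 ->
  exists x', [/\ N x', forall p, opE p = 0 -> p.@[x'] = p.@[x] &
    (iter c opF P).@[x'] = 0].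
Proof.
move=> Nx c0 hP Px; have [Q [hQ eQ]] := flowEP (iter c opF P).
pose q := map_poly (meval x) Q.
have qc : q`_c != 0.
  apply: contra_neq Px => qc.
  have /(congr1 (meval x)) := hQ c; rewrite (iter_opE_iter_opF _ hP) mevalZ mevalMn.
  rewrite -coef_map -/q qc mul0rn => /esym/eqP.
  by rewrite mulf_eq0 (negPf (hw_coef_neq0 _ _)) // => /eqP.
have /closed_rootP[t /eqP qt] : size q != 1.
  by apply: contraNneq qc => sq; rewrite nth_default // sq.
exists (flowE t x); split; first by case: (nullN.1 t x Nx).
  by move=> p; apply: flowE_const.
by rewrite eQ meval_map_horner.
Qed.

End NullPoints.

(** * An obstruction to ideal membership *)

Section IdealTest.
Variables (C : numClosedFieldType) (k : nat) (m : 'I_k -> nat).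
Notation n := #|{: coef_index m}|.
Notation A := {mpoly C[n]}.
Notation Y := (@Y C k m).
Notation coef_rank := (@coef_rank k m).

Hypothesis m_gt0 : forall i, (0 < m i)%N.

(** Infinitesimal description of the invariants without constant term, the generators of the ideal
    under study. *)
Definition ideal_gen0 (h : A) := [/\ opE h = 0, opF h = 0 & h.@[fun=> 0] = 0].

Lemma ideal_gen0_weight h mu : ideal_gen0 h -> h@_mu != 0 ->
  \sum_a @weight C k m a *+ mu a = 0.
Proof.
case=> Eh Fh _ hmu; have : opH h = 0 by rewrite /opH Eh Fh !linear0 addr0.
rewrite opH_mder => /(congr1 (mcoeff mu)); rewrite mcoeff_mder_diag mcoeff0 => /eqP.
by rewrite mulf_eq0 (negPf hmu) orbF => /eqP.
Qed.

Lemma mderivU (a b : 'I_n) : ('X_a : A)^`M(b) = (a == b)%:R.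
Proof.
rewrite mderivX mnm1E; case: eqP => [->|_]; last by rewrite scale0r.
rewrite scale1r -mpolyX0; congr mpolyX.
by apply/mnmP => c; rewrite mnmBE subnn mnm0E.
Qed.

(** A linear term of weight 0 would be in some [Y i j] with m i = 2j, hence j > 0. Then E h would
    have a nonzero coefficient at [Y i j.-1], because no other coordinate is sent there by E. *)
Lemma ideal_gen0_linear h a : ideal_gen0 h -> h@_(U_(a)) = 0.
Proof.
move=> h0; apply/eqP; apply: contraT => ha.
have := ideal_gen0_weight h0 ha.
rewrite (bigD1 a) //= big1 => [|b /negPf ba]; last by rewrite mnm1E eq_sym ba mulr0n.
rewrite addr0 mnm1E eqxx mulr1n => /eqP; rewrite subr_eq0 eqr_nat => /eqP.
have [Eh _ _] := h0; set i := tag _; set j := nat_of_ord _ => mj.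
have ja : (j <= m i)%N by apply: leq_ord.
have j0 : (0 < j)%N by have := m_gt0 i; lia.
have jb : (j.-1 <= m i)%N by apply: leq_trans ja; apply: leq_pred.
pose b : 'I_n := coef_rank i j.-1.
have : (opE h)^`M(b).@[fun=> 0] = 0 by rewrite Eh mderiv0 meval0.
rewrite /opE /mder (raddf_sum (mderiv b)) (raddf_sum (meval _)) /= (bigD1 a) //=.
rewrite [X in _ + X]big1 => [|c ca].
  rewrite addr0 mderivM mevalD !mevalM Y_zero !mulr0 add0r.
  rewrite /genE -/i -/j -mpolyC_nat mderiv_mulC mevalM mevalC /Y jb mderivU eqxx meval1.
  rewrite mulr1 meval_zero mcoeff_deriv add0m mnm0E mulr1n => /eqP.
  by rewrite mulf_eq0 (negPf ha) pnatr_eq0 gtn_eqF.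
rewrite mderivM mevalD !mevalM Y_zero !mulr0 add0r /genE.
set i' := tag _; set j' := nat_of_ord _.
have [->|j'0] := posnP j'; first by rewrite mul0r mderiv0 meval0 mulr0.
have jc : (j' <= m i')%N by apply: leq_ord.
have jc' : (j'.-1 <= m i')%N by apply: leq_trans jc; apply: leq_pred.
rewrite -mpolyC_nat mderiv_mulC mevalM /Y jc' mderivU.
case: eqP => [/(congr1 (@coef_pos _ _)) E|_]; last by rewrite meval0 !mulr0.
case/eqP: ca; rewrite -(coef_rank_enum c) -(coef_rank_enum a) -/i -/i' -/j -/j'.
have [ei ej] : i' = i /\ j' = j by move: E; rewrite !coef_rank_pos // => -[ei ej]; split=> //; lia.
move: ei ej; rewrite /i' /j' => ei ej.
by rewrite ej; move: (tag _) ei => i0 ->.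
Qed.

Variables (s : seq ('I_k * nat)) (e : 'I_k * nat -> nat).
Hypothesis s_uniq : uniq s.
Hypothesis s_le : forall u, u \in s -> (u.2 <= m u.1)%N.

(* The coefficients listed in [s] become powers of 'X and the others 0.  If all *)
(* monomials of weight 0 and degree at least 2 in [s] are sent to multiples of  *)
(* 'X^D.+1, then so is the whole ideal generated by the invariants.            *)
Definition test_var (a : 'I_n) : {poly C} :=
  if coef_pos a \in s then 'X^(e (coef_pos a)) else 0.
Definition test : A -> {poly C} := mmap polyC test_var.
HB.instance Definition _ := GRing.RMorphism.on test.

Lemma test_Y i j : test (Y i j) = if (i, j) \in s then 'X^(e (i, j)) else 0.
Proof.
rewrite /Y; case: leqP => ji; last first.
  by rewrite rmorph0; case: ifP => // /s_le /=; rewrite leqNgt ji.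
by rewrite /test mmapX mmap1U /test_var coef_rank_pos.
Qed.

Let rk (u : 'I_k * nat) : 'I_n := coef_rank u.1 u.2.

Lemma test_big_supp (V : nmodType) (F : 'I_n -> V) :
  (forall a, coef_pos a \notin s -> F a = 0) ->
  \sum_a F a = \sum_(u <- s) F (rk u).
Proof.
have rk_uniq : uniq (map rk s).
  rewrite map_inj_in_uniq // => -[i j] [i' j'] /s_le /= ij /s_le /= ij' E.
  by rewrite -(coef_rank_pos ij) -[coef_rank i j]/(rk (i, j)) E coef_rank_pos.
move=> hF; rewrite -(big_map rk xpredT F) (big_uniq _ rk_uniq) /=.
rewrite [RHS]big_mkcond /=; apply: eq_bigr => a _; case: ifPn => // am; apply: hF.
apply: contra am => am; apply/mapP; eexists; first exact: am.
by rewrite /rk /= coef_rank_enum.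
Qed.

Variable D : nat.
Hypothesis test_ok : forall nu : 'I_k * nat -> nat,
  (\sum_(u <- s) nu u * m u.1 = \sum_(u <- s) nu u * (2 * u.2))%N ->
  (2 <= \sum_(u <- s) nu u)%N -> (D < \sum_(u <- s) nu u * e u)%N.

(** Every monomial of an invariant without constant term has weight 0 and degree at least 2. It is
    sent to 0 if it involves a coordinate outside [s], and otherwise to a power covered by
    [test_ok]. *)
Lemma test_ideal_gen0 h : ideal_gen0 h -> 'X^(D.+1) %| test h.
Proof.
move=> h0; rewrite /test /mmap; apply: (big_ind (fun p : {poly C} => 'X^(D.+1) %| p)) => [|p q hp hq|mu _].
  exact: dvdp0.
  exact: dvdp_add.
have [->|hmu] := eqVneq h@_mu 0; first by rewrite polyC0 mul0r dvdp0.
apply: dvdp_mull.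
have [/existsP[a /andP[as' mua]]|/existsPn mus] := boolP [exists a,
    (coef_pos a \notin s) && (mu a != 0%N)].
  rewrite /mmap1 (bigD1 a) //= {1}/test_var (negPf as') expr0n (negPf mua) mul0r.
  exact: dvdp0.
have mu0 a : coef_pos a \notin s -> mu a = 0%N.
  by move=> as'; have := mus a; rewrite as' /= negbK => /eqP.
have -> : mmap1 test_var mu = 'X^(\sum_(u <- s) mu (rk u) * e u).
  have <- : (\sum_a mu a * e (coef_pos a) =
      \sum_(u <- s) mu (rk u) * e u)%N.
    rewrite test_big_supp => [|a as']; last by rewrite mu0.
    rewrite big_seq [RHS]big_seq; apply: eq_bigr => -[i j] /s_le /= ij.
    by rewrite coef_rank_pos.
  rewrite expr_sum; apply: eq_bigr => a _; rewrite /test_var; case: ifPn => [_|as'].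
    by rewrite -exprM mulnC.
  by rewrite mu0 // !expr0.
have degmu : mdeg mu = (\sum_(u <- s) mu (rk u))%N.
  by rewrite mdegE test_big_supp // => a; apply: mu0.
apply: dvdp_exp2l; apply: (test_ok (nu := fun u => mu (rk u))).
  have := ideal_gen0_weight h0 hmu.
  rewrite test_big_supp => [|a as']; last by rewrite mu0 // mulr0n.
  have -> : \sum_(u <- s) @weight C k m (rk u) *+ mu (rk u) =
      \sum_(u <- s) ((mu (rk u) * m u.1)%:R - (mu (rk u) * (2 * u.2))%:R).
    rewrite big_seq [RHS]big_seq; apply: eq_bigr => -[i j] /s_le /= ij.
    rewrite /weight -[tag _]/(coef_pos _).1 -[nat_of_ord _]/(coef_pos _).2.
    by rewrite coef_rank_pos //= mulrnBl -!mulrnA !(mulnC _ (mu _)).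
  by rewrite sumrB -!natr_sum => /eqP; rewrite subr_eq0 eqr_nat => /eqP.
rewrite -degmu ltnNge; apply: contra hmu; rewrite leq_eqVlt ltnS leqn0 => /orP[].
  by rewrite mdeg_eq1 => /existsP[a /eqP->]; rewrite ideal_gen0_linear.
by rewrite mdeg_eq0 => /eqP->; case: h0 => _ _; rewrite meval_zero => ->.
Qed.

Lemma test_ideal (l : seq (A * A)) : (forall x, x \in l -> ideal_gen0 x.2) ->
  'X^(D.+1) %| test (\sum_(x <- l) x.1 * x.2).
Proof.
move=> hl; rewrite rmorph_sum big_seq.
apply: (big_ind (fun p : {poly C} => 'X^(D.+1) %| p)) => [|p q hp hq|x /hl hx].
- exact: dvdp0.
- exact: dvdp_add.
by rewrite rmorphM; apply: dvdp_mull; apply: test_ideal_gen0.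
Qed.

End IdealTest.

(** * Covariants excluding pairs of summands *)

Section Exclusions.
Variables (C : numClosedFieldType) (k : nat) (m : 'I_k -> nat).
Notation n := #|{: coef_index m}|.
Notation A := {mpoly C[n]}.
Notation Y := (@Y C k m).
Notation transvectant := (@transvectant C k m).

Hypothesis m_gt0 : forall i, (0 < m i)%N.
Variable N : ('I_n -> C) -> Prop.
Hypothesis nullN : null_closed N.
Hypothesis coreducedN : forall phi : A, (forall x, N x -> phi.@[x] = 0) ->
  exists l : seq (A * A),
    (forall x, x \in l -> ideal_gen0 x.2) /\ phi = \sum_(x <- l) x.1 * x.2.

(* The points of the sum of the positive weight spaces. *)
Definition positive (x : 'I_n -> C) := forall i j, (m i <= 2 * j)%N -> (Y i j).@[x] = 0.

Lemma not_coreduced (s : seq ('I_k * nat)) e D (c : C) (phi : A) :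
  uniq s -> (forall u, u \in s -> (u.2 <= m u.1)%N) ->
  (forall nu : 'I_k * nat -> nat,
    (\sum_(u <- s) nu u * m u.1 = \sum_(u <- s) nu u * (2 * u.2))%N ->
    (2 <= \sum_(u <- s) nu u)%N -> (D < \sum_(u <- s) nu u * e u)%N) ->
  c != 0 -> test s e phi = c *: 'X^D ->
  ~ (forall x, N x -> phi.@[x] = 0).
Proof.
move=> s_uniq s_le ok c0 tphi /coreducedN[l [hl El]].
have := test_ideal m_gt0 s_uniq s_le ok hl; rewrite -El tphi => /dvdp_leq.
by rewrite scaler_eq0 negb_or c0 monic_neq0 ?monicXn // => /(_ isT); rewrite size_scale // !size_polyXn ltnn.
Qed.

Lemma iter_opF_above r (P : A) j : hw r%:R P -> (r < j)%N -> iter j opF P = 0.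
Proof.
move=> hP rj; rewrite -(subnK rj) iterD hw_iter_opF //.
by rewrite iter_derivation0 //; apply: opF_der.
Qed.

(** Combines [null_move] and [Y_vanish]; what remains to be checked for each P is that the vanishing
    of the last coefficient F^r P at a null point forces that of the intermediate ones. *)
Lemma null_positive r (P : A) x : N x -> (0 < r)%N -> hw r%:R P -> P.@[x] != 0 ->
  (forall x', N x' -> (iter r opF P).@[x'] = 0 ->
     forall j, (0 < j < r)%N -> (iter j opF P).@[x'] = 0) ->
  exists x', [/\ N x', forall p, opE p = 0 -> p.@[x'] = p.@[x],
    positive x' & forall j, (iter j.+1 opF P).@[x'] = 0].
Proof.
move=> Nx r0 hP Px hF; have [x' [Nx' x'x rx']] := null_move nullN Nx r0 hP Px.
have hF' j : (iter j.+1 opF P).@[x'] = 0.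
  have [jr|rj|->//] := ltngtP j.+1 r; first by apply: hF => //; rewrite jr.
  by rewrite (iter_opF_above hP rj) meval0.
have Px' : P.@[x'] != 0 by rewrite x'x // hP.1.
by exists x'; split=> //; apply: (Y_vanish nullN Nx' r0 hP Px' hF').
Qed.

(** Up to sign, the discriminant of the quadratic form with coefficients P, F P and F^2 P / 2. *)
Lemma disc_hw2 (P : A) : hw 2%:R P ->
  hw 0 (2%:R * (P * opF (opF P)) - (opF P) ^+ 2).
Proof.
move=> hP; have e1 : opE (opF P) = 2%:R * P.
  by rewrite (opE_iter_opF 0 hP) mul1r subr0 -mul_mpolyC mpolyC_nat.
have e2 : opE (opF (opF P)) = 2%:R * opF P.
  rewrite (opE_iter_opF 1 hP) /= -mul_mpolyC (_ : 2%:R * (2%:R - 1%:R) = 2%:R).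
    by rewrite mpolyC_nat.
  by rewrite (_ : 2%:R - 1%:R = 1) ?mulr1 //; ring.
have E0 : opE (2%:R * (P * opF (opF P)) - (opF P) ^+ 2) = 0.
  rewrite (derivationB opE_der) opE_natM opE_der.2 (derivationX opE_der _ 1) e1 e2 hP.1.
  by ring.
have F3 : opF (opF (opF P)) = 0 by apply: (hw_iter_opF (r := 2)).
have F0 : opF (2%:R * (P * opF (opF P)) - (opF P) ^+ 2) = 0.
  rewrite (derivationB opF_der) opF_natM opF_der.2 (derivationX opF_der _ 1) F3.
  by ring.
by split=> //; rewrite /opH E0 F0 !linear0 addr0 scale0r.
Qed.

Lemma null_hw2 (P : A) x : N x -> hw 2%:R P ->
  (iter 2 opF P).@[x] = 0 -> (opF P).@[x] = 0.
Proof.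
move=> Nx hP F2; have := null_hw0 nullN Nx (disc_hw2 hP).
rewrite expr2 !mevalB !mevalM -/(iter 2 opF P) F2 !opF_zero.
rewrite !mulr0 subrr sub0r => /eqP.
by rewrite oppr_eq0 mulf_eq0 orbb => /eqP.
Qed.

(** For r = 1 there is no intermediate coefficient, and for r = 2 the vanishing of the discriminant
    takes care of it. So P need only be tested at positive points. *)
Lemma null_vanish r (P : A) : (0 < r <= 2)%N -> hw r%:R P ->
  (forall x, N x -> positive x -> P.@[x] = 0) -> forall x, N x -> P.@[x] = 0.
Proof.
case/andP=> r0 r2 hP hx x Nx; apply/eqP; apply: contraT => Px.
have [x' Nx'|x' [Nx' x'x pos _]] := null_positive Nx r0 hP Px.
  case: r r0 r2 hP => [|[|[|]]] // _ _ hP Fr j; first by case: j => [|[|]].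
  by case: j => [|[|]] //= _; apply: null_hw2.
by move: Px; rewrite -(x'x P hP.1) hx ?eqxx.
Qed.

Lemma transvectant_vanish K i i' x : positive x ->
  (forall l, (l <= K)%N -> (m i <= 2 * l)%N || (m i' <= 2 * (K - l))%N) ->
  (transvectant K i i').@[x] = 0.
Proof.
move=> pos hK; rewrite raddf_sum big1 //= => l _; rewrite !mevalM.
have /orP[/pos->|/pos->] := hK l (leq_ord l); first by rewrite mul0r !mulr0.
by rewrite !mulr0.
Qed.

Lemma test_transvectant_cross e K i i' : (K <= m i')%N -> i != i' ->
  test [:: (i, 0%N); (i', K)] e (transvectant K i i') =
  1 *: 'X^(e (i, 0%N) + e (i', K)).
Proof.
move=> Ki ii'.
have s_le u : u \in [:: (i, 0%N); (i', K)] -> (u.2 <= m u.1)%N.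
  by rewrite !inE => /orP[/eqP->|/eqP->].
rewrite rmorph_sum big_ord_recl big1 => [|l _]; last first.
  rewrite !rmorphM /= (test_Y _ _ s_le) !inE !xpair_eqE eqxx (negPf ii') /=.
  by rewrite mul0r !mulr0.
rewrite addr0 scale1r expr0 bin0 !mul1r rmorphM /= subn0 !(test_Y _ _ s_le) !inE !eqxx orbT.
by rewrite exprD.
Qed.

(** With K = [m i'], the K-th transvectant has weight 1, and each product in it has a factor of
    nonpositive weight. The two surviving coordinates have weights K + 1 and - K, so weight 0
    monomials have degree at least 2K + 1, hence at least 3, whereas the transvectant has degree
    2. *)
Lemma no_consecutive i i' : m i <> (m i').+1.
Proof.
move=> mi; have ii' : i != i' by apply/eqP => E; move: mi; rewrite E; lia.
have hK := @hw_transvectant C k m (m i') i i'.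
apply: (@not_coreduced [:: (i, 0%N); (i', m i')] (fun=> 1%N) 2 1 _ _ _ _ _
  (test_transvectant_cross _ (leqnn _) ii')).
- by rewrite /= inE xpair_eqE (negPf ii').
- by move=> u; rewrite !inE => /orP[/eqP->|/eqP->].
- move=> nu; rewrite !big_cons !big_nil /= mi.
  by move: (nu _) (nu _) (m_gt0 i') => [|[|a]] [|[|b]]; nia.
- exact: oner_neq0.
have h1 : hw 1%:R (transvectant (m i') i i').
  by rewrite (_ : 1 = m i + m i' - 2 * m i')%N; [apply: hK; lia | lia].
apply: (null_vanish (r := 1)) => // x Nx pos.
by apply: transvectant_vanish => // l lK; lia.
Qed.

(** The order K is chosen so that the transvectant has weight 2. *)
Lemma no_even_pair i i' : i != i' -> ~~ odd (m i) -> ~~ odd (m i') ->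
  (m i = m i' \/ m i = (m i').+2) -> False.
Proof.
move=> ii' ei ei' mii'; pose K := ((m i + m i').-2)./2.
have m0 := m_gt0 i; have m0' := m_gt0 i'.
have [KE Ki Ki'] : [/\ (2 * K + 2 = m i + m i')%N, (K <= m i)%N & (K <= m i')%N].
  by rewrite /K; split; lia.
have mK : (K.+1 = m i \/ K.+2 = m i)%N by lia.
have h2 : hw 2%:R (transvectant K i i').
  by rewrite (_ : 2 = m i + m i' - 2 * K)%N; [apply: hw_transvectant | lia].
(* When both degrees are 2, the coordinate [Y i' K] has weight 0 and its square is a weight 0
   monomial of degree 2. Giving that coordinate exponent 2 sends the square to X^4, beyond the image
   X^3 of the transvectant. *)
pose e (u : 'I_k * nat) := if u.2 == 0%N then 1%N else 2.
apply: (@not_coreduced [:: (i, 0%N); (i', K)] e _ 1 _ _ _ _ _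
  (test_transvectant_cross _ Ki' ii')).
- by rewrite /= inE xpair_eqE (negPf ii').
- by move=> u; rewrite !inE => /orP[/eqP->|/eqP->].
- move=> nu; rewrite !big_cons !big_nil /= /e /=.
  have -> : (K == 0%N) = false by lia.
  by move: (nu _) (nu _) => [|[|a]] [|[|b]]; nia.
- exact: oner_neq0.
apply: (null_vanish (r := 2)) => // x Nx pos.
by apply: transvectant_vanish => // l lK; lia.
Qed.

(** The three coordinates have weights 3, -1 and -1, so the degree of a weight 0 monomial is a
    multiple of 4. *)
Lemma test_ok3 (i i' : 'I_k) j : (0 < j)%N -> (m i = 3)%N -> (m i' = 2 * j - 1)%N ->
  forall nu : 'I_k * nat -> nat,
    (\sum_(u <- [:: (i, 0); (i, 2); (i', j)]) nu u * m u.1 =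
     \sum_(u <- [:: (i, 0); (i, 2); (i', j)]) nu u * (2 * u.2))%N ->
    (2 <= \sum_(u <- [:: (i, 0); (i, 2); (i', j)]) nu u)%N ->
    (3 < \sum_(u <- [:: (i, 0); (i, 2); (i', j)]) nu u * 1)%N.
Proof.
move=> j0 mi mi' nu; rewrite !big_cons !big_nil /= mi mi'.
move: (nu _) (nu _) (nu _) => a b c.
have : (c * (2 * j - 1) + c = c * (2 * j))%N by rewrite -mulnSr; congr (_ * _)%N; lia.
by lia.
Qed.

(** The Hessian of a cubic and its successive images under [opF]. *)
Let hess0 i := Y i 0 * Y i 2 - Y i 1 * Y i 1.
Let hess1 i := Y i 0 * Y i 3 - Y i 1 * Y i 2.
Let hess2 i := 2%:R * (Y i 1 * Y i 3 - Y i 2 * Y i 2).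

Let dE := @opE_der C k m.
Let dH := @opH_der C k m.
Let opEs := (derivationB dE, @opE_natM C k m, dE.2, dE.1).
Let opHs := (derivationB dH, @opH_natM C k m, dH.2, dH.1).

(** The covariant [phi] contracts the Hessian of the cubic with the linear form. *)
Lemma no_three_one i i' : m i = 3%N -> m i' = 1%N -> False.
Proof.
move=> mi mi'; have ii' : i != i' by apply/eqP => E; move: mi; rewrite E mi'.
pose phi := 2%:R * (hess0 i * Y i' 1) - hess1 i * Y i' 0.
have hphi : hw 1%:R phi.
  split.
    rewrite /phi /hess0 /hess1 !opEs !opE_Y ?mi ?mi' //=; ring.
  rewrite -mul_mpolyC mpolyC_nat /phi /hess0 /hess1.
  rewrite !opHs !opH_Y mi mi'.
  ring.
have s_le u : u \in [:: (i, 0%N); (i, 2); (i', 1%N)] -> (u.2 <= m u.1)%N.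
  by rewrite !inE => /or3P[/eqP->|/eqP->|/eqP->] /=; rewrite ?mi ?mi'.
apply: (@not_coreduced [:: (i, 0); (i, 2); (i', 1)]%N (fun=> 1%N) 3 2%:R phi) => //.
- by rewrite /= !inE !xpair_eqE (negPf ii') /= andbF.
- by apply: test_ok3; rewrite ?mi'.
- by rewrite pnatr_eq0.
- rewrite /phi /hess0 /hess1 !(rmorphB, rmorphM, rmorph_nat) /= !(test_Y _ _ s_le).
  rewrite !inE !xpair_eqE !eqxx /= 1?[i' == i]eq_sym ?(negPf ii') /=.
  rewrite -mul_polyC rmorph_nat; ring.
apply: (null_vanish (r := 1)) => // x Nx pos.
rewrite /phi /hess0 /hess1 !(mevalB, mevalM).
rewrite (pos i 2%N) ?mi // (pos i 3%N) ?mi // (pos i' 1%N) ?mi' //.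
by rewrite !(mulr0, mul0r, subr0, addr0).
Qed.

(** The covariant [phi] is the second transvectant of the Hessian of one cubic with the other
    cubic. *)
Lemma no_three_three i i' : i != i' -> m i = 3%N -> m i' = 3%N -> False.
Proof.
move=> ii' mi mi'.
pose phi := 2%:R * (hess0 i * Y i' 2) - 2%:R * (hess1 i * Y i' 1) + hess2 i * Y i' 0.
have hphi : hw 1%:R phi.
  split.
    rewrite /phi /hess0 /hess1 /hess2 !opEs !opE_Y ?mi ?mi' //=; ring.
  rewrite -mul_mpolyC mpolyC_nat /phi /hess0 /hess1 /hess2 !opHs !opH_Y mi mi'.
  ring.
have s_le u : u \in [:: (i, 0%N); (i, 2); (i', 2)] -> (u.2 <= m u.1)%N.
  by rewrite !inE => /or3P[/eqP->|/eqP->|/eqP->] /=; rewrite ?mi ?mi'.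
apply: (@not_coreduced [:: (i, 0); (i, 2); (i', 2)]%N (fun=> 1%N) 3 2%:R phi) => //.
- by rewrite /= !inE !xpair_eqE (negPf ii') /= andbF.
- by apply: test_ok3; rewrite ?mi'.
- by rewrite pnatr_eq0.
- rewrite /phi /hess0 /hess1 /hess2 !(rmorphB, rmorphD, rmorphM, rmorph_nat) /= !(test_Y _ _ s_le).
  rewrite !inE !xpair_eqE !eqxx /= 1?[i' == i]eq_sym ?(negPf ii') /=.
  rewrite -mul_polyC rmorph_nat; ring.
apply: (null_vanish (r := 1)) => // x Nx pos.
rewrite /phi /hess0 /hess1 /hess2 !(mevalB, mevalD, mevalM).
rewrite (pos i 2%N) ?mi // (pos i 3%N) ?mi // (pos i' 2%N) ?mi' //.
by rewrite !(mulr0, mul0r, subr0, addr0).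
Qed.

(** The covariant [phi] contracts the quartic with the square of the linear form. The weights 4 and
    -1 of the test coordinates force weight 0 monomials to have degree at least 5. *)
Lemma no_four_one i i' : m i = 4%N -> m i' = 1%N -> False.
Proof.
move=> mi mi'; have ii' : i != i' by apply/eqP => E; move: mi; rewrite E mi'.
pose phi := Y i 0 * (Y i' 1 * Y i' 1) - 2%:R * (Y i 1 * (Y i' 0 * Y i' 1))
  + Y i 2 * (Y i' 0 * Y i' 0).
have hphi : hw 2%:R phi.
  split.
    rewrite /phi !opEs !opE_Y ?mi ?mi' //=; ring.
  rewrite -mul_mpolyC mpolyC_nat /phi !opHs !opH_Y mi mi'.
  ring.
have s_le u : u \in [:: (i, 0%N); (i', 1%N)] -> (u.2 <= m u.1)%N.
  by rewrite !inE => /orP[/eqP->|/eqP->] /=; rewrite ?mi ?mi'.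
apply: (@not_coreduced [:: (i, 0); (i', 1)]%N (fun=> 1%N) 3 1 phi) => //.
- by rewrite /= !inE !xpair_eqE (negPf ii').
- by move=> nu; rewrite !big_cons !big_nil /= mi mi'; lia.
- exact: oner_neq0.
- rewrite /phi !(rmorphB, rmorphD, rmorphM, rmorph_nat) /= !(test_Y _ _ s_le).
  rewrite !inE !xpair_eqE !eqxx /= 1?[i' == i]eq_sym ?(negPf ii') /=.
  rewrite scale1r; ring.
apply: (null_vanish (r := 2)) => // x Nx pos.
rewrite /phi !(mevalB, mevalD, mevalM).
rewrite (pos i 2%N) ?mi // (pos i' 1%N) ?mi' //.
by rewrite !(mulr0, mul0r, subr0, addr0).
Qed.

End Exclusions.

(** * The Hessian of a quartic covariant *)

Section SingleForm.
Variables (C : numClosedFieldType) (k : nat) (m : 'I_k -> nat).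
Notation n := #|{: coef_index m}|.
Notation A := {mpoly C[n]}.
Notation Y := (@Y C k m).
Notation transvectant := (@transvectant C k m).

(* The Hessian of the Hessian [h] of a quartic [q] with vanishing invariants    *)
(* [I] and [J] is [8 J q - 4 I h = 0], and a form with zero Hessian is a power *)
(* of a linear form.                                                           *)
Lemma quartic_hessian_coefs (q0 q1 q2 q3 q4 : C) :
  let h0 := 4%:R * (q0 * q2) - 3%:R * (q1 * q1) in
  let h1 := 4%:R * (q0 * q3) - 2%:R * (q1 * q2) in
  let h2 := 4%:R * (q0 * q4) + 2%:R * (q1 * q3) - 2%:R * (q2 * q2) in
  let h3 := 6%:R * (q1 * q4) - 2%:R * (q2 * q3) in
  let h4 := 4%:R * (q2 * q4) - 2%:R * (q3 * q3) in
  2%:R * (q0 * q4) - 2%:R * (q1 * q3) + q2 * q2 = 0 ->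
  q0 * h4 - q1 * h3 + q2 * h2 - q3 * h1 + q4 * h0 = 0 ->
  h4 = 0 -> [/\ h1 = 0, h2 = 0 & h3 = 0].
Proof.
move=> h0 h1 h2 h3 h4 I0 J0 h40.
have sq0 (z : C) j : z * z *+ j.+1 = 0 -> z = 0.
  by move/eqP; rewrite mulrn_eq0 mulf_eq0 orbb => /eqP.
(* The last, middle and first coefficients of the identity for the Hessian of h, solved for the
   squares of h3, h2 and h1. With h4 = 0 they give h3 = 0, then h2 = 0, then h1 = 0. *)
have e3 : h3 * h3 *+ 2 = 4%:R * (h2 * h4) +
    4%:R * ((2%:R * (q0 * q4) - 2%:R * (q1 * q3) + q2 * q2) * h4) -
    8%:R * ((q0 * h4 - q1 * h3 + q2 * h2 - q3 * h1 + q4 * h0) * q4).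
  by rewrite /h0 /h1 /h2 /h3 /h4; ring.
have e2 : h2 * h2 *+ 2 = 4%:R * (h0 * h4) + 2%:R * (h1 * h3) +
    4%:R * ((2%:R * (q0 * q4) - 2%:R * (q1 * q3) + q2 * q2) * h2) -
    8%:R * ((q0 * h4 - q1 * h3 + q2 * h2 - q3 * h1 + q4 * h0) * q2).
  by rewrite /h0 /h1 /h2 /h3 /h4; ring.
have e1 : h1 * h1 *+ 3 = 4%:R * (h0 * h2) +
    4%:R * ((2%:R * (q0 * q4) - 2%:R * (q1 * q3) + q2 * q2) * h0) -
    8%:R * ((q0 * h4 - q1 * h3 + q2 * h2 - q3 * h1 + q4 * h0) * q0).
  by rewrite /h0 /h1 /h2 /h3 /h4; ring.
move: e1 e2 e3 I0 J0 h40; move: h0 h1 h2 h3 h4 (_ + q2 * q2) (_ + q4 * h0).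
move=> h0 h1 h2 h3 h4 I J e1 e2 e3 I0 J0 h40.
move: e3; rewrite I0 J0 h40 !(mulr0, mul0r, subr0, addr0) => /sq0 h30.
move: e2; rewrite I0 J0 h40 h30 !(mulr0, mul0r, subr0, addr0) => /sq0 h20.
by move: e1; rewrite I0 J0 h20 !(mulr0, mul0r, subr0, addr0) => /sq0 h10.
Qed.

Lemma meval_nat (x : 'I_n -> C) j : (j%:R : A).@[x] = j%:R.
Proof. by rewrite -mpolyC_nat mevalC. Qed.

Lemma iter_opF_sign j l (p : A) : iter j opF ((-1) ^+ l * p) = (-1) ^+ l * iter j opF p.
Proof. by elim: j => //= j ->; rewrite (derivation_signM opF_der). Qed.

Lemma iter_opF_natM j l (p : A) : iter j opF (l%:R * p) = l%:R * iter j opF p.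
Proof. by elim: j => //= j ->; rewrite opF_natM. Qed.

Lemma iter_opF_transvectant j K i i' :
  iter j opF (transvectant K i i') =
  \sum_(l < K.+1) \sum_(c < j.+1)
    (-1) ^+ l * ('C(K, l) * (m i - l) ^_ c * (m i' - (K - l)) ^_ (j - c) * 'C(j, c))%:R *
      (Y i (l + c) * Y i' (K - l + (j - c))).
Proof.
rewrite (big_morph (iter j opF) (iter_derivationD opF_der j) (iter_derivation0 opF_der j)).
apply: eq_bigr => l _; rewrite iter_opF_sign iter_opF_natM (iter_derivationM opF_der).
rewrite !mulr_sumr; apply: eq_bigr => c _; rewrite !iter_opF_Y !natrM -mulr_natl; ring.
Qed.

Lemma iter_transvectant_vanish j K i i' x : positive x ->
  (forall a b, (a + b = K + j)%N -> (m i <= 2 * a)%N || (m i' <= 2 * b)%N) ->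
  (iter j opF (transvectant K i i')).@[x] = 0.
Proof.
move=> pos hK; rewrite iter_opF_transvectant raddf_sum big1 //= => l _.
rewrite raddf_sum big1 //= => c _; rewrite !mevalM.
have ab : (l + c + (K - l + (j - c)) = K + j)%N.
  by have := ltn_ord l; have := ltn_ord c; lia.
by have /orP[/pos->|/pos->] := hK _ _ ab; rewrite ?mul0r !mulr0.
Qed.

(** All products have index sum K + j < m i. Hence only the pairs of indices 0 and m i - 1 survive,
    in the two extreme terms of the sum, and these have equal sign because K is even. *)
Lemma test_iter_transvectant j K i : (0 < K)%N -> (K + j < m i)%N -> (j.+1 < m i)%N ->
  ~~ odd K ->
  test [:: (i, 0%N); (i, (m i).-1)] (fun=> 1%N) (iter j opF (transvectant K i i)) =
  (if K + j == (m i).-1 then 2 * (m i - K) ^_ j else 0)%N%:R *: 'X^2.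
Proof.
move=> K0 Kj j0 oK; set s := [:: _; _].
have s_le u : u \in s -> (u.2 <= m u.1)%N.
  by rewrite !inE => /orP[/eqP->|/eqP->] //=; apply: leq_pred.
have tY a : test s (fun=> 1%N) (Y i a) = if (a == 0%N) || (a == (m i).-1) then 'X else 0.
  by rewrite (test_Y _ _ s_le) !inE !xpair_eqE eqxx.
pose X a : {poly C} := if (a == 0%N) || (a == (m i).-1) then 'X else 0.
pose w l c := ('C(K, l) * (m i - l) ^_ c * (m i - (K - l)) ^_ (j - c) * 'C(j, c))%N.
pose G l := \sum_(c < j.+1) (-1) ^+ l * (w l c)%:R * (X (l + c)%N * X (K - l + (j - c))%N).
transitivity (\sum_(l < K.+1) G l).
  rewrite iter_opF_transvectant rmorph_sum; apply: eq_bigr => l _.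
  rewrite rmorph_sum; apply: eq_bigr => c _.
  by rewrite !rmorphM /= !tY !rmorph_nat rmorphXn rmorphN1.
have X_mid a : (0 < a < (m i).-1)%N -> X a = 0.
  by case/andP=> a0 am; rewrite /X gtn_eqF // ltn_eqF.
case: K @w @G K0 Kj oK => [//|K] w G _ Kj oK.
rewrite big_ord_recl big_ord_recr big1 /= => [|l _]; last first.
  rewrite /G big1 // => c _; rewrite X_mid ?mul0r ?mulr0 //.
  by have := ltn_ord l; have := ltn_ord c; rewrite /bump /=; lia.
rewrite add0r /G [X in X + _]big_ord_recl [X in _ + X + _]big1 => [|c _]; last first.
  rewrite X_mid ?mul0r ?mulr0 //.
  by have := ltn_ord c; rewrite /= /bump; lia.
rewrite addr0 [X in _ + X]big_ord_recr [X in _ + (X + _)]big1 /= => [|c _]; last first.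
  rewrite X_mid ?mul0r ?mulr0 //.
  by have := ltn_ord c; rewrite /= /bump; lia.
rewrite add0r /bump /= !add1n /w ?subn0 !subnn ?addn0 ?add0n ?subn0 !bin0 !binn !ffactn0.
rewrite !muln1 !mul1n -[(-1) ^+ K.+1]signr_odd (negPf oK) /X eqxx /=.
case: ifP => _; last by rewrite !(mulr0, mul0r) scale0r addr0.
rewrite -mul_polyC rmorph_nat; ring.
Qed.

Let dE := @opE_der C k m.
Let dF := @opF_der C k m.
Let opEs := (derivationB dE, @opE_natM C k m, dE.2, dE.1).
Let opFs := (derivationB dF, @opF_natM C k m, dF.2, dF.1).

Section Quartic.
Variable q : A.
Hypothesis hq : hw 4%:R q.
Variables q1 q2 q3 q4 : A.
Hypotheses (Fq0 : opF q = q1) (Fq1 : opF q1 = q2) (Fq2 : opF q2 = q3) (Fq3 : opF q3 = q4).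

Let iterq j : opE (iter j.+1 opF q) = (j.+1%:R * (4%:R - j%:R)) * iter j opF q.
Proof.
rewrite (opE_iter_opF j hq) -mul_mpolyC; congr (_ * _).
by rewrite mpolyCM mpolyCB !mpolyC_nat.
Qed.

Let Eq0 : opE q = 0. Proof. exact: hq.1. Qed.
Let Eq1 : opE q1 = 4%:R * q.
Proof. by have := iterq 0; rewrite /= Fq0 => ->; ring. Qed.
Let Eq2 : opE q2 = 6%:R * q1.
Proof. by have := iterq 1; rewrite /= Fq0 Fq1 => ->; ring. Qed.
Let Eq3 : opE q3 = 6%:R * q2.
Proof. by have := iterq 2; rewrite /= Fq0 Fq1 Fq2 => ->; ring. Qed.
Let Eq4 : opE q4 = 4%:R * q3.
Proof. by have := iterq 3; rewrite /= Fq0 Fq1 Fq2 Fq3 => ->; ring. Qed.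
Let Fq4 : opF q4 = 0.
Proof. by have := @hw_iter_opF C k m 4 q hq; rewrite /= Fq0 Fq1 Fq2 Fq3. Qed.
Let qE := (Eq0, Eq1, Eq2, Eq3, Eq4).
Let qF := (Fq0, Fq1, Fq2, Fq3, Fq4).

Definition quartic_hess := 4%:R * (q * q2) - 3%:R * (q1 * q1).
Let h1 := 4%:R * (q * q3) - 2%:R * (q1 * q2).
Let h2 := 4%:R * (q * q4) + 2%:R * (q1 * q3) - 2%:R * (q2 * q2).
Let h3 := 6%:R * (q1 * q4) - 2%:R * (q2 * q3).
Let h4 := 4%:R * (q2 * q4) - 2%:R * (q3 * q3).

Lemma hw_quartic_hess : hw 4%:R quartic_hess.
Proof.
split; first by rewrite /quartic_hess !opEs !qE; ring.
rewrite /quartic_hess (derivationB opH_der) !opH_natM !opH_der.2.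
have Hj j : opH (iter j opF q) = (4%:R - (2 * j)%:R) * iter j opF q.
  by rewrite (opH_iter_opF j hq) -mul_mpolyC mpolyCB !mpolyC_nat.
have := Hj 0%N; have := Hj 1%N; have := Hj 2%N; rewrite /= Fq0 Fq1 => -> -> ->.
rewrite -mul_mpolyC mpolyC_nat; ring.
Qed.

Let F1 : opF quartic_hess = h1.
Proof. by rewrite /quartic_hess !opFs !qF /h1; ring. Qed.
Let F2 : opF h1 = h2.
Proof. by rewrite /h1 !opFs !qF /h2; ring. Qed.
Let F3 : opF h2 = h3.
Proof. by rewrite /h2 !opFs !qF /h3; ring. Qed.
Let F4 : opF h3 = h4.
Proof. by rewrite /h3 !opFs !qF /h4; ring. Qed.

Let invI := 2%:R * (q * q4) - 2%:R * (q1 * q3) + q2 * q2.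
Let invJ := q * h4 - q1 * h3 + q2 * h2 - q3 * h1 + q4 * quartic_hess.

(** The invariants I and J of the quartic covariant vanish at null points, so
    [quartic_hessian_coefs] applies to the values there. *)
Lemma null_quartic N x : null_closed N -> N x ->
  (iter 4 opF quartic_hess).@[x] = 0 ->
  forall j, (0 < j < 4)%N -> (iter j opF quartic_hess).@[x] = 0.
Proof.
move=> nullN Nx; have q0 : q.@[fun=> 0] = 0 by apply: hw_zero hq; rewrite pnatr_eq0.
have z1 : q1.@[fun=> 0] = 0 by rewrite -Fq0 opF_zero.
have z2 : q2.@[fun=> 0] = 0 by rewrite -Fq1 opF_zero.
have z3 : q3.@[fun=> 0] = 0 by rewrite -Fq2 opF_zero.
have z4 : q4.@[fun=> 0] = 0 by rewrite -Fq3 opF_zero.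
have I0 : invI.@[x] = 0.
  rewrite nullN.2 //.
  - by rewrite /= !(mevalB, mevalD, mevalM) q0 z1 z2 z3 z4 !(mulr0, mul0r, subr0, addr0).
  - by rewrite /invI !opEs !qE; ring.
  - by rewrite /invI !opFs !qF; ring.
have J0 : invJ.@[x] = 0.
  rewrite nullN.2 //.
  - by rewrite /= !(mevalB, mevalD, mevalM) q0 z1 z2 z3 z4 !(mulr0, mul0r, subr0, addr0).
  - by rewrite /invJ /quartic_hess /h1 /h2 /h3 /h4 !opEs !qE; ring.
  - by rewrite /invJ /quartic_hess /h1 /h2 /h3 /h4 !opFs !qF; ring.
rewrite /= F1 F2 F3 F4 => h40.
have [] := @quartic_hessian_coefs q.@[x] q1.@[x] q2.@[x] q3.@[x] q4.@[x].
- by rewrite -[RHS]I0 /invI !(meval_nat, mevalB, mevalD, mevalM). 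
- by rewrite -[RHS]J0 /invJ /quartic_hess /h1 /h2 /h3 /h4 !(meval_nat, mevalB, mevalD, mevalM).
- by rewrite -[RHS]h40 /h4 !(meval_nat, mevalB, mevalD, mevalM).
move=> h10 h20 h30.
case=> [|[|[|[|]]]] //= _; rewrite F1 ?F2 ?F3.
- by rewrite -[RHS]h10 /h1 !(meval_nat, mevalB, mevalD, mevalM).
- by rewrite -[RHS]h20 /h2 !(meval_nat, mevalB, mevalD, mevalM).
- by rewrite -[RHS]h30 /h3 !(meval_nat, mevalB, mevalD, mevalM).
Qed.

End Quartic.

End SingleForm.

(** * Covariants excluding large degrees *)

Section LargeDegrees.
Variables (C : numClosedFieldType) (k : nat) (m : 'I_k -> nat).
Notation n := #|{: coef_index m}|.
Notation A := {mpoly C[n]}.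
Notation Y := (@Y C k m).
Notation transvectant := (@transvectant C k m).

Hypothesis m_gt0 : forall i, (0 < m i)%N.
Variable N : ('I_n -> C) -> Prop.
Hypothesis nullN : null_closed N.
Hypothesis coreducedN : forall phi : A, (forall x, N x -> phi.@[x] = 0) ->
  exists l : seq (A * A),
    (forall x, x \in l -> ideal_gen0 x.2) /\ phi = \sum_(x <- l) x.1 * x.2.

(** The weights are m i and 2 - m i. The least degree of a weight 0 monomial is m i - 1 for even m i
    and 2 m i - 2 for odd m i. *)
Lemma test_ok_ends (i : 'I_k) : (5 <= m i)%N -> forall nu : 'I_k * nat -> nat,
  (\sum_(u <- [:: (i, 0); (i, (m i).-1)]) nu u * m u.1 =
   \sum_(u <- [:: (i, 0); (i, (m i).-1)]) nu u * (2 * u.2))%N ->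
  (2 <= \sum_(u <- [:: (i, 0); (i, (m i).-1)]) nu u)%N ->
  (4 < \sum_(u <- [:: (i, 0); (i, (m i).-1)]) nu u * 1)%N.
Proof.
move=> m5 nu; rewrite !big_cons !big_nil /=.
by move: (nu _) (nu _) => [|[|[|[|[|a]]]]] [|[|[|[|[|b]]]]]; lia.
Qed.

(** The covariant is the Hessian 4 q F^2 q - 3 (F q)^2 of the transvectant q of order m - 2. At
    positive points F q and F^2 q vanish, since a product of two coordinates of positive weight has
    index sum at most m - 2. Under the test q goes to 0 and F q to 4 X^2, whence - 48 X^4. *)
Lemma no_large_even i : ~~ odd (m i) -> (6 <= m i)%N -> False.
Proof.
move=> em m6; pose K := (m i - 2)%N; pose q := transvectant K i i.
have hq : hw 4%:R q.
  by rewrite (_ : 4 = m i + m i - 2 * K)%N; [apply: hw_transvectant; lia | lia].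
have hh := hw_quartic_hess hq (erefl (opF q)) (erefl (opF (opF q))).
have s_le u : u \in [:: (i, 0%N); (i, (m i).-1)] -> (u.2 <= m u.1)%N.
  by rewrite !inE => /orP[/eqP->|/eqP->] //=; apply: leq_pred.
have eK : ~~ odd K by rewrite /K; lia.
have K0 : (0 < K)%N by rewrite /K; lia.
have Kj j : (j < 2)%N -> (K + j < m i)%N by rewrite /K; lia.
apply: (@not_coreduced C k m m_gt0 N coreducedN [:: (i, 0); (i, (m i).-1)]%N
  (fun=> 1%N) 4 (- 48%:R) (quartic_hess q (opF q) (opF (opF q)))) => //.
- by rewrite /= inE xpair_eqE; lia.
- by apply: test_ok_ends; lia.
- by rewrite oppr_eq0 pnatr_eq0.
- have [m1 m2] : (1 < m i)%N /\ (2 < m i)%N by split; lia.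
  have t0 := @test_iter_transvectant C k m 0 K i K0 (Kj 0%N isT) m1 eK.
  have t1 := @test_iter_transvectant C k m 1 K i K0 (Kj 1%N isT) m2 eK.
  rewrite /quartic_hess rmorphB !rmorphM !rmorph_nat /=.
  move: t0 t1; rewrite /= -/q => -> ->.
  have -> : (K + 0 == (m i).-1)%N = false by rewrite /K; lia.
  have -> : (K + 1 == (m i).-1)%N by rewrite /K; lia.
  have -> : (m i - K = 2)%N by rewrite /K; lia.
  rewrite (_ : 2 * 2 ^_ 1 = 4)%N // -!mul_polyC rmorphN !rmorph_nat; ring.
move=> x Nx; apply/eqP; apply: contraT => hx.
have [x' Nx'|x' [Nx' x'x pos _]] := @null_positive C k m N nullN 4 _ x Nx isT hh hx.
  exact: (null_quartic hq (erefl _) (erefl _) (erefl _) (erefl _) nullN Nx').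
move: hx; rewrite -(x'x _ hh.1) /quartic_hess !(meval_nat, mevalB, mevalM).
have -> : (opF q).@[x'] = 0.
  by apply: (@iter_transvectant_vanish C k m 1 K i i) => // a b; rewrite /K; lia.
have -> : (opF (opF q)).@[x'] = 0.
  by apply: (@iter_transvectant_vanish C k m 2 K i i) => // a b; rewrite /K; lia.
by rewrite !mulr0 subrr eqxx.
Qed.

(** At positive points the coordinates with index above p vanish. As all index sums equal 2p, only
    multiples of the square of [Y i p] remain. *)
Lemma iter_transvectant_positive j K p i x : positive x -> m i = (2 * p).+1 ->
  (K + j = 2 * p)%N -> (j <= p)%N -> (p <= K)%N ->
  (iter j opF (transvectant K i i)).@[x] =
  (\sum_(c < j.+1) (-1) ^+ (p - c) *
    ('C(K, p - c) * (m i - (p - c)) ^_ c * (m i - (K - (p - c))) ^_ (j - c) * 'C(j, c))%:R) *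
  ((Y i p).@[x] * (Y i p).@[x]).
Proof.
move=> pos mp Kj jp pK; rewrite iter_opF_transvectant exchange_big raddf_sum mulr_suml.
apply: eq_bigr => c _; have cj := leq_ord c.
have lp : (p - c < K.+1)%N by lia.
rewrite raddf_sum (bigD1 (Ordinal lp)) //= big1 => [|l lc]; last first.
  rewrite !mevalM.
  have lc' : (l : nat) != (p - c)%N by apply: contra lc => /eqP lc; apply/eqP/val_inj.
  have ll := leq_ord l.
  have [h|h] : (m i <= 2 * (l + c) \/ m i <= 2 * (K - l + (j - c)))%N by lia.
    by rewrite (pos _ _ h) mul0r mulr0.
  by rewrite (pos _ _ h) !mulr0.
rewrite addr0 !mevalM meval_nat (_ : (p - c + c = p)%N); last by lia.
rewrite (_ : (K - (p - c) + (j - c) = p)%N); last by lia.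
by rewrite rmorphXn rmorphN1.
Qed.

(* The leading coefficient of a combination of the transvectants [(q, h)_2] and *)
(* [h^2], where [h] and [q] are the covariants of [f] of degree 2 and of order *)
(* 2 and 6. *)
Definition odd_test (a b : nat) (h q : A) : A :=
  a%:R * (15%:R * (q * opF (opF h)) - 5%:R * (opF q * opF h) + opF (opF q) * h)
  + b%:R * (h * h).

Lemma opE_odd_test a b h q : hw 2%:R h -> hw 6%:R q -> opE (odd_test a b h q) = 0.
Proof.
move=> hh hq; have d := @opE_der C k m.
have e c (p : A) j : hw c%:R p -> opE (iter j.+1 opF p) = (j.+1%:R * (c%:R - j%:R)) * iter j opF p.
  move=> hp; rewrite (opE_iter_opF j hp) -mul_mpolyC; congr (_ * _).
  by rewrite mpolyCM mpolyCB !mpolyC_nat.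
have := e _ _ 0%N hh; have := e _ _ 1%N hh; have := e _ _ 0%N hq; have := e _ _ 1%N hq.
rewrite /odd_test /= => q2 q1 h2 h1.
rewrite !(derivationB d, opE_natM, d.2, d.1) q2 q1 h2 h1 hh.1 hq.1.
by move: (opF (opF q)) (opF (opF h)) (opF q) (opF h) => *; ring.
Qed.

(** Where h is nonzero the point can be moved to a positive one with F h = F^2 h = 0. Where h is
    zero the discriminant gives F h = 0, and either F^2 h = 0 makes every term zero, or the flow of
    F leads to points with h nonzero. *)
Lemma null_odd_test a b h q x : hw 2%:R h -> hw 6%:R q ->
  (forall x, N x -> positive x -> (opF h).@[x] = 0 -> (opF (opF h)).@[x] = 0 ->
    (odd_test a b h q).@[x] = 0) ->
  N x -> (odd_test a b h q).@[x] = 0.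
Proof.
move=> hh hq pos; have Ephi := opE_odd_test a b hh hq.
have h_neq0 y : N y -> h.@[y] != 0 -> (odd_test a b h q).@[y] = 0.
  move=> Ny hy.
  have [y' Ny'|y' [Ny' y'y posy' Fy']] := @null_positive C k m N nullN 2 h y Ny isT hh hy.
    by move=> Fh [//|[_|//]]; apply: (null_hw2 nullN).
  by rewrite -y'y //; apply: pos => //; [apply: (Fy' 0%N) | apply: (Fy' 1%N)].
move=> Nx; have [hx|] := eqVneq h.@[x] 0; last exact: h_neq0.
have h1x : (opF h).@[x] = 0.
  have := null_hw0 nullN Nx (disc_hw2 hh).
  rewrite expr2 !(meval_nat, mevalB, mevalM) hx !opF_zero !(mulr0, mul0r, subrr, sub0r).
  by move/eqP; rewrite oppr0 oppr_eq0 mulf_eq0 orbb => /eqP.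
have [h2x|h2x] := eqVneq (opF (opF h)).@[x] 0.
  by rewrite /odd_test !(meval_nat, mevalB, mevalD, mevalM) hx h1x h2x !(mulr0, subr0, addr0).
(* Along this flow h is a nonzero polynomial in the time, so the test covariant vanishes for all but
   finitely many times, hence also at time 0. *)
have [P [hP eP]] := flowFP h; have [Q [hQ eQ]] := flowFP (odd_test a b h q).
pose r := map_poly (meval x) P; pose s := map_poly (meval x) Q.
have r0 : r != 0.
  apply: contra_neq h2x => r0.
  by have /(congr1 (meval x)) := hP 2; rewrite mevalMn -coef_map -/r r0 coef0 mul0rn => /=.
have s0 : s = 0.
  apply: poly_vanish r0 _ => t; rewrite -!meval_map_horner -eP -eQ.
  by apply: h_neq0; case: (nullN.1 t x Nx).
have /(congr1 (meval x)) := hQ 0%N.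
by rewrite mulr1n -coef_map -/s s0 coef0.
Qed.

(** Makes the truncated subtraction in the coefficient [b] of [no_large_odd] a true one. The ratio
    of the binomials is (p + 2) / (p + 1), and (p + 4)(p + 2) exceeds (p + 5)(p + 1) by 3. *)
Lemma odd_coef_lt p : ((p + 5) * 'C(p.+1 * 2, p) < (p + 4) * 'C(p.+1 * 2, p.+1))%N.
Proof.
have := mul_bin_left (p.+1 * 2) p.
rewrite (_ : p.+1 * 2 - p = p.+2)%N; last by lia.
have : (0 < 'C(p.+1 * 2, p))%N by rewrite bin_gt0; lia.
nia.
Qed.

Lemma no_large_odd i : odd (m i) -> (5 <= m i)%N -> False.
Proof.
move=> om m5; have [p mp] : exists p, (m i = (2 * p.+2).+1)%N.
  by exists ((m i)./2 - 2)%N; lia.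
pose h := transvectant (2 * p.+2) i i; pose q := transvectant (2 * p.+1) i i.
have hh : hw 2%:R h.
  by rewrite (_ : 2 = m i + m i - 2 * (2 * p.+2))%N; [apply: hw_transvectant; lia | lia].
have hq : hw 6%:R q.
  by rewrite (_ : 6 = m i + m i - 2 * (2 * p.+1))%N; [apply: hw_transvectant; lia | lia].
(* At the positive points in question h and F^2 q are multiples of one square, with coefficients a
   and - b up to a common sign, so a h F^2 q + b h^2 vanishes there. Naturality of a and b prevents
   cancellation in the test value 24 a + 4 b. The existentials keep the binomials opaque. *)
have [a aE] : exists a, a = 'C(2 * p.+2, p.+2) by eexists.
have [b bE] : exists b, b = (2 * (p + 4) *
    ((p + 4) * 'C(p.+1 * 2, p.+1) - (p + 5) * 'C(p.+1 * 2, p)))%N by eexists.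
have s_le u : u \in [:: (i, 0%N); (i, (m i).-1)] -> (u.2 <= m u.1)%N.
  by rewrite !inE => /orP[/eqP->|/eqP->] //=; apply: leq_pred.
apply: (@not_coreduced C k m m_gt0 N coreducedN [:: (i, 0); (i, (m i).-1)]%N
  (fun=> 1%N) 4 (a * 24 + b * 4)%N%:R (odd_test a b h q)) => //.
- by rewrite /= inE xpair_eqE; lia.
- by apply: test_ok_ends; lia.
- by rewrite pnatr_eq0 aE; have : (0 < 'C(2 * p.+2, p.+2))%N by [rewrite bin_gt0; lia]; lia.
- have T j K : (j <= 2)%N -> (0 < K)%N -> (K + j < m i)%N -> ~~ odd K ->
      test [:: (i, 0%N); (i, (m i).-1)] (fun=> 1%N) (iter j opF (transvectant K i i)) =
      (if K + j == (m i).-1 then 2 * (m i - K) ^_ j else 0)%N%:R *: 'X^2.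
    by move=> j2 K0 Kj oK; apply: test_iter_transvectant => //; lia.
  have t0 : test [:: (i, 0%N); (i, (m i).-1)] (fun=> 1%N) h = 2%:R *: 'X^2.
    by rewrite -[h]/(iter 0 opF _) T; rewrite ?mp ?addn0 ?eqxx //; lia.
  have t1 : test [:: (i, 0%N); (i, (m i).-1)] (fun=> 1%N) q = 0.
    rewrite -[q]/(iter 0 opF _) T; rewrite ?mp; try lia.
    by rewrite (_ : _ == _ = false) ?scale0r //; lia.
  have t2 : test [:: (i, 0%N); (i, (m i).-1)] (fun=> 1%N) (opF q) = 0.
    rewrite -[opF q]/(iter 1 opF _) T; rewrite ?mp; try lia.
    by rewrite (_ : _ == _ = false) ?scale0r //; lia.
  have t3 : test [:: (i, 0%N); (i, (m i).-1)] (fun=> 1%N) (opF (opF q)) = 12%:R *: 'X^2.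
    rewrite -[opF (opF q)]/(iter 2 opF _) T; rewrite ?mp; try lia.
    rewrite (_ : _ == _) /=; last by lia.
    by rewrite (_ : ((2 * p.+2).+1 - 2 * p.+1 = 3)%N); last by lia.
  rewrite /odd_test !(rmorph_nat, rmorphB, rmorphD, rmorphM) /= t0 t1 t2 t3.
  rewrite -!mul_polyC !(rmorph_nat, rmorphD, rmorphM) /=; ring.
move=> x; apply: null_odd_test => // {}x Nx pos F1 F2.
rewrite /odd_test !(meval_nat, mevalB, mevalD, mevalM) F1 F2 !mulr0 subr0 add0r.
have -> : (opF (opF q)).@[x] = - ((-1) ^+ p * b%:R) * ((Y i p.+2).@[x] * (Y i p.+2).@[x]).
  rewrite -[opF (opF q)]/(iter 2 opF _) (@iter_transvectant_positive _ _ p.+2) //; try lia.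
  congr (_ * _); rewrite !big_ord_recl big_ord0 addr0 !lift0 [nat_of_ord ord0]/=.
  rewrite (_ : 'C(2 * p.+1, p.+2 - 0) = 'C(p.+1 * 2, p))%N; last first.
    by rewrite [(2 * _)%N]mulnC -bin_sub; [congr 'C(_, _); lia | lia].
  rewrite (_ : p.+2 - 0 = p.+2)%N // (_ : p.+2 - 1 = p.+1)%N; last by lia.
  rewrite (_ : p.+2 - 2 = p)%N; last by lia.
  rewrite (_ : m i - (2 * p.+1 - p.+2) = (p + 4).+1)%N; last by lia.
  rewrite (_ : m i - p.+1 = p + 4)%N; last by lia.
  rewrite (_ : m i - p = (p + 4).+1)%N; last by lia.
  rewrite (_ : m i - (2 * p.+1 - p.+1) = p + 4)%N; last by lia.
  rewrite !subn0 !ffactn0 !ffactSS !ffactn1 bin0 bin1 binn !muln1.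
  rewrite bE [(2 * p.+1)%N]mulnC !exprS !natrM natrB ?natrM ?(ltnW (odd_coef_lt p)) //.
  move: ('C(_, _)%:R) ('C(_, _)%:R) => u v; ring.
have -> : h.@[x] = (-1) ^+ p * a%:R * ((Y i p.+2).@[x] * (Y i p.+2).@[x]).
  rewrite -[h]/(iter 0 opF _) (@iter_transvectant_positive _ _ p.+2) //; try lia.
  by rewrite aE big_ord1 !subn0 !ffactn0 bin0 !muln1 !exprS !mulN1r opprK.
ring.
Qed.

Lemma coreduced_degrees :
  (forall i, m i = 1%N) \/ exists i, (1 < m i <= 4)%N /\ forall i', i' = i.
Proof.
have m4 i : (m i <= 4)%N.
  rewrite leqNgt; apply/negP => m5; have [om|em] := boolP (odd (m i)).
    exact: no_large_odd om m5.
  by apply: (no_large_even em); lia.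
have pairs i i' : i != i' -> (m i' <= m i)%N -> (1 < m i)%N -> False.
  move=> ii' mii' m1.
  have H1 := no_consecutive m_gt0 nullN coreducedN (i := i) (i' := i').
  have H2 := no_even_pair m_gt0 nullN coreducedN ii'.
  have H3 := no_three_one m_gt0 nullN coreducedN (i := i) (i' := i').
  have H4 := no_three_three m_gt0 nullN coreducedN ii'.
  have H5 := no_four_one m_gt0 nullN coreducedN (i := i) (i' := i').
  have := m4 i; have := m_gt0 i'.
  move: H1 H2 H3 H4 H5 mii' m1; move: (m i) (m i') => [|[|[|[|[|a]]]]] [|[|[|[|[|b]]]]] //= *; tauto.
have [/forallP h|/forallPn[i mi]] := boolP [forall i, m i == 1%N].
  by left=> i; apply/eqP.
have m1 : (1 < m i)%N by have := m_gt0 i; move: mi; lia.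
right; exists i; split; first by rewrite m1 m4.
move=> i'; apply/eqP; apply: contraT => ii'.
have [mii'|mii'] := leqP (m i') (m i).
  by case: (pairs i i') => //; rewrite eq_sym.
by case: (pairs i' i) => //; [apply: ltnW | apply: ltn_trans mii'].
Qed.

End LargeDegrees.

(** * Generators of SL2 *)

Section VectorPolynomials.
Variables (C : numFieldType) (W : vectType C).

Lemma coord_eq0 (w : W) : (forall i, coord (vbasis {:W}) i w = 0) -> w = 0.
Proof. by move=> hw; rewrite (coord_vbasis (memvf w)) big1 // => i _; rewrite hw scale0r. Qed.

Lemma poly_vect_eq0 (I : finType) (c : I -> {poly C}) (a : I -> W) (q : {poly C}) :
  q != 0 -> (forall t, q.[t] != 0 -> \sum_x (c x).[t] *: a x = 0) ->
  forall i, \sum_x coord (vbasis {:W}) i (a x) *: c x = 0.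
Proof.
move=> q0 h i; apply: poly_vanish q0 _ => t /h /(congr1 (coord (vbasis {:W}) i)).
rewrite linear0 linear_sum /= => <-; rewrite horner_sum; apply: eq_bigr => x _.
by rewrite linearZ hornerZ /= mulrC.
Qed.

Lemma poly_vect_deriv (I J : finType) (c : I -> {poly C}) (d : J -> {poly C})
    (a : I -> W) (b : J -> W) (q : {poly C}) t :
  q != 0 ->
  (forall t, q.[t] != 0 -> \sum_x (c x).[t] *: a x = \sum_y (d y).[t] *: b y) ->
  \sum_x (c x)^`().[t] *: a x = \sum_y (d y)^`().[t] *: b y.
Proof.
move=> q0 h; apply/eqP; rewrite -subr_eq0; apply/eqP.
pose e (z : I + J) := match z with inl x => c x | inr y => - d y end.
pose f (z : I + J) := match z with inl x => a x | inr y => b y end.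
have := @poly_vect_eq0 _ e f q q0.
have hsum (g : {poly C} -> C) : (forall p, g (- p) = - g p) ->
    \sum_z g (e z) *: f z = \sum_x g (c x) *: a x - \sum_y g (d y) *: b y.
  move=> gN; rewrite big_sumType /= -sumrN; congr (_ + _).
  by apply: eq_bigr => y _; rewrite gN scaleNr.
case/(_ _)/Wrap => [s qs|hi].
  by rewrite (hsum (fun p => p.[s])) ?h ?subrr // => p; rewrite hornerN.
rewrite -(hsum (fun p => p^`().[t])) => [|p]; last by rewrite derivN hornerN.
apply: coord_eq0 => i; have /(congr1 (fun p : {poly C} => p^`().[t])) := hi i.
rewrite deriv0 horner0 => <-; rewrite linear_sum raddf_sum /= horner_sum; apply: eq_bigr => z _.
by rewrite linearZ /= derivZ hornerZ mulrC.
Qed.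

Lemma poly_vect_coef (K L : nat) (a b : nat -> W) (q : {poly C}) :
  q != 0 ->
  (forall t, q.[t] != 0 -> \sum_(k < K) t ^+ k *: a k = \sum_(k < L) t ^+ k *: b k) ->
  (forall k, (K <= k)%N -> a k = 0) -> (forall k, (L <= k)%N -> b k = 0) ->
  forall k, a k = b k.
Proof.
move=> q0 h ha hb k.
have pad M N (c : nat -> W) t : (M <= N)%N -> (forall k, (M <= k)%N -> c k = 0) ->
    \sum_(k < M) t ^+ k *: c k = \sum_(k < N) t ^+ k *: c k.
  move=> MN hc; rewrite (big_ord_widen N (fun k => t ^+ k *: c k) MN) big_mkcond.
  by apply: eq_bigr => j _; case: ltnP => // /hc->; rewrite scaler0.
pose N := maxn k.+1 (maxn K L).
have [KN LN kN] : [/\ K <= N, L <= N & k < N]%N by rewrite /N; split; lia.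
have := @poly_vect_eq0 _ (fun j : 'I_N => 'X^j) (fun j => a j - b j) q q0.
case/(_ _)/Wrap => [t /h|hi].
  rewrite (pad K N) // (pad L N) // => hN.
  rewrite (eq_bigr (fun j : 'I_N => t ^+ j *: a j - t ^+ j *: b j)) => [|j _].
    by rewrite sumrB hN subrr.
  by rewrite hornerXn scalerBr.
apply/eqP; rewrite -subr_eq0; apply/eqP/coord_eq0 => i.
have /(congr1 (fun p : {poly C} => p`_k)) := hi i.
rewrite coef0 coef_sum (bigD1 (Ordinal kN)) //= big1 => [|j jk].
  by rewrite addr0 coefZ coefXn eqxx mulr1.
rewrite coefZ coefXn; have [E|_] := eqVneq k j; last by rewrite mulr0.
by case/eqP: jk; apply: ord_inj.
Qed.

End VectorPolynomials.

Section UnipotentsAndTorus.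
Variable C : numClosedFieldType.

Definition mat2 (R : nzRingType) (a b c d : R) : 'M[R]_2 :=
  \matrix_(i < 2, j < 2) if i == 0 then (if j == 0 then a else b)
                         else (if j == 0 then c else d).

Lemma det_mat2 (R : comNzRingType) (a b c d : R) : \det (mat2 a b c d) = a * d - b * c.
Proof.
rewrite (expand_det_row _ ord0) !big_ord_recl big_ord0 /cofactor !det_mx11 !mxE /=.
by rewrite addr0 expr0 expr1 mul1r mulN1r mulrN.
Qed.

Lemma mat2M (R : nzRingType) (a b c d a' b' c' d' : R) :
  mat2 a b c d *m mat2 a' b' c' d' =
  mat2 (a * a' + b * c') (a * b' + b * d') (c * a' + d * c') (c * b' + d * d').
Proof.
apply/matrixP => i j; rewrite !mxE !big_ord_recl big_ord0 !mxE /= addr0.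
by case: (i == 0); case: (j == 0).
Qed.

Lemma mat2_eta (M : 'M[C]_2) : M = mat2 (M 0 0) (M 0 1) (M 1 0) (M 1 1).
Proof.
apply/matrixP => i j; rewrite !mxE.
by case: i => [[|[|]]] // ?; case: j => [[|[|]]] // ?; congr (M _ _); apply/val_inj.
Qed.

(** The value is the identity when the determinant is not 1, which avoids carrying a proof as an
    argument. *)
Definition sl2 (a b c d : C) : SL2 C := insubd (SL2_one C) (mat2 a b c d).

Lemma sl2E a b c d : a * d - b * c = 1 -> SL2_mx (sl2 a b c d) = mat2 a b c d.
Proof. by move=> h; rewrite -[SL2_mx _]/(val _) insubdK // unfold_in /= det_mat2 h. Qed.

Lemma sl2M a b c d a' b' c' d' : a * d - b * c = 1 -> a' * d' - b' * c' = 1 ->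
  (sl2 a b c d * sl2 a' b' c' d')%g =
  sl2 (a * a' + b * c') (a * b' + b * d') (c * a' + d * c') (c * b' + d * d').
Proof.
move=> h h'; apply: val_inj; rewrite [LHS]/= (sl2E h) (sl2E h') mat2M.
rewrite -[RHS]/(SL2_mx _) sl2E //.
have -> : (a * a' + b * c') * (c * b' + d * d') - (a * b' + b * d') * (c * a' + d * c') =
  (a * d - b * c) * (a' * d' - b' * c') by ring.
by rewrite h h' mulr1.
Qed.

Definition upper t := sl2 1 t 0 1.
Definition lower t := sl2 1 0 t 1.
Definition torus t := sl2 t 0 0 t^-1.
Definition weyl := sl2 0 1 (- 1) 0.

Lemma upperM s t : (upper s * upper t)%g = upper (s + t).
Proof. by rewrite sl2M; [congr sl2; ring | ring..]. Qed.

Lemma lowerM s t : (lower s * lower t)%g = lower (s + t).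
Proof. by rewrite sl2M; [congr sl2; ring | ring..]. Qed.

Lemma torusM s t : s != 0 -> t != 0 -> (torus s * torus t)%g = torus (s * t).
Proof. by move=> s0 t0; rewrite sl2M; [congr sl2; field | field | field]; rewrite ?s0 ?t0. Qed.

Lemma torus1 : torus 1 = 1%g.
Proof.
apply: val_inj; rewrite /= sl2E ?invr1; last by ring.
by apply/matrixP => i j; rewrite !mxE; case: i => [[|[|]]] // ?; case: j => [[|[|]]].
Qed.

Lemma upper0 : upper 0 = 1%g.
Proof. by rewrite -torus1 /upper /torus invr1. Qed.

Lemma lower0 : lower 0 = 1%g.
Proof. by rewrite -torus1 /lower /torus invr1. Qed.

Lemma torus_upper s t : t != 0 -> (torus t * upper s)%g = (upper (t ^+ 2 * s) * torus t)%g.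
Proof. by move=> t0; rewrite !sl2M; [congr sl2 | ..]; field; rewrite ?t0. Qed.

Lemma torus_lower s t : t != 0 -> (torus t * lower (t ^+ 2 * s))%g = (lower s * torus t)%g.
Proof. by move=> t0; rewrite !sl2M; [congr sl2 | ..]; field; rewrite ?t0. Qed.

Lemma torus_weyl t : t != 0 -> (torus t * weyl)%g = (weyl * torus t^-1)%g.
Proof. by move=> t0; rewrite !sl2M; [congr sl2 | ..]; field; rewrite ?t0. Qed.

Lemma upper_lower s r : 1 + r * s != 0 ->
  (upper s * lower r)%g =
  (lower (r / (1 + r * s)) * (torus (1 + r * s) * upper (s / (1 + r * s))))%g.
Proof. by move=> t0; rewrite !sl2M; [congr sl2 | ..]; field; rewrite ?t0. Qed.

Lemma SL2_eta (g : SL2 C) :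
  (g 0 0 * g 1 1 - g 0 1 * g 1 0 = 1) * (g = sl2 (g 0 0) (g 0 1) (g 1 0) (g 1 1)).
Proof.
have h := eqP (SL2_det g); rewrite {1}[SL2_mx g]mat2_eta det_mat2 in h.
by split=> //; apply: val_inj; rewrite -[RHS]/(SL2_mx _) sl2E // -mat2_eta.
Qed.

Lemma SL2_upper_lower a b c d : c != 0 -> a * d - b * c = 1 ->
  sl2 a b c d = (upper ((a - 1) / c) * (lower c * upper ((d - 1) / c)))%g.
Proof.
move=> c0 h; rewrite !sl2M; [| by field..].
have -> : b = (a * d - 1) / c by rewrite -h; field.
by congr sl2; field.
Qed.

(** A matrix with nonzero lower left entry is a product of upper, lower and upper unipotents. *)
Lemma SL2_gen (P : SL2 C -> Prop) :
  (forall t, P (upper t)) -> (forall t, P (lower t)) ->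
  (forall g h, P g -> P h -> P (g * h)%g) -> forall g, P g.
Proof.
move=> hu hl hM.
have h1 (g : SL2 C) : g 1 0 != 0 -> P g.
  move=> c0; rewrite (SL2_eta g).2 SL2_upper_lower ?(SL2_eta g).1 //.
  by apply: (hM) => //; apply: (hM).
move=> g; have [c0|/h1//] := eqVneq (g 1 0) 0.
(* Multiplying by [lower 1] makes the lower left entry nonzero. *)
have -> : g = (g * lower 1 * lower (- 1))%g.
  by rewrite -mulgA lowerM subrr lower0 mulg1.
apply: (hM) => //; apply: h1; have [hd ->] := SL2_eta g.
move: hd; rewrite c0 => hd; have e1 : 1 * 1 - 0 * 1 = 1 :> C by ring.
rewrite sl2M // sl2E; last by ring: hd.
rewrite mxE /= mul0r add0r mulr1; apply: contraTneq isT => d0.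
by move: hd; rewrite d0 !mulr0 subr0 => /esym/eqP; rewrite oner_eq0.
Qed.

End UnipotentsAndTorus.

(** * Polynomial expansions of one-parameter subgroups *)

Section Expansions.
Variable C : numClosedFieldType.

Lemma meval_poly n (p : {mpoly C[n]}) (x : C -> 'I_n -> C) :
  (forall i, exists Q : {poly C}, forall t, x t i = Q.[t]) ->
  exists Q : {poly C}, forall t, p.@[x t] = Q.[t].
Proof.
move=> hx; elim/mpoly_ring_ind: p => [c|i|p q [P hP] [Q hQ]|p q [P hP] [Q hQ]].
- by exists c%:P => t; rewrite mevalC hornerC.
- by have [Q hQ] := hx i; exists Q => t; rewrite mevalXU.
- by exists (P + Q) => t; rewrite mevalD hornerD hP hQ.
- by exists (P * Q) => t; rewrite mevalM hornerM hP hQ.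
Qed.

Lemma meval_laurent n (p : {mpoly C[n]}) (x : C -> 'I_n -> C) :
  (forall i, exists N (Q : {poly C}), forall t, t != 0 -> t ^+ N * x t i = Q.[t]) ->
  exists N (Q : {poly C}), forall t, t != 0 -> t ^+ N * p.@[x t] = Q.[t].
Proof.
move=> hx; elim/mpoly_ring_ind: p => [c|i|p q [M [P hP]] [N [Q hQ]]|p q [M [P hP]] [N [Q hQ]]].
- by exists 0%N, c%:P => t; rewrite mevalC hornerC mul1r.
- by have [N [Q hQ]] := hx i; exists N, Q => t; rewrite mevalXU; apply: hQ.
- exists (M + N)%N, ('X^N * P + 'X^M * Q) => t t0.
  by rewrite mevalD !hornerE -hP // -hQ // exprD; ring.
- exists (M + N)%N, (P * Q) => t t0.
  by rewrite mevalM hornerM -hP // -hQ // exprD; ring.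
Qed.

Section ElementaryEndomorphisms.
Variable V : vectType C.

Definition elem_fun (i j : 'I_(\dim {:V})) (v : V) : V :=
  coord (vbasis {:V}) j v *: (vbasis {:V})`_i.

Fact elem_fun_is_linear i j : linear (elem_fun i j).
Proof. by move=> c u v; rewrite /elem_fun linearP scalerDl scalerA. Qed.

HB.instance Definition _ i j :=
  GRing.isLinear.Build C V V _ (elem_fun i j) (elem_fun_is_linear i j).

Lemma End_expand (D : C -> bool) (Phi : C -> 'End(V)) :
  (forall i (j : 'I_(\dim {:V})), exists Q : {poly C}, forall t, D t ->
     coord (vbasis {:V}) i (Phi t (vbasis {:V})`_j) = Q.[t]) ->
  exists K (E : nat -> 'End(V)), [/\ (1 < K)%N, forall k, (K <= k)%N -> E k = 0 &
    forall t, D t -> Phi t = \sum_(k < K) t ^+ k *: E k].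
Proof.
set X := vbasis {:V} => hQ.
have [Q {}hQ] : exists Q : 'I_(\dim {:V}) -> 'I_(\dim {:V}) -> {poly C},
    forall i (j : 'I_(\dim {:V})) t, D t ->
    coord X i (Phi t X`_j) = (Q i j).[t].
  apply: (@fin_all_exists _ _ (fun i Qi => forall (j : 'I_(\dim {:V})) t, D t ->
    coord X i (Phi t X`_j) = (Qi j).[t])) => i.
  by apply: (@fin_all_exists _ _ (fun (j : 'I_(\dim {:V})) Q =>
    forall t, D t -> coord X i (Phi t X`_j) = Q.[t])).
(* At least 2, so that the coefficients [E 0] and [E 1] occur in the sum. *)
pose K := (\max_i \max_j size (Q i j)).+2%N.
have QK i j : (size (Q i j) <= K)%N.
  by apply: leqW; apply: leqW; apply: leq_trans (leq_bigmax j) (leq_bigmax i).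
exists K, (fun k => \sum_i \sum_j (Q i j)`_k *: linfun (elem_fun i j)); split=> // [k Kk|t Dt].
  rewrite big1 // => i _; rewrite big1 // => j _; rewrite nth_default ?scale0r //.
  exact: leq_trans Kk.
apply/lfunP => v; rewrite {1}(coord_vbasis (memvf v)) linear_sum sum_lfunE.
rewrite (eq_bigr (fun j => \sum_i (Q i j).[t] *: linfun (elem_fun i j) v)) => [|j _].
  rewrite exchange_big /=; under [RHS]eq_bigr => k _ do
    rewrite scale_lfunE sum_lfunE scaler_sumr.
  rewrite [RHS]exchange_big; apply: eq_bigr => i _ /=.
  under [RHS]eq_bigr => k _ do rewrite sum_lfunE scaler_sumr.
  rewrite [RHS]exchange_big; apply: eq_bigr => j _ /=.
  rewrite (horner_coef_wide _ (QK i j)) scaler_suml; apply: eq_bigr => k _.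
  by rewrite scale_lfunE scalerA mulrC.
rewrite linearZ /= {1}(coord_vbasis (memvf (Phi t X`_j))) scaler_sumr.
apply: eq_bigr => i _; rewrite (hQ i j t Dt) lfunE /elem_fun !scalerA mulrC //.
Qed.

End ElementaryEndomorphisms.

End Expansions.

Section RationalRepresentations.
Variables (C : numClosedFieldType) (V : vectType C) (rho : SL2rep V).
Hypothesis rat_rho : rational_rep rho.

Let repM g h v : rho (g * h)%g v = rho g (rho h v).
Proof. by rewrite rep_actM comp_lfunE. Qed.

Let rep1 v : rho 1%g v = v.
Proof. by rewrite rep_act1 id_lfunE. Qed.

Lemma coord_rational i (v : V) :
  exists p : {mpoly C[2 * 2]}, forall g : SL2 C,
    coord (vbasis {:V}) i (rho g v) = p.@[fun k => mxvec (SL2_mx g) 0 k].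
Proof.
have [p hp] := rat_rho v (linfun (coord (vbasis {:V}) i : V -> C^o)).
by exists p => g; rewrite -hp lfunE.
Qed.

Lemma upper_expand : exists K (E : nat -> 'End(V)), [/\ (1 < K)%N, forall k, (K <= k)%N -> E k = 0 &
  forall t, rho (upper t) = \sum_(k < K) t ^+ k *: E k].
Proof.
have [|K [E [K1 hE hK]]] := @End_expand C V xpredT (fun t => rho (upper t)) _.
  move=> i j; have [p hp] := coord_rational i (vbasis {:V})`_j.
  have [|Q hQ] := @meval_poly C _ p (fun t k => mxvec (SL2_mx (upper t)) 0 k) _.
    move=> k; case/mxvec_indexP: k => a b.
    exists (mat2 1 'X 0 1 a b) => t; rewrite mxvecE /upper sl2E; last by ring.
    by rewrite !mxE; case: (a == 0); case: (b == 0); rewrite ?hornerE.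
  by exists Q => t _; rewrite hp hQ.
by exists K, E; split=> // t; apply: hK.
Qed.

Lemma lower_expand : exists K (E : nat -> 'End(V)), [/\ (1 < K)%N, forall k, (K <= k)%N -> E k = 0 &
  forall t, rho (lower t) = \sum_(k < K) t ^+ k *: E k].
Proof.
have [|K [E [K1 hE hK]]] := @End_expand C V xpredT (fun t => rho (lower t)) _.
  move=> i j; have [p hp] := coord_rational i (vbasis {:V})`_j.
  have [|Q hQ] := @meval_poly C _ p (fun t k => mxvec (SL2_mx (lower t)) 0 k) _.
    move=> k; case/mxvec_indexP: k => a b.
    exists (mat2 1 0 'X 1 a b) => t; rewrite mxvecE /lower sl2E; last by ring.
    by rewrite !mxE; case: (a == 0); case: (b == 0); rewrite ?hornerE.
  by exists Q => t _; rewrite hp hQ.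
by exists K, E; split=> // t; apply: hK.
Qed.

Lemma torus_expand : exists N K (D : nat -> 'End(V)), [/\ (1 < K)%N, forall k, (K <= k)%N -> D k = 0 &
  forall t, t != 0 -> t ^+ N *: rho (torus t) = \sum_(k < K) t ^+ k *: D k].
Proof.
have hQ i (j : 'I_(\dim {:V})) : exists N (Q : {poly C}), forall t, t != 0 ->
    t ^+ N * coord (vbasis {:V}) i (rho (torus t) (vbasis {:V})`_j) = Q.[t].
  have [p hp] := coord_rational i (vbasis {:V})`_j.
  have [|N [Q hQ]] := @meval_laurent C _ p (fun t k => mxvec (SL2_mx (torus t)) 0 k) _.
    move=> k; case/mxvec_indexP: k => a b.
    exists 1%N, (mat2 'X^2 0 0 1 a b) => t t0; rewrite mxvecE /torus sl2E; last by field.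
    rewrite !mxE; case: (a == 0); case: (b == 0); rewrite ?hornerE ?mulr0 //.
    by rewrite divff.
  by exists N, Q => t t0; rewrite hp hQ.
have [N {}hQ] : exists N : 'I_(\dim {:V}) -> 'I_(\dim {:V}) -> nat,
    forall i (j : 'I_(\dim {:V})),
    exists Q : {poly C}, forall t, t != 0 ->
    t ^+ N i j * coord (vbasis {:V}) i (rho (torus t) (vbasis {:V})`_j) = Q.[t].
  apply: (@fin_all_exists _ _ (fun i Ni => forall j : 'I_(\dim {:V}),
    exists Q : {poly C}, forall t, t != 0 ->
    t ^+ Ni j * coord (vbasis {:V}) i (rho (torus t) (vbasis {:V})`_j) = Q.[t])) => i.
  by apply: (@fin_all_exists _ _ (fun (j : 'I_(\dim {:V})) N => exists Q : {poly C}, forall t, t != 0 ->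
    t ^+ N * coord (vbasis {:V}) i (rho (torus t) (vbasis {:V})`_j) = Q.[t])).
pose M := (\max_i \max_j N i j)%N.
have NM i j : (N i j <= M)%N.
  exact: leq_trans (leq_bigmax j) (leq_bigmax i).
have [|K [E [K1 hE hK]]] := @End_expand C V (fun t => t != 0) (fun t => t ^+ M *: rho (torus t)) _.
  move=> i j; have [Q {}hQ] := hQ i j; exists ('X^(M - N i j) * Q) => t t0.
  rewrite scale_lfunE linearZ /= hornerE hornerXn -hQ // mulrA -exprD subnK //.
by exists M, K, E.
Qed.

End RationalRepresentations.

(** * The Lie algebra action *)

Section LieAction.
Variables (C : numClosedFieldType) (V : vectType C) (rho : SL2rep V).

Let repM g h v : rho (g * h)%g v = rho g (rho h v).
Proof. by rewrite rep_actM comp_lfunE. Qed.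

Let rep1 v : rho 1%g v = v.
Proof. by rewrite rep_act1 id_lfunE. Qed.

Lemma sum_delta K (a : nat -> V) i : (i < K)%N ->
  \sum_(k < K) ((k : nat) == i)%:R *: a k = a i.
Proof.
move=> iK; rewrite (bigD1 (Ordinal iK)) //= eqxx scale1r big1 ?addr0 // => k ki.
rewrite (_ : (k : nat) == i = false) ?scale0r //.
by apply/negbTE; apply: contra ki => /eqP ki; apply/eqP/val_inj.
Qed.

Lemma derivXn0 (c : C) k : (('X * c%:P) ^+ k)^`().[0] = (k == 1%N)%:R * c.
Proof.
rewrite deriv_exp derivM derivX derivC mulr0 addr0 mul1r hornerMn hornerM hornerC.
rewrite horner_exp hornerM hornerX mul0r; case: k => [|[|k]].
- by rewrite mulr0n mul0r.
- by rewrite expr0 mulr1 mulr1n mul1r.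
- by rewrite expr0n mulr0 mul0rn mul0r.
Qed.

Section OneParameter.
Variables (g : C -> SL2 C) (K : nat) (E : nat -> 'End(V)).
Hypotheses (gM : forall s t, (g s * g t)%g = g (s + t)) (g0 : g 0 = 1%g).
Hypotheses (K1 : (1 < K)%N) (EK : forall k, (K <= k)%N -> E k = 0).
Hypothesis gE : forall t, rho (g t) = \sum_(k < K) t ^+ k *: E k.

Lemma gEv t v : rho (g t) v = \sum_(k < K) t ^+ k *: E k v.
Proof. by rewrite gE sum_lfunE; apply: eq_bigr => k _; rewrite scale_lfunE. Qed.

Lemma one_param0 v : E 0 v = v.
Proof.
rewrite -[RHS](rep1 v) -g0 gEv -(sum_delta (fun k => E k v) (ltnW K1)).
by apply: eq_bigr => k _; rewrite expr0n.
Qed.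

(** Differentiating g(s) g(t) = g(s + t) at s = 0 and comparing coefficients in t gives E_1 E_l = (l
    + 1) E_(l+1). *)
Lemma one_param_iter l v : E l v *+ l`! = iter l (E 1) v.
Proof.
elim: l => [|l IH]; first by rewrite one_param0.
have step t : E 1 (rho (g t) v) = \sum_(k < K) (k%:R * t ^+ k.-1) *: E k v.
  have := @poly_vect_deriv C V 'I_K 'I_K (fun k => ('X * 1%:P) ^+ k)
    (fun k => ('X + t%:P) ^+ k) (fun k => E k (rho (g t) v)) (fun k => E k v) 1 0
    (oner_neq0 _).
  case/(_ _)/Wrap => [s _|].
    rewrite (eq_bigr (fun k : 'I_K => s ^+ k *: E k (rho (g t) v))) => [|k _].
      rewrite -gEv -repM gM gEv; apply: eq_bigr => k _.
      by rewrite horner_exp hornerD hornerX hornerC.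
    by rewrite mulr1 hornerXn.
  under eq_bigr => k _ do rewrite derivXn0 mulr1.
  rewrite (sum_delta (fun k => E k (rho (g t) v))) // => ->.
  apply: eq_bigr => k _; rewrite deriv_exp derivD derivX derivC addr0 mul1r hornerMn.
  by rewrite horner_exp hornerD hornerX hornerC add0r mulr_natl.
have := @poly_vect_coef C V K K (fun l => E 1 (E l v)) (fun l => l.+1%:R *: E l.+1 v) 1
  (oner_neq0 _) _ _ _ l.
case/(_ _ _ _)/Wrap.
- move=> t _; have := step t; rewrite gEv linear_sum => H.
  rewrite (eq_bigr (fun k : 'I_K => E 1 (t ^+ k *: E k v))) => [|k _]; last by rewrite linearZ.
  rewrite H; case: K EK => [|K'] EK'; first by rewrite !big_ord0.
  rewrite big_ord_recl mul0r scale0r add0r [RHS]big_ord_recr /= EK' // zero_lfunE !scaler0 addr0.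
  by apply: eq_bigr => k _; rewrite /bump /= add1n scalerA mulrC.
- by move=> j Kj; rewrite (EK Kj) zero_lfunE linear0.
- by move=> j Kj; rewrite (EK (leqW Kj)) zero_lfunE scaler0.
rewrite iterS -IH linearMn /= => ->.
by rewrite factS mulrnA scaler_nat.
Qed.

Lemma one_param_nil v : iter K (E 1) v = 0.
Proof. by rewrite -one_param_iter EK // zero_lfunE mul0rn. Qed.

Lemma one_param_exp t v : rho (g t) v = \sum_(k < K) (t ^+ k / k`!%:R) *: iter k (E 1) v.
Proof.
rewrite gEv; apply: eq_bigr => k _; rewrite -one_param_iter -scaler_nat scalerA.
by rewrite -mulrA mulVf ?mulr1 // fact_neq0.
Qed.

End OneParameter.

Section Torus.
Variables (N K : nat) (D : nat -> 'End(V)).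
Hypothesis DK : forall k, (K <= k)%N -> D k = 0.
Hypothesis torusE : forall t, t != 0 -> t ^+ N *: rho (torus t) = \sum_(k < K) t ^+ k *: D k.

Lemma torusEv t v : t != 0 -> t ^+ N *: rho (torus t) v = \sum_(k < K) t ^+ k *: D k v.
Proof.
move=> t0; rewrite -scale_lfunE torusE // sum_lfunE.
by apply: eq_bigr => k _; rewrite scale_lfunE.
Qed.

(** The derivative of the torus action at t = 1; [D k] is the component of weight k - N. *)
Definition cartan : 'End(V) := \sum_(k < K) k%:R *: D k - N%:R *: \1%VF.

Lemma cartanE v : \sum_(k < K) k%:R *: D k v = cartan v + N%:R *: v.
Proof.
rewrite add_lfunE opp_lfunE scale_lfunE id_lfunE subrK sum_lfunE.
by apply: eq_bigr => k _; rewrite scale_lfunE.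
Qed.

Lemma torus_sum v : \sum_(k < K) D k v = v.
Proof.
have := torusEv v (oner_neq0 _); rewrite expr1n scale1r torus1 rep1 => {2}->.
by apply: eq_bigr => k _; rewrite expr1n scale1r.
Qed.

Let X0 : ('X : {poly C}) != 0. Proof. by rewrite polyX_eq0. Qed.

Lemma deriv1_sum (n : nat) (a : nat -> V) (x : nat -> nat) :
  \sum_(k < n) ('X^(x k) : {poly C})^`().[1] *: a k = \sum_(k < n) (x k)%:R *: a k.
Proof.
by apply: eq_bigr => k _; rewrite derivXn hornerMn hornerXn expr1n.
Qed.

Lemma torus_deriv1 (n p : nat) (a b : nat -> V) (x y : nat -> nat) :
  (forall t, t != 0 -> \sum_(k < n) t ^+ x k *: a k = \sum_(k < p) t ^+ y k *: b k) ->
  \sum_(k < n) (x k)%:R *: a k = \sum_(k < p) (y k)%:R *: b k.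
Proof.
move=> h; rewrite -!deriv1_sum; apply: (poly_vect_deriv _ X0) => t; rewrite hornerX => /h h'.
under eq_bigr => k _ do rewrite hornerXn.
by rewrite h'; apply: eq_bigr => k _; rewrite hornerXn.
Qed.

Lemma torus_coef (a b : nat -> V) (i : nat) :
  (forall t, t != 0 -> \sum_(k < K) t ^+ k *: a k = \sum_(k < K) t ^+ (k + i) *: b k) ->
  (forall k, (K <= k)%N -> a k = 0) -> (forall k, (K <= k)%N -> b k = 0) ->
  forall k, a (k + i)%N = b k.
Proof.
move=> h ha hb k.
have := @poly_vect_coef C V K (K + i) a (fun j => if (j < i)%N then 0 else b (j - i)%N) 'X X0.
case/(_ _ _ _ (k + i)%N)/Wrap => [t||j jK|].
- rewrite hornerX => /h ->.
  rewrite addnC big_split_ord /= [X in X + _]big1 ?add0r => [|j _]; last first.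
    by rewrite ltn_ord scaler0.
  by apply: eq_bigr => j _; rewrite ltnNge leq_addr /= addKn addnC.
- exact: ha.
- by case: ifP => // _; apply: hb; lia.
by rewrite ltnNge leq_addl /= addnK.
Qed.

Lemma cartan_torus l v : cartan (D l v) = (l%:R - N%:R) *: D l v.
Proof.
pose w t := \sum_(k < K) t ^+ k *: D k v.
have h t : t != 0 -> cartan (w t) + N%:R *: w t = \sum_(k < K) k%:R *: (t ^+ k *: D k v).
  move=> t0; rewrite -cartanE.
  apply: (@torus_deriv1 K K (fun k => D k (w t)) (fun k => t ^+ k *: D k v) id id) => s s0.
  rewrite -torusEv // /w -torusEv // linearZ /= -repM torusM // scalerA -exprMn.
  rewrite torusEv ?mulf_neq0 //; apply: eq_bigr => k _.
  by rewrite scalerA exprMn.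
have := @torus_coef (fun k => cartan (D k v) + N%:R *: D k v) (fun k => k%:R *: D k v) 0.
case/(_ _ _ _ l)/Wrap => [t t0|k Kk|k Kk|].
- have := h t t0; rewrite /w linear_sum scaler_sumr -big_split /= => H.
  rewrite (eq_bigr (fun k : 'I_K => cartan (t ^+ k *: D k v) + N%:R *: (t ^+ k *: D k v))).
    by rewrite H; apply: eq_bigr => k _; rewrite addn0 !scalerA mulrC.
  by move=> k _; rewrite linearZ scalerDr !scalerA [N%:R * _]mulrC.
- by rewrite (DK Kk) zero_lfunE linear0 scaler0 addr0.
- by rewrite (DK Kk) zero_lfunE scaler0.
by rewrite addn0 scalerBl => <-; rewrite addrK.
Qed.

Section TorusUpper.
Variables (e : 'End(V)) (M : nat).
Hypothesis M1 : (1 < M)%N.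
Hypothesis upperE : forall t v, rho (upper t) v = \sum_(k < M) (t ^+ k / k`!%:R) *: iter k e v.

Lemma deriv0_sum (c : C) (a : nat -> V) :
  \sum_(k < M) ((k`!%:R^-1)%:P * ('X * c%:P) ^+ k)^`().[0] *: a k = c *: a 1%N.
Proof.
rewrite -(sum_delta (fun k => c *: a k) M1); apply: eq_bigr => k _.
rewrite derivM derivC mul0r add0r hornerM hornerC derivXn0 scalerA; congr (_ *: _).
by case: eqP => [->|_]; rewrite ?invr1 ?mul1r // !mul0r mulr0.
Qed.

Lemma upper_deriv (c d : C) (F G : 'End(V)) v w :
  (forall s, F (rho (upper (s * c)) v) = rho (upper (s * d)) w) ->
  c *: F (e v) = d *: e w.
Proof.
move=> h; have := deriv0_sum c (fun k => F (iter k e v)); rewrite /= => <-.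
have := deriv0_sum d (fun k => iter k e w); rewrite /= => <-.
apply: (poly_vect_deriv _ (oner_neq0 _)) => s _.
transitivity (F (rho (upper (s * c)) v)).
  rewrite upperE linear_sum; apply: eq_bigr => k _.
  by rewrite linearZ hornerM hornerC horner_exp hornerM hornerX hornerC mulrC.
rewrite h upperE; apply: eq_bigr => k _.
by rewrite hornerM hornerC horner_exp hornerM hornerX hornerC mulrC.
Qed.

(** The derivative at s = 0 of the conjugation relation [torus_upper]. *)
Lemma torus_upper_e t v : t != 0 ->
  \sum_(k < K) t ^+ k *: D k (e v) = \sum_(k < K) t ^+ (k + 2) *: e (D k v).
Proof.
move=> t0; rewrite -torusEv // -scale_lfunE -[LHS]scale1r.
rewrite (@upper_deriv 1 (t ^+ 2) (t ^+ N *: rho (torus t)) 0 v (t ^+ N *: rho (torus t) v)).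
  rewrite torusEv // linear_sum scaler_sumr; apply: eq_bigr => k _.
  by rewrite linearZ /= scalerA -exprD addnC.
move=> s; rewrite mulr1 scale_lfunE linearZ /= -!repM mulrC torus_upper //.
Qed.

Lemma cartan_e v : cartan (e v) = e (cartan v) + 2%:R *: e v.
Proof.
have := @torus_deriv1 K K (fun k => D k (e v)) (fun k => e (D k v)) id (addn^~ 2%N)
  (fun t t0 => torus_upper_e v t0).
rewrite cartanE.
rewrite (eq_bigr (fun k : 'I_K => e (k%:R *: D k v) + 2%:R *: e (D k v))) => [|k _]; last first.
  by rewrite natrD scalerDl linearZ.
rewrite big_split /= -linear_sum cartanE -scaler_sumr -linear_sum torus_sum linearD linearZ /=.
by rewrite addrAC => /addIr.
Qed.

Lemma torus_e_coef k v : D (k + 2) (e v) = e (D k v).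
Proof.
apply: (@torus_coef (fun k => D k (e v)) (fun k => e (D k v)) 2 _ _ _ k) => [t|j Kj|j Kj].
- exact: torus_upper_e.
- by rewrite (DK Kj) zero_lfunE.
- by rewrite (DK Kj) zero_lfunE linear0.
Qed.

End TorusUpper.

Section TorusLower.
Variables (f : 'End(V)) (M : nat).
Hypothesis M1 : (1 < M)%N.
Hypothesis lowerE : forall t v, rho (lower t) v = \sum_(k < M) (t ^+ k / k`!%:R) *: iter k f v.

Lemma lower_deriv (c d : C) (F : 'End(V)) v w :
  (forall s, F (rho (lower (s * c)) v) = rho (lower (s * d)) w) ->
  c *: F (f v) = d *: f w.
Proof.
move=> h; have := deriv0_sum M1 c (fun k => F (iter k f v)); rewrite /= => <-.
have := deriv0_sum M1 d (fun k => iter k f w); rewrite /= => <-.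
apply: (poly_vect_deriv _ (oner_neq0 _)) => s _.
transitivity (F (rho (lower (s * c)) v)).
  rewrite lowerE linear_sum; apply: eq_bigr => k _.
  by rewrite linearZ hornerM hornerC horner_exp hornerM hornerX hornerC mulrC.
rewrite h lowerE; apply: eq_bigr => k _.
by rewrite hornerM hornerC horner_exp hornerM hornerX hornerC mulrC.
Qed.

Lemma cartan_f v : cartan (f v) = f (cartan v) - 2%:R *: f v.
Proof.
have h t : t != 0 -> \sum_(k < K) t ^+ (k + 2) *: D k (f v) = \sum_(k < K) t ^+ k *: f (D k v).
  move=> t0; have H s : (t ^+ N *: rho (torus t)) (rho (lower (s * t ^+ 2)) v) =
      rho (lower (s * 1)) (t ^+ N *: rho (torus t) v).
    by rewrite scale_lfunE mulr1 linearZ /= -!repM mulrC torus_lower.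
  have := lower_deriv H; rewrite scale_lfunE scale1r !torusEv // scaler_sumr linear_sum.
  under eq_bigr => k _ do rewrite scalerA -exprD addnC.
  by move=> ->; apply: eq_bigr => k _; rewrite linearZ.
have := @torus_deriv1 K K (fun k => D k (f v)) (fun k => f (D k v)) (addn^~ 2%N) id h.
rewrite (eq_bigr (fun k : 'I_K => k%:R *: D k (f v) + 2%:R *: D k (f v))) => [|k _]; last first.
  by rewrite natrD scalerDl.
rewrite big_split /= cartanE -scaler_sumr torus_sum.
under [RHS]eq_bigr => k _ do rewrite -linearZ.
rewrite -linear_sum /= cartanE linearD linearZ /= addrAC => /addIr <-.
by rewrite addrK.
Qed.

End TorusLower.

(** The Weyl element conjugates the torus element at t to the one at 1/t. Negative powers of t are
    cleared before differentiating at t = 1. *)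
Lemma cartan_weyl v : cartan (rho (weyl C) v) = - rho (weyl C) (cartan v).
Proof.
have h t : t != 0 -> \sum_(k < K) t ^+ (k + K) *: D k (rho (weyl C) v) =
    \sum_(k < K) t ^+ (K + 2 * N - k) *: rho (weyl C) (D k v).
  move=> t0; have ti0 : t^-1 != 0 by rewrite invr_eq0.
  under eq_bigr => k _ do rewrite addnC exprD -scalerA.
  rewrite -scaler_sumr -torusEv // -repM torus_weyl // repM.
  have -> : rho (torus t^-1) v = t ^+ N *: \sum_(k < K) t^-1 ^+ k *: D k v.
    by rewrite -torusEv // scalerA -exprMn divff // expr1n scale1r.
  rewrite [rho (weyl C) (_ *: _)]linearZ /= [rho (weyl C) (\sum_(_ < _) _)]linear_sum.
  rewrite !scaler_sumr; apply: eq_bigr => k _.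
  rewrite /= [rho (weyl C) (_ *: D k v)]linearZ /= !scalerA; congr (_ *: _).
  have kK := ltn_ord k; rewrite exprVn exprB ?unitfE //; last by lia.
  by rewrite exprD mul2n -addnn exprD !mulrA.
have := @torus_deriv1 K K (fun k => D k (rho (weyl C) v)) (fun k => rho (weyl C) (D k v))
  (addn^~ K) (subn (K + 2 * N)) h.
rewrite (eq_bigr (fun k : 'I_K => k%:R *: D k (rho (weyl C) v) + K%:R *: D k (rho (weyl C) v)));
  last by move=> k _; rewrite natrD scalerDl.
rewrite big_split /= cartanE -scaler_sumr torus_sum.
rewrite [RHS](eq_bigr (fun k : 'I_K => (K + 2 * N)%:R *: rho (weyl C) (D k v) -
    rho (weyl C) (k%:R *: D k v))) => [|k _]; last first.
  by rewrite natrB ?scalerBl ?linearZ //; have := ltn_ord k; lia.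
rewrite sumrB -scaler_sumr -!linear_sum /= torus_sum cartanE linearD linearZ /=.
move: (cartan (rho (weyl C) v)) (rho (weyl C) (cartan v)) (rho (weyl C) v) => z y x E.
apply: (@addIr _ (N%:R *: x + K%:R *: x)); rewrite [LHS]addrA E opprD addrCA; congr (_ + _).
by rewrite -scaleNr -!scalerDl; congr (_ *: _); rewrite natrD natrM; ring.
Qed.

End Torus.

End LieAction.

(** * The bracket of the two nilpotent operators *)

Section Bracket.
Variables (C : numClosedFieldType) (V : vectType C) (rho : SL2rep V).

Let repM g h v : rho (g * h)%g v = rho g (rho h v).
Proof. by rewrite rep_actM comp_lfunE. Qed.

Variables (N K : nat) (D : nat -> 'End(V)).
Hypothesis torusE : forall t, t != 0 -> t ^+ N *: rho (torus t) = \sum_(k < K) t ^+ k *: D k.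
Variables (e f : 'End(V)) (Me Mf : nat).
Hypothesis Me1 : (1 < Me)%N.
Hypothesis Mf1 : (1 < Mf)%N.
Hypothesis upperE : forall t v, rho (upper t) v = \sum_(k < Me) (t ^+ k / k`!%:R) *: iter k e v.
Hypothesis lowerE : forall t v, rho (lower t) v = \sum_(k < Mf) (t ^+ k / k`!%:R) *: iter k f v.
Let h := cartan N K D.

Lemma deriv0_monomial (c s : C) a M :
  (c%:P * 'X^a * (1 + 'X * s%:P) ^+ M)^`().[0] =
  c * ((a == 1%N)%:R + (a == 0%N)%:R * (M%:R * s)).
Proof.
have Xa : ('X^a : {poly C}).[0] = (a == 0%N)%:R by rewrite hornerXn expr0n.
have dXa : ('X^a : {poly C})^`().[0] = (a == 1%N)%:R.
  by rewrite -[in LHS](mulr1 'X) -[1]/(1%:P) derivXn0 mulr1.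
rewrite derivM derivM derivC mul0r add0r hornerD !hornerM hornerC dXa Xa.
rewrite !horner_exp hornerD hornerM hornerX mul0r addr0 hornerC expr1n mulr1.
rewrite deriv_exp derivD derivM derivX !derivC mulr0 addr0 add0r mul1r hornerMn hornerM hornerC.
rewrite horner_exp hornerD hornerM hornerX mul0r addr0 hornerC expr1n mulr1 -mulr_natr; ring.
Qed.

Let m := (N + Me + Mf)%N.

Lemma iter_lfunZ (g : 'End(V)) j c v : iter j g (c *: v) = c *: iter j g v.
Proof. by elim: j => //= j ->; rewrite linearZ. Qed.

Lemma iter_lfun_sum (g : 'End(V)) j (I : finType) (v : I -> V) :
  iter j g (\sum_i v i) = \sum_i iter j g (v i).
Proof. by elim: j => //= j ->; rewrite linear_sum. Qed.

Lemma scaled_exp (g : SL2 C) (x : 'End(V)) M (t d : C) v : d != 0 ->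
  rho g v = \sum_(b < M) ((t / d) ^+ b / b`!%:R) *: iter b x v ->
  d ^+ M *: rho g v = \sum_(b < M) (b`!%:R^-1 * t ^+ b * d ^+ (M - b)) *: iter b x v.
Proof.
move=> d0 ->; rewrite scaler_sumr; apply: eq_bigr => b _; rewrite scalerA.
have -> : d ^+ M = d ^+ (M - b) * d ^+ b by rewrite -exprD subnK // ltnW.
rewrite expr_div_n; congr (_ *: _).
by field; rewrite expf_neq0 // fact_neq0.
Qed.

(* The derivative at [r = 0] of the relation [upper_lower], after multiplying  *)
(* it by [(1 + r * s) ^+ m] to clear the denominators.                         *)
Lemma upper_lower_deriv s v :
  rho (upper s) (f v) + (m%:R * s) *: rho (upper s) v =
  f (rho (upper s) v) + \sum_(b < Me) (s ^+ b.+1 / b`!%:R) *: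
     ((Mf + (Me - b) + N)%:R *: iter b e v + h (iter b e v)).
Proof.
pose d : {poly C} := 1 + 'X * s%:P.
have dE r : d.[r] = 1 + r * s by rewrite hornerD hornerM hornerX !hornerC.
have d0 : d != 0.
  by apply: contra_neq (oner_neq0 C) => d0; have := dE 0; rewrite d0 horner0 mul0r addr0.
pose cL (a : 'I_Mf) : {poly C} := (a`!%:R^-1)%:P * 'X^a * d ^+ m.
pose cR (x : 'I_Mf * ('I_K * 'I_Me)) : {poly C} :=
  (x.1`!%:R^-1 * (s ^+ x.2.2 / x.2.2`!%:R))%:P * 'X^(x.1) * d ^+ (Mf - x.1 + x.2.1 + (Me - x.2.2)).
pose aR (x : 'I_Mf * ('I_K * 'I_Me)) : V := iter x.1 f (D x.2.1 (iter x.2.2 e v)).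
have := @poly_vect_deriv C V _ _ cL cR (fun a => rho (upper s) (iter a f v)) aR d 0 d0.
case/(_ _)/Wrap => [r|].
  rewrite dE => dr0.
  transitivity ((1 + r * s) ^+ m *: rho (upper s) (rho (lower r) v)).
    rewrite lowerE [rho (upper s) _]linear_sum scaler_sumr; apply: eq_bigr => a _.
    rewrite /= [rho (upper s) (_ *: _)]linearZ /= scalerA /cL !hornerM hornerC hornerXn horner_exp dE.
    by congr (_ *: _); ring.
  rewrite -repM upper_lower // !repM.
  have -> : forall x : V, (1 + r * s) ^+ m *: x =
      (1 + r * s) ^+ Mf *: ((1 + r * s) ^+ N *: ((1 + r * s) ^+ Me *: x)).
    by move=> x; rewrite !scalerA -!exprD; congr (_ ^+ _ *: _); rewrite /m; lia.
  set dl := 1 + r * s in dr0 *.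
  have -> : dl ^+ Mf *: (dl ^+ N *: (dl ^+ Me *: rho (lower (r / dl))
      (rho (torus dl) (rho (upper (s / dl)) v)))) =
      dl ^+ Mf *: rho (lower (r / dl)) (dl ^+ N *: rho (torus dl)
      (dl ^+ Me *: rho (upper (s / dl)) v)).
    rewrite [rho (torus dl) (_ *: _)]linearZ /= !scalerA [rho (lower _) (_ *: _)]linearZ /= scalerA.
    by congr (_ *: _); ring.
  rewrite (scaled_exp dr0 (upperE _ _)) (scaled_exp dr0 (lowerE _ _)).
  rewrite -(pair_bigA _ (fun a y => (cR (a, y)).[r] *: aR (a, y))) /=.
  apply: eq_bigr => a _; rewrite -(pair_bigA _ (fun y z => (cR (a, (y, z))).[r] *: aR (a, (y, z)))) /=.
  rewrite -scale_lfunE torusE // sum_lfunE iter_lfun_sum scaler_sumr.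
  apply: eq_bigr => k _; rewrite scale_lfunE [D k _]linear_sum iter_lfunZ iter_lfun_sum !scaler_sumr.
  apply: eq_bigr => b _; rewrite /= [D k _]linearZ iter_lfunZ !scalerA /cR /aR /=.
  rewrite !hornerM hornerC hornerXn horner_exp dE -/dl !exprD.
  by congr (_ *: _); ring.
have deltas (M : nat) (x : C) (u : nat -> V) : (1 < M)%N ->
    \sum_(a < M) (a`!%:R^-1 * ((nat_of_ord a == 1%N)%:R + (nat_of_ord a == 0%N)%:R * x)) *: u a =
    u 1%N + x *: u 0%N.
  move=> M1; rewrite -(sum_delta u M1) -(sum_delta (fun a => x *: u a) (ltnW M1)) -big_split.
  apply: eq_bigr => a _ /=; rewrite scalerA -scalerDl; congr (_ *: _).
  by case: (nat_of_ord a) => [|[|j]]; rewrite /= ?invr1 ?mul1r // !(mul0r, mulr0, addr0).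
under eq_bigr => a _ do rewrite deriv0_monomial.
rewrite (deltas Mf _ (fun a => rho (upper s) (iter a f v))) //= => ->.
rewrite -(pair_bigA _ (fun a y => (cR (a, y))^`().[0] *: aR (a, y))) /= exchange_big /=.
transitivity (\sum_(y : 'I_K * 'I_Me) (s ^+ y.2 / y.2`!%:R) *: (f (D y.1 (iter y.2 e v)) +
    ((Mf + y.1 + (Me - y.2))%:R * s) *: D y.1 (iter y.2 e v))).
  apply: eq_bigr => y _.
  rewrite -(deltas Mf _ (fun a => iter a f (D y.1 (iter y.2 e v)))) // scaler_sumr.
  apply: eq_bigr => a _; rewrite /cR /aR deriv0_monomial /= scalerA; congr (_ *: _).
  by case: (nat_of_ord a) => [|j] /=; [rewrite subn0 | rewrite !(mul0r, addr0)]; ring.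
rewrite -(pair_bigA _ (fun (k : 'I_K) (b : 'I_Me) => (s ^+ b / b`!%:R) *: (f (D k (iter b e v)) +
    ((Mf + k + (Me - b))%:R * s) *: D k (iter b e v)))) /= exchange_big /=.
rewrite {1}upperE linear_sum -big_split; apply: eq_bigr => b _ /=.
rewrite linearZ /= -scaler_sumr big_split /= -linear_sum.
have tsum w : \sum_(k < K) D k w = w.
  have := torusE (oner_neq0 _); rewrite expr1n scale1r torus1 => /(congr1 (fun g : 'End(V) => g w)).
  rewrite rep_act1 id_lfunE sum_lfunE => {2}->; apply: eq_bigr => k _.
  by rewrite expr1n scale1r.
rewrite tsum scalerDr; congr (_ + _).
have -> : s ^+ b.+1 / b`!%:R = s ^+ b / b`!%:R * s by rewrite exprS; ring.
rewrite -scalerA; congr (_ *: _); rewrite natrD scalerDl -addrA [_ *: _ + h _]addrC -cartanE.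
rewrite scalerDr -{2}(tsum (iter b e v)) !scaler_sumr -big_split; apply: eq_bigr => k _ /=.
by rewrite !scalerA -scalerDl; congr (_ *: _); rewrite !natrD; ring.
Qed.

(** The derivative at s = 0 of [upper_lower_deriv]; the scalars coming from the cleared denominators
    cancel. *)
Lemma bracket_ef v : e (f v) - f (e v) = h v.
Proof.
pose c (z : 'I_Me + 'I_Me) : {poly C} := match z with
  | inl b => (b`!%:R^-1)%:P * 'X^b * (1 + 'X * 0%:P) ^+ 0
  | inr b => (b`!%:R^-1)%:P * 'X^(b.+1) * (1 + 'X * 0%:P) ^+ 0 end.
pose a (z : 'I_Me + 'I_Me) : V := match z with
  | inl b => iter b e (f v) - f (iter b e v)
  | inr b => m%:R *: iter b e v - ((Mf + (Me - b) + N)%:R *: iter b e v + h (iter b e v)) end.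
have := @poly_vect_deriv C V _ _ c (fun _ : 'I_0 => 0) a (fun _ => 0) 1 0 (oner_neq0 _).
case/(_ _)/Wrap => [s _|].
  rewrite big_ord0 big_sumType /= -big_split /=.
  have := upper_lower_deriv s v; rewrite !upperE scaler_sumr [f (\sum_(_ < _) _)]linear_sum -!big_split /=.
  move/eqP; rewrite -subr_eq0 -sumrB => /eqP H; rewrite -[RHS]H; apply: eq_bigr => b _.
  rewrite !(hornerM, hornerC, hornerXn) ?expr0 ?hornerC !mulr1 [f (_ *: _)]linearZ /=.
  rewrite [in RHS]opprD [in RHS]addrACA !scalerBr; congr (_ - _ + (_ - _)); rewrite ?scalerA; congr (_ *: _);
    by rewrite ?exprS; ring.
rewrite !big_ord0 big_sumType /=.
under eq_bigr => b _ do rewrite deriv0_monomial mul0r mulr0 addr0.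
under [X in _ + X]eq_bigr => b _ do rewrite deriv0_monomial !mul0r addr0.
have pick1 (u : nat -> V) : \sum_(b < Me) (b`!%:R^-1 * ((b : nat) == 1%N)%:R : C) *: u b = u 1%N.
  rewrite -(sum_delta u Me1); apply: eq_bigr => b _; congr (_ *: _).
  by case: eqP => [->|_]; rewrite ?mulr0 // invr1 mulr1.
have pick0 (u : nat -> V) : \sum_(b < Me) (b`!%:R^-1 * ((b.+1 : nat) == 1%N)%:R : C) *: u b = u 0%N.
  rewrite -(sum_delta u (ltnW Me1)); apply: eq_bigr => b _; congr (_ *: _).
  by rewrite eqSS; case: eqP => [->|_]; rewrite ?mulr0 // invr1 mulr1.
rewrite (pick1 (fun b => iter b e (f v) - f (iter b e v))).
rewrite (pick0 (fun b => m%:R *: iter b e v - ((Mf + (Me - b) + N)%:R *: iter b e v + h (iter b e v)))) /=.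
have -> : (Mf + (Me - 0) + N)%N = m by rewrite /m; lia.
by rewrite opprD addNKr => /subr0_eq.
Qed.

End Bracket.

(** * Decomposition into irreducible summands *)

Lemma span_free_sub (F : fieldType) (V : vectType F) (X : seq V) :
  exists2 s : seq V, free s /\ (<<s>> = <<X>>)%VS & {subset s <= X}.
Proof.
elim: X => [|x X [s [fs sX] sub]]; first by exists [::] => //; split=> //; apply: nil_free.
have [xs|xs] := boolP (x \in <<s>>%VS).
  exists s => [|y /sub]; last by rewrite inE => ->; rewrite orbT.
  split=> //; rewrite span_cons -sX; apply/esym/addv_idPr.
  by rewrite -memvE.
exists (x :: s) => [|y]; first by rewrite free_cons xs fs !span_cons sX.
by rewrite !inE => /orP[->//|/sub->]; rewrite orbT.
Qed.

Lemma pad_sum (V : nmodType) A B (a : nat -> V) :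
  (forall k, (A <= k)%N -> a k = 0) -> (forall k, (B <= k)%N -> a k = 0) ->
  \sum_(k < A) a k = \sum_(k < B) a k.
Proof.
move=> hA hB; have pad M N : (M <= N)%N -> (forall k, (M <= k)%N -> a k = 0) ->
    \sum_(k < M) a k = \sum_(k < N) a k.
  move=> MN h; rewrite (big_ord_widen N a MN) big_mkcond.
  by apply: eq_bigr => j _; case: ltnP => // /h.
have [AB|/ltnW BA] := leqP A B; first exact: pad.
by apply/esym/pad.
Qed.

Section Decomposition.
Variables (C : numClosedFieldType) (V : vectType C) (rho : SL2rep V).

Let repM g h v : rho (g * h)%g v = rho g (rho h v).
Proof. by rewrite rep_actM comp_lfunE. Qed.

Variables (N K : nat) (D : nat -> 'End(V)).
Hypothesis DK : forall k, (K <= k)%N -> D k = 0.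
Hypothesis torusE : forall t, t != 0 -> t ^+ N *: rho (torus t) = \sum_(k < K) t ^+ k *: D k.
Variables (e f : 'End(V)) (Me Mf : nat).
Hypothesis Me1 : (1 < Me)%N.
Hypothesis Mf1 : (1 < Mf)%N.
Hypothesis upperE : forall t v, rho (upper t) v = \sum_(k < Me) (t ^+ k / k`!%:R) *: iter k e v.
Hypothesis lowerE : forall t v, rho (lower t) v = \sum_(k < Mf) (t ^+ k / k`!%:R) *: iter k f v.
Hypothesis e_nil : forall v, iter Me e v = 0.
Hypothesis f_nil : forall v, iter Mf f v = 0.

Let h := cartan N K D.

Let hE v : lie_h e f v = h v.
Proof. exact: (bracket_ef torusE Me1 Mf1 upperE lowerE). Qed.

Let he v : lie_h e f (e v) = e (lie_h e f v) + 2%:R *: e v.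
Proof. by rewrite !hE; apply: (cartan_e torusE Me1 upperE). Qed.

Let hf v : lie_h e f (f v) = f (lie_h e f v) - 2%:R *: f v.
Proof. by rewrite !hE; apply: (cartan_f torusE Mf1 lowerE). Qed.

(** The kernel of e is spanned by the weight components of its elements, since the torus normalises
    e. A free subfamily of these is the required basis, and [hw_eq0] rules out negative weights. *)
Lemma highest_basis : exists d (u : d.-tuple V) (m : 'I_d -> nat),
  [/\ free u, (<<u>> = lker e)%VS & forall i : 'I_d, lie_h e f (u`_i) = (m i)%:R *: u`_i].
Proof.
pose X := [seq D k b | k <- iota 0 K, b <- vbasis (lker e)].
have [s [fs sX] sub] := span_free_sub X.
have XE x : x \in X -> exists2 k, e x = 0 & lie_h e f x = (k%:R - N%:R) *: x.
  case/allpairsP => [[k b]] /= [_ bX ->]; exists k.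
    rewrite -(torus_e_coef DK torusE Me1 upperE).
    have /eqP -> : e b == 0 by rewrite -memv_ker; apply: vbasis_mem.
    by rewrite linear0.
  by rewrite hE (cartan_torus DK torusE).
have spanX : (<<X>> = lker e)%VS.
  apply/eqP; rewrite eqEsubv; apply/andP; split.
    by apply/span_subvP => x /XE [k ex _]; rewrite memv_ker ex.
  rewrite -(span_basis (vbasisP (lker e))); apply/span_subvP => b bX.
  rewrite -(torus_sum torusE b); apply: memv_suml => k _; apply: memv_span.
  by apply/allpairsP; exists (k : nat, b); split=> //; rewrite mem_iota /= ltn_ord.
have [m hm] : exists m : 'I_(size s) -> nat, forall i : 'I_(size s), lie_h e f (s`_i) = (m i)%:R *: s`_i.
  apply: (@fin_all_exists _ _ (fun (i : 'I_(size s)) r => lie_h e f (s`_i) = r%:R *: s`_i)) => i.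
  have si : s`_i \in s by rewrite mem_nth.
  have [k ex hx] := XE _ (sub _ si); have [Nk|kN] := leqP N k.
    by exists (k - N)%N; rewrite natrB.
  have : s`_i = 0.
    apply: (hw_eq0 hf _ ex hx); first by exists Mf; apply: f_nil.
    by move=> j; rewrite subr_eq -natrD eqr_nat; lia.
  by move=> s0; move: fs; rewrite (perm_free (perm_to_rem si)) free_cons s0 mem0v.
by exists (size s), (in_tuple s), m; split=> //; rewrite sX.
Qed.

Variables (d : nat) (u : d.-tuple V) (m : 'I_d -> nat).
Hypotheses (fu : free u) (su : (<<u>> = lker e)%VS).
Hypothesis hu : forall i : 'I_d, lie_h e f (u`_i) = (m i)%:R *: u`_i.

Let eu i : (i < d)%N -> e (u`_i) = 0.
Proof. by move=> id; apply/eqP; rewrite -memv_ker -su memv_span // mem_nth // size_tuple. Qed.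

(** Divided powers make the unipotents act with binomial coefficients, matching [bform]. *)
Definition string_basis (i : 'I_d) j : V := j`!%:R^-1 *: iter j f (u`_i).

Lemma f_string i j : f (string_basis i j) = j.+1%:R *: string_basis i j.+1.
Proof.
rewrite /string_basis linearZ /= scalerA; congr (_ *: _).
by rewrite factS natrM; field; rewrite fact_neq0 -mulrS pnatr_eq0.
Qed.

Lemma e_string0 i : e (string_basis i 0) = 0.
Proof. by rewrite /string_basis linearZ /= eu // scaler0. Qed.

Lemma e_string i j : (j < m i)%N -> e (string_basis i j.+1) = (m i - j)%:R *: string_basis i j.
Proof.
move=> jm; rewrite /string_basis linearZ /= -iterS (e_iter_f hf _ (eu (ltn_ord i)) (hu i)) !scalerA.
rewrite natrB 1?ltnW //; congr (_ *: _).
by rewrite factS natrM; field; rewrite fact_neq0 -mulrS pnatr_eq0.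
Qed.

Lemma string_eq0 i j : (m i < j)%N -> string_basis i j = 0.
Proof.
move=> mj; rewrite /string_basis.
have h0 : iter (m i).+1 f (u`_i) = 0.
  apply: (hw_iter_f_eq0 hf _ (eu (ltn_ord i)) (hu i)).
  by exists Mf; apply: f_nil.
have -> : j = (j - (m i).+1 + (m i).+1)%N by lia.
rewrite [iter _ f _]iterD h0.
elim: (j - _)%N => /= [|n /eqP]; first by rewrite scaler0.
by rewrite scaler_eq0 invr_eq0 (negPf (fact_neq0 _ _)) => /eqP ->; rewrite linear0 scaler0.
Qed.

Lemma iter_f_string i j l :
  iter l f (string_basis i j) = (l`! * 'C(j + l, l))%:R *: string_basis i (j + l).
Proof.
elim: l => [|l IH]; first by rewrite addn0 bin0 scale1r.
rewrite iterS IH linearZ /= f_string scalerA addnS; congr (_ *: _); rewrite -natrM; congr _%:R.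
by have /= B := mul_bin_diag (j + l).+1 l; rewrite factS -[RHS]mulnA [RHS]mulnCA -B; ring.
Qed.

Lemma iter_e_string i j l : (j <= m i)%N -> (l <= j)%N ->
  iter l e (string_basis i j) = (l`! * 'C(m i - j + l, l))%:R *: string_basis i (j - l).
Proof.
move=> jm; elim: l => [|l IH] lj; first by rewrite subn0 addn0 bin0 scale1r.
rewrite iterS IH 1?ltnW // linearZ /=.
have -> : (j - l = (j - l.+1).+1)%N by lia.
rewrite e_string ?scalerA -?natrM; last by lia.
congr (_ / _ *: _); congr _%:R; have -> : (m i - (j - l.+1) = (m i - j + l).+1)%N by lia.
have /= B := mul_bin_diag (m i - j + l).+1 l.
by rewrite addnS factS -[RHS]mulnA [RHS]mulnCA -B; ring.
Qed.

Lemma iter_e_string0 i j l : (j <= m i)%N -> (j < l)%N -> iter l e (string_basis i j) = 0.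
Proof.
move=> jm jl; have -> : l = ((l - j.+1).+1 + j)%N by lia.
rewrite iterD iter_e_string // subnn iterSr linearZ /= e_string0 scaler0.
by elim: (l - _)%N => //= n ->; rewrite linear0.
Qed.

Lemma upper_string t i j : (j <= m i)%N ->
  rho (upper t) (string_basis i j) =
  \sum_(l < j.+1) (t ^+ l * 'C(m i - j + l, l)%:R) *: string_basis i (j - l).
Proof.
move=> jm; rewrite upperE.
rewrite (@pad_sum _ _ j.+1 (fun l => (t ^+ l / l`!%:R) *: iter l e (string_basis i j))).
- apply: eq_bigr => l _; rewrite (iter_e_string jm (ltn_ord l : l <= j)%N) scalerA natrM; congr (_ *: _).
  by field; apply: fact_neq0.
- move=> k Mk; have -> : k = (k - Me + Me)%N by lia.
  rewrite iterD e_nil; have -> : iter (k - Me) e 0 = 0 by elim: (k - Me)%N => //= n ->; rewrite linear0.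
  by rewrite scaler0.
- by move=> k jk; rewrite iter_e_string0 // scaler0.
Qed.

Lemma lower_string t i j : (j <= m i)%N ->
  rho (lower t) (string_basis i j) =
  \sum_(l < (m i - j).+1) (t ^+ l * 'C(j + l, l)%:R) *: string_basis i (j + l).
Proof.
move=> jm; rewrite lowerE.
rewrite (@pad_sum _ _ (m i - j).+1 (fun l => (t ^+ l / l`!%:R) *: iter l f (string_basis i j))).
- apply: eq_bigr => l _; rewrite iter_f_string scalerA natrM; congr (_ *: _).
  by field; apply: fact_neq0.
- move=> k Mk; have -> : k = (k - Mf + Mf)%N by lia.
  rewrite iterD f_nil; have -> : iter (k - Mf) f 0 = 0 by elim: (k - Mf)%N => //= n ->; rewrite linear0.
  by rewrite scaler0.
- by move=> k jk; rewrite iter_f_string string_eq0 ?scaler0 //; lia.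
Qed.

Let bas (a : coef_index m) := string_basis (tag a) (tagged a).

(** Apply e^j to a relation, with j the largest index carrying a nonzero coefficient. Shorter terms
    die and the others become nonzero multiples of the independent vectors of u. *)
Lemma string_free (c : coef_index m -> C) :
  \sum_a c a *: bas a = 0 -> forall a, c a = 0.
Proof.
move=> c0 a1; apply/eqP; apply: contraT => a1P.
have [a0 a0P amax] := @arg_maxnP _ a1 (fun a => c a != 0) (fun a => tagged a) a1P.
have a0m : (tagged a0 <= m (tag a0))%N by rewrite -ltnS.
have iterZ (g : 'End(V)) l x w : iter l g (x *: w) = x *: iter l g w.
  by elim: l => //= l ->; rewrite linearZ.
pose T v := coord u (tag a0) (iter (tagged a0) e v).
have T0 : T 0 = 0.
  by rewrite /T -(scale0r 0) iterZ scale0r linear0.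
have TD v w : T (v + w) = T v + T w.
  rewrite /T -linearD /=; congr (coord _ _ _).
  by elim: (nat_of_ord _) => //= l ->; rewrite linearD.
have := congr1 T c0; rewrite (big_morph T TD T0) T0 (bigD1 a0) //= big1 ?addr0 => [|a aa0].
  rewrite /T iterZ /bas iter_e_string // subnn /string_basis /= fact0 invr1 scale1r !linearZ /=.
  rewrite coord_free // eqxx mulr1 => /eqP.
  by rewrite mulf_eq0 (negPf a0P) pnatr_eq0 muln_eq0 -!leqn0 leqNgt fact_gt0 leqNgt bin_gt0 leq_addl.
have [->|ca] := eqVneq (c a) 0; first by rewrite scale0r T0.
have am : (tagged a <= m (tag a))%N by rewrite -ltnS.
have : (tagged a <= tagged a0)%N by apply: (amax a ca).
rewrite /T iterZ /bas leq_eqVlt => /orP[/eqP Ea|lt].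
  rewrite -Ea iter_e_string // subnn /string_basis /= fact0 invr1 scale1r !linearZ /=.
  rewrite coord_free //; have [Et|_] := eqVneq; last by rewrite !mulr0.
  case/eqP: aa0; case: a a0 Et Ea {am ca a0m a0P amax T TD T0} => [i j] [i' j'] /= Et.
  by subst i' => Ej; congr existT; apply: ord_inj.
by rewrite iter_e_string0 // scaler0 linear0.
Qed.

Let S := <<codom bas>>%VS.

Lemma string_span_f v : v \in S -> f v \in S.
Proof.
move=> vS; have : f v \in (f @: S)%VS by apply: memv_img.
apply/subvP; rewrite limg_span; apply/span_subvP => _ /mapP [_ /codomP [[i j] ->] ->].
rewrite /bas /= f_string; apply: memvZ; have [mj|jm] := ltnP (m i) j.+1.
  by rewrite string_eq0 // mem0v.
by apply/memv_span/codomP; exists (Tagged (fun i => 'I_(m i).+1) (Ordinal (jm : j.+1 < (m i).+1)%N)).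
Qed.

Lemma string_span_e v : v \in S -> e v \in S.
Proof.
move=> vS; have : e v \in (e @: S)%VS by apply: memv_img.
apply/subvP; rewrite limg_span; apply/span_subvP => _ /mapP [_ /codomP [[i [j jm]] ->] ->].
rewrite /bas /=; case: j jm => [|j] jm; first by rewrite e_string0 mem0v.
rewrite e_string //; apply: memvZ; apply/memv_span/codomP.
by exists (Tagged (fun i => 'I_(m i).+1) (Ordinal (ltnW jm))).
Qed.

Lemma iter_stable (g : 'End(V)) l v : (forall w, w \in S -> g w \in S) -> v \in S ->
  iter l g v \in S.
Proof. by move=> gS vS; elim: l => //= l; apply: gS. Qed.

Lemma string_span_rep g v : v \in S -> rho g v \in S.
Proof.
move: g v; apply: SL2_gen => [t v vS|t v vS|g g' hg hg' v vS].
- rewrite upperE; apply: memv_suml => k _; apply/memvZ/iter_stable => //; exact: string_span_e.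
- rewrite lowerE; apply: memv_suml => k _; apply/memvZ/iter_stable => //; exact: string_span_f.
- by rewrite repM; apply/hg/hg'.
Qed.

(** Induction on j. The vector w = e^j v is a highest weight vector of weight r + 2j, so a multiple
    of f^j w can be subtracted from v to get a vector killed by e^j; the scalar in e^j f^j w is
    nonzero because j is at most r + 2j. *)
Lemma string_span_weight r j v : lie_h e f v = r%:R *: v -> iter j e v = 0 -> v \in S.
Proof.
elim: j v => [|j IH] v hv /= ev; first by rewrite ev mem0v.
pose w := iter j e v.
have hw : lie_h e f w = (r + 2 * j)%:R *: w by rewrite (lie_h_iter_e he _ hv) natrD.
pose c := hw_coef (r + 2 * j)%:R j : C.
have c0 : c != 0 by apply: hw_coef_neq0; lia.
pose v' := v - c^-1 *: iter j f w.
have iterB l x y a : iter l e (x - a *: y) = iter l e x - a *: iter l e y.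
  by elim: l => //= l ->; rewrite linearB linearZ.
have wS : w \in S.
  have : w \in lker e by rewrite memv_ker ev.
  rewrite -su => /coord_span ->; apply: memv_suml => i _; apply/memvZ/memv_span/codomP.
  exists (Tagged (fun i => 'I_(m i).+1) (Ordinal (ltn0Sn (m i)))).
  by rewrite /bas /string_basis /= fact0 invr1 scale1r.
have -> : v = v' + c^-1 *: iter j f w by rewrite subrK.
apply: memvD; last by apply/memvZ/iter_stable => //; exact: string_span_f.
apply: IH.
  have hE' := lie_h_iter_f hf j hw.
  rewrite hE /v' linearB linearZ /= -!hE hv hE' scalerBr; congr (_ - _).
  by rewrite !scalerA; congr (_ *: _); rewrite natrD addrK mulrC.
by rewrite /v' iterB (iter_e_iter_f hf _ _ hw) ?scalerA ?mulVf ?scale1r ?subrr.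
Qed.

(* The Weyl element exchanges negative and positive weights. *)
Lemma string_span : S = fullv.
Proof.
apply/eqP; rewrite eqEsubv subvf; apply/subvP => v _.
rewrite -(torus_sum torusE v); apply: memv_suml => k _.
have hk := cartan_torus DK torusE k v.
have [Nk|kN] := leqP N k.
  by apply: (@string_span_weight (k - N) Me); rewrite ?e_nil // hE hk natrB.
have -> : D k v = rho (weyl C)^-1%g (rho (weyl C) (D k v)).
  by rewrite -repM mulVg rep_act1 id_lfunE.
apply/string_span_rep/(@string_span_weight (N - k) Me); rewrite ?e_nil // hE.
rewrite (cartan_weyl torusE) hk linearZ /= -scaleNr opprB natrB 1?ltnW //.
Qed.

Lemma string_coords v : exists c : coef_index m -> C, v = \sum_a c a *: bas a.
Proof.
have /coord_span E : v \in <<[tuple of codom bas]>>%VS by rewrite -[<<_>>%VS]/S string_span memvf.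
exists (fun a => coord [tuple of codom bas] (enum_rank a) v); rewrite {1}E.
rewrite (reindex (@enum_rank (coef_index m))) /=; last by apply: onW_bij; apply: enum_rank_bij.
apply: eq_bigr => a _; congr (_ *: _); rewrite -[(codom bas)`_ _](tnth_nth 0 [tuple of codom bas]).
by rewrite /tnth /= (nth_map a) ?nth_enum_rank // -cardE ltn_ord.
Qed.

End Decomposition.

Lemma rep_decomposition (C : numClosedFieldType) (V : vectType C) (rho : SL2rep V) :
  rational_rep rho ->
  exists k (m : 'I_k -> nat) (b : 'I_k -> nat -> V),
  [/\ forall c : coef_index m -> C, \sum_a c a *: b (tag a) (tagged a) = 0 -> forall a, c a = 0,
      forall v, exists c : coef_index m -> C, v = \sum_a c a *: b (tag a) (tagged a),
      forall t i j, (j <= m i)%N -> rho (upper t) (b i j) =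
        \sum_(l < j.+1) (t ^+ l * 'C(m i - j + l, l)%:R) *: b i (j - l)%N &
      forall t i j, (j <= m i)%N -> rho (lower t) (b i j) =
        \sum_(l < (m i - j).+1) (t ^+ l * 'C(j + l, l)%:R) *: b i (j + l)%N].
Proof.
move=> rat.
have [Me [E [Me1 EK upE]]] := upper_expand rat.
have [Mf [F [Mf1 FK loE]]] := lower_expand rat.
have [N [K [D [K1 DK toE]]]] := torus_expand rat.
have upE' := one_param_exp (@upperM C) (upper0 C) Me1 EK upE.
have loE' := one_param_exp (@lowerM C) (lower0 C) Mf1 FK loE.
have enil := one_param_nil (@upperM C) (upper0 C) Me1 EK upE.
have fnil := one_param_nil (@lowerM C) (lower0 C) Mf1 FK loE.
have [d [u [m [fu su hu]]]] := highest_basis DK toE Me1 Mf1 upE' loE' fnil.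
exists d, m, (string_basis (F 1%N) u); split.
- exact: (string_free toE Me1 Mf1 upE' loE' fu su hu).
- exact: (string_coords DK toE Me1 Mf1 upE' loE' enil fnil fu su hu).
- exact: (upper_string toE Me1 Mf1 upE' loE' enil fu su hu).
- exact: (lower_string toE Me1 Mf1 upE' loE' fnil fu su hu).
Qed.

(** * The null cone in the coefficients *)

Lemma sum_flip (V : nmodType) M j (G : nat -> nat -> V) : (j <= M)%N ->
  \sum_(l < j.+1) G l (j - l)%N = \sum_(i < M.+1) if (i <= j)%N then G (j - i)%N i else 0.
Proof.
move=> jM; rewrite (reindex_inj rev_ord_inj) /=.
transitivity (\sum_(i < j.+1) G (j - i)%N i).
  by apply: eq_bigr => l _; rewrite subSS subKn // -ltnS.
by rewrite (big_ord_widen M.+1 (fun i => G (j - i)%N i)) // big_mkcond.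
Qed.

Lemma sum_shift (V : nmodType) M j (G : nat -> nat -> V) : (j <= M)%N ->
  \sum_(l < (M - j).+1) G l (j + l)%N = \sum_(i < M.+1) if (j <= i)%N then G (i - j)%N i else 0.
Proof.
move=> jM; rewrite -[RHS](big_mkord xpredT (fun i => if (j <= i)%N then G (i - j)%N i else 0)).
rewrite (big_cat_nat (n := j)) ?leqW //= big_nat [X in _ = X + _]big1 ?add0r => [|i ij]; last first.
  by rewrite ifN // -ltnNge; lia.
set F := fun i : nat => if (j <= i)%N then G (i - j)%N i else 0.
have -> : \sum_(j <= i < M.+1) F i = \sum_(0 <= i < M.+1 - j) F (i + j)%N.
  by rewrite -{1}[j]add0n big_addn.
rewrite big_mkord subSn // /F; apply: eq_bigr => l _.
by rewrite leq_addl addnK addnC.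
Qed.

Section Bridge.
Variables (C : numClosedFieldType) (V : vectType C) (rho : SL2rep V).

Let repM g h v : rho (g * h)%g v = rho g (rho h v).
Proof. by rewrite rep_actM comp_lfunE. Qed.

Variables (k : nat) (m : 'I_k -> nat) (b : 'I_k -> nat -> V).
Hypothesis b_free : forall c : coef_index m -> C,
  \sum_a c a *: b (tag a) (tagged a) = 0 -> forall a, c a = 0.
Hypothesis b_span : forall v, exists c : coef_index m -> C, v = \sum_a c a *: b (tag a) (tagged a).
Hypothesis b_upper : forall t i j, (j <= m i)%N -> rho (upper t) (b i j) =
  \sum_(l < j.+1) (t ^+ l * 'C(m i - j + l, l)%:R) *: b i (j - l)%N.
Hypothesis b_lower : forall t i j, (j <= m i)%N -> rho (lower t) (b i j) =
  \sum_(l < (m i - j).+1) (t ^+ l * 'C(j + l, l)%:R) *: b i (j + l)%N.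

Notation n := #|{: coef_index m}|.
Notation A := {mpoly C[n]}.
Notation Y := (@Y C k m).

Definition form_basis : n.-tuple V :=
  [tuple b (tag (enum_val a)) (tagged (enum_val a)) | a < n].

Lemma form_basisE (a : 'I_n) : form_basis`_a = b (tag (enum_val a)) (tagged (enum_val a)).
Proof. by rewrite -tnth_nth tnth_mktuple. Qed.

Lemma sum_coef_index (W : nmodType) (c : coef_index m -> W) :
  \sum_(a < n) c (enum_val a) = \sum_a c a.
Proof.
by rewrite [RHS](reindex (@enum_val (coef_index m) predT)) //=; apply: onW_bij; apply: enum_val_bij.
Qed.

Lemma form_basis_free : free form_basis.
Proof.
apply/freeP => c c0 a; have [c' cE] : exists c', forall a, c a = c' (enum_val a : coef_index m).
  by exists (c \o enum_rank) => x /=; rewrite enum_valK.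
rewrite cE; apply: b_free; rewrite -[RHS]c0 -sum_coef_index.
by apply: eq_bigr => x _; rewrite form_basisE cE.
Qed.

Lemma form_basis_full v : v = \sum_a coord form_basis a v *: form_basis`_a.
Proof.
apply: coord_span; have [c ->] := b_span v; rewrite -sum_coef_index.
apply: memv_suml => a _; rewrite -form_basisE; apply/memvZ/memv_span/mem_nth.
by rewrite size_tuple.
Qed.

Definition pt v (a : 'I_n) : C := coord form_basis a v.

Lemma pt_sum (x : 'I_n -> C) a : pt (\sum_a x a *: form_basis`_a) a = x a.
Proof. by rewrite /pt coord_sum_free // form_basis_free. Qed.

Lemma pt0 a : pt 0 a = 0. Proof. exact: linear0. Qed.

Lemma sum_forms (W : nmodType) (F : 'I_k -> nat -> W) :
  \sum_(a < n) F (tag (enum_val a)) (tagged (enum_val a)) = \sum_i \sum_(j < (m i).+1) F i j.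
Proof.
rewrite (sum_coef_index (fun a => F (tag a) (tagged a))).
by rewrite (sig_big_dep _ _ (fun i (j : 'I_(m i).+1) => F i j)).
Qed.

Lemma form_coords v : v = \sum_i \sum_(j < (m i).+1) (Y i j).@[pt v] *: b i j.
Proof.
rewrite -(sum_forms (fun i j => (Y i j).@[pt v] *: b i j)) {1}[v]form_basis_full.
by apply: eq_bigr => a _; rewrite form_basisE Y_var mevalXU.
Qed.

Lemma pt_forms (F : 'I_k -> nat -> C) a :
  pt (\sum_i \sum_(j < (m i).+1) F i j *: b i j) a = F (tag (enum_val a)) (tagged (enum_val a)).
Proof.
rewrite -(sum_forms (fun i j => F i j *: b i j)).
under eq_bigr => x _ do rewrite -form_basisE.
exact: (pt_sum (fun a => F (tag (enum_val a)) (tagged (enum_val a)))).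
Qed.

(** Coordinates transform dually to basis vectors: coordinate j of the image collects the
    coordinates j + l. So [upper] corresponds to the flow of [opF], and [lower] to that of [opE]. *)
Lemma pt_upper t v a : pt (rho (upper t) v) a = flowF t (pt v) a.
Proof.
pose F i j := \sum_(l < (m i - j).+1) (Y i (j + l)).@[pt v] * (t ^+ l * 'C(m i - j, l)%:R).
transitivity (F (tag (enum_val a)) (tagged (enum_val a))); last first.
  rewrite /F /flowF /serF; case: (enum_val a) => i j /=.
  rewrite horner_poly raddf_sum /= -(@pad_sum _ (m i - j).+1 (m i).+1
    (fun l => ('C(m i - j, l)%:R * Y i (j + l) * t%:MP ^+ l).@[pt v])).
  - apply: eq_bigr => l _; rewrite !mevalM rmorphXn /= mevalC -mpolyC_nat mevalC; ring.
  - by move=> l jl; rewrite Y_large ?mulr0 ?mul0r ?meval0 //; lia.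
  - by move=> l jl; rewrite Y_large ?mulr0 ?mul0r ?meval0 //; lia.
rewrite -pt_forms; congr (pt _ a); rewrite {1}[v]form_coords linear_sum; apply: eq_bigr => i _.
rewrite /= linear_sum /=.
transitivity (\sum_(j < (m i).+1) \sum_(j' < (m i).+1) (if (j' <= j)%N then
    ((Y i j).@[pt v] * (t ^+ (j - j') * 'C(m i - j', j - j')%:R)) *: b i j' else 0)).
  apply: eq_bigr => j _; have jm : (j <= m i)%N by rewrite -ltnS.
  rewrite linearZ /= b_upper // scaler_sumr.
  rewrite (sum_flip (fun l j' => (Y i j).@[pt v] *: ((t ^+ l * 'C(m i - j + l, l)%:R) *: b i j')) jm).
  apply: eq_bigr => j' _; case: ifP => // jj.
  by rewrite scalerA (_ : m i - j + (j - j') = m i - j')%N; last lia.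
rewrite exchange_big; apply: eq_bigr => j' _ /=; have jm : (j' <= m i)%N by rewrite -ltnS.
rewrite /F scaler_suml (sum_shift (fun l j => ((Y i j).@[pt v] *
  (t ^+ l * 'C(m i - j', l)%:R)) *: b i j') jm).
by [].
Qed.

Lemma pt_lower t v a : pt (rho (lower t) v) a = flowE t (pt v) a.
Proof.
pose F i j := \sum_(l < j.+1) (Y i (j - l)).@[pt v] * (t ^+ l * 'C(j, l)%:R).
transitivity (F (tag (enum_val a)) (tagged (enum_val a))); last first.
  rewrite /F /flowE /serE horner_poly raddf_sum /=.
  by apply: eq_bigr => l _; rewrite !mevalM rmorphXn /= mevalC -mpolyC_nat mevalC; ring.
rewrite -pt_forms; congr (pt _ a); rewrite {1}[v]form_coords linear_sum; apply: eq_bigr => i _.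
rewrite /= linear_sum /=.
transitivity (\sum_(j < (m i).+1) \sum_(j' < (m i).+1) (if (j <= j')%N then
    ((Y i j).@[pt v] * (t ^+ (j' - j) * 'C(j', j' - j)%:R)) *: b i j' else 0)).
  apply: eq_bigr => j _; have jm : (j <= m i)%N by rewrite -ltnS.
  rewrite linearZ /= b_lower // scaler_sumr.
  rewrite (sum_shift (fun l j' => (Y i j).@[pt v] *: ((t ^+ l * 'C(j + l, l)%:R) *: b i j')) jm).
  by apply: eq_bigr => j' _; case: ifP => // jj; rewrite scalerA subnKC.
rewrite exchange_big; apply: eq_bigr => j' _ /=; have jm : (j' <= m i)%N by rewrite -ltnS.
by rewrite /F scaler_suml (sum_flip (fun l j => ((Y i j).@[pt v] *
  (t ^+ l * 'C(j', l)%:R)) *: b i j') jm).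
Qed.

Let d := \dim {:V}.

Definition to_forms (f : coord_ring V) : A :=
  f \mPo [tuple \sum_(a < n) coord (vbasis {:V}) i form_basis`_a *: 'X_a | i < d].
Definition of_forms (p : A) : coord_ring V :=
  p \mPo [tuple \sum_(i < d) coord form_basis a (vbasis {:V})`_i *: 'X_i | a < n].

Lemma to_formsE f v : (to_forms f).@[pt v] = eval_at v f.
Proof.
rewrite /to_forms comp_mpoly_meval; apply: meval_eq => i; rewrite tnth_mktuple raddf_sum /=.
rewrite {2}[v]form_basis_full linear_sum; apply: eq_bigr => a _.
by rewrite mevalZ mevalXU linearZ /= mulrC.
Qed.

Lemma of_formsE p v : eval_at v (of_forms p) = p.@[pt v].
Proof.
rewrite /eval_at comp_mpoly_meval; apply: meval_eq => a; rewrite tnth_mktuple raddf_sum /=.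
rewrite /pt {2}(coord_vbasis (memvf v)) linear_sum; apply: eq_bigr => i _.
by rewrite mevalZ mevalXU linearZ /= mulrC.
Qed.

Lemma meval_pt_eq (p q : A) : (forall v, p.@[pt v] = q.@[pt v]) -> p = q.
Proof.
move=> pq; apply/eqP; rewrite -subr_eq0; apply/eqP/mpoly_vanish => x.
rewrite mevalB -!(meval_eq _ (pt_sum x)).
by rewrite pq subrr.
Qed.

Lemma killed_invariant (h : A) : opE h = 0 -> opF h = 0 -> Defs.invariant rho (of_forms h).
Proof.
move=> Eh Fh g; move: g; apply: SL2_gen => [t v|t v|g g' hg hg' v].
- by rewrite !of_formsE (meval_eq _ (pt_upper t v)) flowF_const.
- by rewrite !of_formsE (meval_eq _ (pt_lower t v)) flowE_const.
- by rewrite repM hg hg'.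
Qed.

(** An invariant is constant along both flows, so the first order terms of its Taylor series
    vanish. *)
Lemma invariant_killed f : Defs.invariant rho f -> eval_at 0 f = 0 -> ideal_gen0 (to_forms f).
Proof.
move=> inv f0; split; last by rewrite -[RHS]f0 -to_formsE; apply: meval_eq => a; rewrite pt0.
- apply: meval_pt_eq => v; rewrite meval0; have [P [hP PE]] := flowEP (to_forms f).
  apply: (exp_series_const 0 hP (c := eval_at v f)) => t.
  by rewrite -PE -(meval_eq _ (pt_lower t v)) to_formsE inv.
- apply: meval_pt_eq => v; rewrite meval0; have [P [hP PE]] := flowFP (to_forms f).
  apply: (exp_series_const 0 hP (c := eval_at v f)) => t.
  by rewrite -PE -(meval_eq _ (pt_upper t v)) to_formsE inv.
Qed.

Definition null_pt (x : 'I_n -> C) := exists2 v, null_cone rho v & x =1 pt v.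

Lemma null_cone_rep g v : null_cone rho v -> null_cone rho (rho g v).
Proof. by move=> nv f inv; rewrite inv nv. Qed.

Lemma null_pt_closed : null_closed null_pt.
Proof.
split=> [t x [v nv xv]|x h [v nv xv] Eh Fh].
  split.
    exists (rho (lower t) v); first exact: null_cone_rep.
    by move=> a; rewrite pt_lower; apply: meval_eq.
  exists (rho (upper t) v); first exact: null_cone_rep.
  by move=> a; rewrite pt_upper; apply: meval_eq.
rewrite (meval_eq _ xv) -of_formsE nv; last exact: killed_invariant.
by rewrite of_formsE; apply: meval_eq => a; rewrite pt0.
Qed.

Lemma coreduced_forms : coreduced rho -> forall phi : A,
  (forall x, null_pt x -> phi.@[x] = 0) -> exists l : seq (A * A),
    (forall x, x \in l -> ideal_gen0 x.2) /\ phi = \sum_(x <- l) x.1 * x.2.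
Proof.
move=> cored phi phi0; have [|l [hl phiE]] := (cored (of_forms phi)).1.
  by move=> v nv; rewrite of_formsE phi0 //; exists v.
exists [seq (to_forms x.1, to_forms x.2) | x <- l]; split.
  by move=> _ /mapP[x /hl [inv x0] ->]; apply: invariant_killed.
apply: meval_pt_eq => v; rewrite -of_formsE phiE big_map /eval_at !raddf_sum /=.
by apply: eq_bigr => x _; rewrite !mevalM -!/(eval_at _ _) !to_formsE.
Qed.

(** A summand of degree 0 would be spanned by a nonzero vector fixed by both unipotent subgroups. *)
Lemma no_fixed_degree : (forall v : V, fixed_point rho v -> v = 0) -> forall i, (0 < m i)%N.
Proof.
move=> nofix i; rewrite lt0n; apply/eqP => mi0.
have b0 : b i 0 = 0.
  apply: nofix; apply: SL2_gen => [t|t|g h hg hh]; last by rewrite repM hh.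
    by rewrite b_upper // big_ord1 mi0 bin0 mul1r scale1r.
  by rewrite b_lower // mi0 big_ord1 bin0 mul1r scale1r.
pose a0 : coef_index m := Tagged (fun i => 'I_(m i).+1) (ord0 : 'I_(m i).+1).
have := @b_free (fun a => (a == a0)%:R); case/(_ _ a0)/Wrap.
  rewrite (bigD1 a0) //= b0 scaler0 add0r big1 // => a /negPf ->.
  by rewrite scale0r.
by rewrite eqxx => /eqP; rewrite oner_eq0.
Qed.

Lemma rep_degrees : coreduced rho -> (forall v : V, fixed_point rho v -> v = 0) ->
  (forall i, m i = 1%N) \/ exists i, (1 < m i <= 4)%N /\ forall i', i' = i.
Proof.
move=> cored nofix; apply: (coreduced_degrees (no_fixed_degree nofix) null_pt_closed).
exact: coreduced_forms.
Qed.

End Bridge.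

(** * Equivariant maps to binary forms *)

Section BinaryMonomials.
Variable C : numClosedFieldType.

Definition bimon d j : 'X_{1..2} := [multinom if i == 0%R then (d - j)%N else j | i < 2].

Lemma bimonE d j : ('X_[bimon d j] : {mpoly C[2]}) = 'X_0 ^+ (d - j) * 'X_1 ^+ j.
Proof.
by rewrite mpolyXE_id !big_ord_recl big_ord0 mulr1 !mnmE /=; congr (_ * 'X_ _ ^+ _).
Qed.

Lemma mdeg_bimon d j : (j <= d)%N -> mdeg (bimon d j) = d.
Proof. by move=> jd; rewrite mdegE !big_ord_recl big_ord0 !mnmE /= addn0 subnK. Qed.

Lemma bimon_mdeg mu : mu = bimon (mdeg mu) (mu 1).
Proof.
have E : mdeg mu = (mu 0%R + mu 1%R)%N.
  by rewrite mdegE !big_ord_recl big_ord0 addn0; congr (_ + mu _)%N; apply: val_inj.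
apply/mnmP => i; rewrite mnmE; case: eqP => [->|]; first by rewrite E addnK.
by case: i => [[|[|]]] // hi i0; [case: i0; apply: val_inj | congr (mu _); apply: val_inj].
Qed.

Lemma bimon_inj d j j' : bimon d j = bimon d j' -> j = j'.
Proof. by move/mnmP/(_ 1); rewrite !mnmE. Qed.

Lemma bform_homog d j : ('C(d, j)%:R *: 'X_[bimon d j] : {mpoly C[2]}) \is d.-homog.
Proof.
have [jd|jd] := leqP j d; last by rewrite bin_small // scale0r dhomog0.
by apply: rpredZ; rewrite dhomogX /= mdeg_bimon.
Qed.

(** The binomial factor makes the unipotents act on these forms exactly as on the basis of
    [rep_decomposition]. *)
Definition bform d j : dhomog 2 C d := DHomog (bform_homog d j).

Lemma val_bform_sum d (I : finType) (c : I -> C) (j : I -> nat) :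
  mpoly_of_dhomog (\sum_l c l *: bform d (j l)) =
  \sum_l (c l * 'C(d, j l)%:R) *: 'X_[bimon d (j l)].
Proof.
rewrite linear_sum; apply: eq_bigr => l _.
by rewrite linearZ /= scalerA.
Qed.

Lemma bin_upper d j l : (j <= d)%N -> (l <= j)%N ->
  ('C(d, j) * 'C(j, l) = 'C(d - j + l, l) * 'C(d, j - l))%N.
Proof.
move=> jd lj; apply/eqP; rewrite -(eqn_pmul2r (fact_gt0 l)) -(eqn_pmul2r (fact_gt0 (j - l))).
rewrite -(eqn_pmul2r (fact_gt0 (d - j))); apply/eqP.
have E1 := bin_fact jd; have E2 := bin_fact lj.
have ldj : (l <= d - j + l)%N by lia.
have jld : (j - l <= d)%N by lia.
have E3 := bin_fact ldj; have E4 := bin_fact jld.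
rewrite addnK in E3; rewrite (_ : d - (j - l) = d - j + l)%N in E4; last by lia.
transitivity (d`!); first by rewrite -E1 -E2; ring.
by rewrite -E4 -E3; ring.
Qed.

Lemma bin_lower d j l : (j <= d)%N -> (l <= d - j)%N ->
  ('C(d, j) * 'C(d - j, l) = 'C(j + l, l) * 'C(d, j + l))%N.
Proof.
move=> jd lj; apply/eqP; rewrite -(eqn_pmul2r (fact_gt0 l)) -(eqn_pmul2r (fact_gt0 j)).
rewrite -(eqn_pmul2r (fact_gt0 (d - j - l))); apply/eqP.
have E1 := bin_fact jd; have E2 := bin_fact lj.
have ldj : (l <= j + l)%N by lia.
have jld : (j + l <= d)%N by lia.
have E3 := bin_fact ldj; have E4 := bin_fact jld.
rewrite addnK in E3; rewrite (_ : d - (j + l) = d - j - l)%N in E4; last by lia.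
transitivity (d`!); first by rewrite -E1 -E2; ring.
by rewrite -E4 -E3; ring.
Qed.

Lemma subst_upper (t : C) : (tnth (SL2_subst (upper t)) 0 = 'X_0) *
  (tnth (SL2_subst (upper t)) 1 = t *: 'X_0 + 'X_1).
Proof.
have X1 : ('X_(lift ord0 ord0) : {mpoly C[2]}) = 'X_1 by congr 'X_ _; apply: val_inj.
by split; rewrite tnth_mktuple !big_ord_recl big_ord0 X1 sl2E ?mxE /= ?scale1r ?scale0r ?addr0 //; ring.
Qed.

Lemma subst_lower (t : C) : (tnth (SL2_subst (lower t)) 0 = 'X_0 + t *: 'X_1) *
  (tnth (SL2_subst (lower t)) 1 = 'X_1).
Proof.
have X1 : ('X_(lift ord0 ord0) : {mpoly C[2]}) = 'X_1 by congr 'X_ _; apply: val_inj.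
split; rewrite tnth_mktuple !big_ord_recl big_ord0 X1 sl2E ?mxE /=.
all: by rewrite ?scale1r ?scale0r ?add0r ?addr0 //; ring.
Qed.

Lemma comp_bform (g : SL2 C) d j : (mpoly_of_dhomog (bform d j)) \mPo SL2_subst g =
  'C(d, j)%:R *: (tnth (SL2_subst g) 0 ^+ (d - j) * tnth (SL2_subst g) 1 ^+ j).
Proof.
rewrite /= linearZ /= comp_mpolyX !big_ord_recl big_ord0 mulr1 !mnmE /=.
by congr (_ *: (_ * tnth _ _ ^+ _)); apply: val_inj.
Qed.

Lemma Rrep_upper (t : C) d j : (j <= d)%N -> Rrep C d (upper t) (bform d j) =
  \sum_(l < j.+1) (t ^+ l * 'C(d - j + l, l)%:R) *: bform d (j - l)%N.
Proof.
move=> jd; rewrite lfunE; apply: val_inj.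
rewrite -[LHS]/(mpoly_of_dhomog (bform d j) \mPo _) comp_bform.
rewrite -[RHS]/(mpoly_of_dhomog _) (val_bform_sum d _ (fun l : 'I_j.+1 => (j - l)%N)) !subst_upper.
rewrite addrC exprDn mulr_sumr scaler_sumr; apply: eq_bigr => l _.
have lj : (l <= j)%N by rewrite -ltnS.
rewrite bimonE -mulrA -natrM -bin_upper // (_ : d - (j - l) = d - j + l)%N; last by lia.
rewrite exprD exprZn -scaler_nat natrM -!mul_mpolyC !mpolyCM; ring.
Qed.

Lemma Rrep_lower (t : C) d j : (j <= d)%N -> Rrep C d (lower t) (bform d j) =
  \sum_(l < (d - j).+1) (t ^+ l * 'C(j + l, l)%:R) *: bform d (j + l)%N.
Proof.
move=> jd; rewrite lfunE; apply: val_inj.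
rewrite -[LHS]/(mpoly_of_dhomog (bform d j) \mPo _) comp_bform.
rewrite -[RHS]/(mpoly_of_dhomog _) (val_bform_sum d _ (fun l : 'I_(d - j).+1 => (j + l)%N)) !subst_lower.
rewrite exprDn mulr_suml scaler_sumr; apply: eq_bigr => l _.
have lj : (l <= d - j)%N by rewrite -ltnS.
rewrite bimonE -mulrA -natrM -bin_lower // subnDA.
rewrite exprD exprZn -scaler_nat natrM -!mul_mpolyC !mpolyCM; ring.
Qed.

Lemma bform_coef d (c : nat -> C) j : (j <= d)%N ->
  (mpoly_of_dhomog (\sum_(l < d.+1) c l *: bform d l))@_(bimon d j) = c j * 'C(d, j)%:R.
Proof.
rewrite -ltnS => jd; rewrite (val_bform_sum d (fun l : 'I_d.+1 => c l) (fun l : 'I_d.+1 => l : nat)).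
rewrite raddf_sum (bigD1 (Ordinal jd)) //= mcoeffZ mcoeffX eqxx mulr1 big1 ?addr0 // => l lj.
rewrite mcoeffZ mcoeffX; case: eqP => [/bimon_inj E|_]; last by rewrite mulr0.
by case/eqP: lj; apply: val_inj.
Qed.

Lemma bform_span d (p : dhomog 2 C d) : exists c : nat -> C, p = \sum_(l < d.+1) c l *: bform d l.
Proof.
pose c j := (mpoly_of_dhomog p)@_(bimon d j) / 'C(d, j)%:R.
exists c; apply: val_inj; apply/mpolyP => mu.
have [dmu|dmu] := eqVneq (mdeg mu) d; last first.
  by rewrite !(dhomog_nemf_coeff (dhomog_is_dhomog _) dmu).
have muE := bimon_mdeg mu; rewrite dmu in muE.
have mu1 : (mu 1%R <= d)%N by rewrite -dmu mdegE (bigD1 1) //= leq_addr.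
rewrite muE; apply/esym/(etrans (bform_coef c mu1)).
by rewrite /c divfK // pnatr_eq0 -lt0n bin_gt0.
Qed.

End BinaryMonomials.

Section FormMaps.
Variables (C : numClosedFieldType) (V : vectType C) (rho : SL2rep V).

Let repM g h v : rho (g * h)%g v = rho g (rho h v).
Proof. by rewrite rep_actM comp_lfunE. Qed.

Variables (k : nat) (m : 'I_k -> nat) (b : 'I_k -> nat -> V).
Hypothesis b_free : forall c : coef_index m -> C,
  \sum_a c a *: b (tag a) (tagged a) = 0 -> forall a, c a = 0.
Hypothesis b_span : forall v, exists c : coef_index m -> C, v = \sum_a c a *: b (tag a) (tagged a).
Hypothesis b_upper : forall t i j, (j <= m i)%N -> rho (upper t) (b i j) =
  \sum_(l < j.+1) (t ^+ l * 'C(m i - j + l, l)%:R) *: b i (j - l)%N.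
Hypothesis b_lower : forall t i j, (j <= m i)%N -> rho (lower t) (b i j) =
  \sum_(l < (m i - j).+1) (t ^+ l * 'C(j + l, l)%:R) *: b i (j + l)%N.

Notation n := #|{: coef_index m}|.
Notation X := (form_basis m b).

(** The degree [d] is kept apart from [m i] so that, when all degrees are 1, the maps for different
    i have the same target. *)
Definition form_map i d (v : V) : dhomog 2 C d :=
  \sum_(j < d.+1) coord X (coef_rank m i j) v *: bform C d j.

Fact form_map_is_linear i d : linear (form_map i d).
Proof.
move=> c u v; rewrite /form_map scaler_sumr -big_split; apply: eq_bigr => j _ /=.
by rewrite linearP scalerDl scalerA.
Qed.

HB.instance Definition _ i d := GRing.isLinear.Build C V (dhomog 2 C d) _
  (form_map i d) (form_map_is_linear i d).

Lemma form_map_basis i j i' : (j <= m i)%N ->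
  form_map i' (m i') (b i j) = if i' == i then bform C (m i') j else 0.
Proof.
move=> jm; have -> : b i j = X`_(coef_rank m i j).
  by rewrite form_basisE coef_rankK //= inordK.
rewrite /form_map; case: eqVneq => [->|ii'].
  rewrite (bigD1 (inord j)) //= inordK // coord_free ?form_basis_free // eqxx scale1r.
  rewrite big1 ?addr0 // => l lj; rewrite coord_free ?form_basis_free //.
  case: eqP => [E|_]; last by rewrite scale0r.
  have /= := congr1 (@coef_pos _ m) E; rewrite !coef_rank_pos // -1?ltnS // => -[jl].
  by case/eqP: lj; apply: val_inj; rewrite /= inordK.
rewrite big1 // => l _; rewrite coord_free ?form_basis_free //.
case: eqP => [E|_]; last by rewrite scale0r.
have /= := congr1 (@coef_pos _ m) E; rewrite !coef_rank_pos // -1?ltnS // => -[E'].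
by rewrite E' eqxx in ii'.
Qed.

Lemma linear_basis_eq (W : lmodType C) (F G : {linear V -> W}) :
  (forall i j, (j <= m i)%N -> F (b i j) = G (b i j)) -> F =1 G.
Proof.
move=> FG v; have [c ->] := b_span v; rewrite !linear_sum; apply: eq_bigr => a _.
by rewrite !linearZ /= FG // -ltnS.
Qed.

(** It suffices to compare both sides on the generators and on the basis vectors, where they have
    the same binomial coefficients. *)
Lemma form_map_rep i g v : form_map i (m i) (rho g v) = Rrep C (m i) g (form_map i (m i) v).
Proof.
move: g v; apply: SL2_gen => [t|t|g h hg hh v].
- apply: (linear_basis_eq (F := form_map i (m i) \o rho (upper t))
    (G := Rrep C (m i) (upper t) \o form_map i (m i))) => i' j jm /=.
  rewrite b_upper // form_map_basis // linear_sum.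
  case: eqVneq jm => [<- jm|ii' jm].
    rewrite Rrep_upper //; apply: eq_bigr => l _.
    by rewrite linearZ /= form_map_basis ?eqxx // (leq_trans (leq_subr _ _)).
  rewrite linear0 big1 // => l _.
  by rewrite linearZ /= form_map_basis ?(negPf ii') ?scaler0 // (leq_trans (leq_subr _ _)).
- apply: (linear_basis_eq (F := form_map i (m i) \o rho (lower t))
    (G := Rrep C (m i) (lower t) \o form_map i (m i))) => i' j jm /=.
  rewrite b_lower // form_map_basis // linear_sum.
  have jl (l : 'I_(m i' - j).+1) : (j + l <= m i')%N by have ll := ltn_ord l; lia.
  case: eqVneq jm jl => [<- jm jl|ii' jm jl].
    rewrite Rrep_lower //; apply: eq_bigr => l _.
    by rewrite linearZ /= form_map_basis ?eqxx.
  rewrite linear0 big1 // => l _.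
  by rewrite linearZ /= form_map_basis ?(negPf ii') ?scaler0.
- by rewrite repM hg hh rep_actM comp_lfunE.
Qed.

Lemma form_map_inj v : (forall i, form_map i (m i) v = 0) -> v = 0.
Proof.
move=> v0; rewrite [v](form_basis_full b_span) big1 // => a _.
have am : (tagged (enum_val a) <= m (tag (enum_val a)))%N by rewrite -ltnS.
have := bform_coef (fun j => coord X (coef_rank m (tag (enum_val a)) j) v) am.
rewrite -/(form_map _ _ v) v0 mcoeff0 coef_rank_enum => /esym/eqP.
by rewrite mulf_eq0 pnatr_eq0 (gtn_eqF (_ : 0 < 'C(_, _))%N) ?bin_gt0 // orbF => /eqP ->; rewrite scale0r.
Qed.

Lemma form_map_surj i (q : dhomog 2 C (m i)) : exists v, form_map i (m i) v = q /\
  forall i', i' != i -> form_map i' (m i') v = 0.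
Proof.
have [c ->] := bform_span q; exists (\sum_(l < (m i).+1) c l *: b i l).
split=> [|i' ii']; rewrite linear_sum; last first.
  by rewrite big1 // => l _; rewrite linearZ /= form_map_basis -1?ltnS // (negPf ii') scaler0.
by apply: eq_bigr => l _; rewrite linearZ /= form_map_basis -1?ltnS // eqxx.
Qed.

Lemma bijective_lfun (W : vectType C) (f : 'Hom(V, W)) :
  (forall v, f v = 0 -> v = 0) -> (forall w, exists v, f v = w) -> bijective f.
Proof.
move=> finj fsurj; exists (f^-1)%VF => [|w].
  apply/lker0_lfunK/eqP; apply/eqP; rewrite -subv0; apply/subvP => v.
  by rewrite memv_ker memv0 => /eqP /finj ->.
by apply: limg_lfunVK; have [v <-] := fsurj w; apply: memv_img; apply: memvf.
Qed.

Lemma single_summand i : (forall i', i' = i) -> isomorphic_rep rho (Rrep C (m i)).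
Proof.
move=> all_i; exists (linfun (form_map i (m i))); split=> [|g v]; last first.
  by rewrite [LHS]lfunE /= form_map_rep; congr (Rrep C (m i) g _); rewrite lfunE.
apply: bijective_lfun => [v|q].
  by rewrite lfunE => v0; apply: form_map_inj => i'; rewrite (all_i i').
by have [v [<- _]] := form_map_surj q; exists v; rewrite lfunE.
Qed.

Definition copies_map (v : V) : {ffun 'I_k -> dhomog 2 C 1} := [ffun i => form_map i 1 v].

Fact copies_map_is_linear : linear copies_map.
Proof. by move=> c u v; apply/ffunP => i; rewrite !ffunE linearP. Qed.

HB.instance Definition _ := GRing.isLinear.Build C V {ffun 'I_k -> dhomog 2 C 1} _
  copies_map copies_map_is_linear.

Lemma linear_summands : (forall i, m i = 1%N) -> isomorphic_rep rho (copies (Rrep C 1) k).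
Proof.
move=> m1; exists (linfun copies_map); split=> [|g v]; last first.
  rewrite !lfunE; apply/ffunP => i; rewrite !ffunE.
  by have := form_map_rep i g v; rewrite m1.
apply: bijective_lfun => [v|q].
  rewrite lfunE => /ffunP v0; apply: form_map_inj => i.
  by have := v0 i; rewrite !ffunE m1.
have hv i : exists v, forall i', form_map i' 1 v = if i' == i then q i else 0.
  have := @form_map_surj i; rewrite m1 => /(_ (q i)) [v [vi vi']]; exists v => i'.
  by case: eqP => [->//|/eqP ii']; have := vi' i' ii'; rewrite m1.
have [v {}hv] := fin_all_exists hv.
exists (\sum_i v i); rewrite lfunE; apply/ffunP => i; rewrite ffunE linear_sum (bigD1 i) //=.
rewrite hv eqxx big1 ?addr0 // => i' ii'.
by rewrite hv eq_sym (negPf ii').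
Qed.

End FormMaps.

(** * From the list of degrees to the classification *)

Theorem theorem3p7 (R : realType) (V : vectType R[i]) (rho : SL2rep V) :
  rational_rep rho ->
  ~ trivial_rep rho ->
  coreduced rho ->
  (forall v : V, fixed_point rho v -> v = 0) ->
  isomorphic_rep rho (Rrep R[i] 2) \/
  isomorphic_rep rho (Rrep R[i] 3) \/
  isomorphic_rep rho (Rrep R[i] 4) \/
  exists k : nat, (1 <= k)%N /\ isomorphic_rep rho (copies (Rrep R[i] 1) k).
Proof.
move=> rat ntriv cored nofix.
have [k [m [b [bf bs bu bl]]]] := rep_decomposition rat.
have [m1|[i [hm all_i]]] := rep_degrees bf bs bu bl cored nofix.
  right; right; right; exists k; split; last exact: linear_summands bf bs bu bl m1.
  (* With no summand the space is zero, and the representation would be trivial. *)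
  rewrite lt0n; apply/eqP => k0; apply: ntriv => g v.
  have v0 (u : V) : u = 0.
    by have [c ->] := bs u; rewrite big1 // => a; exfalso; have := ltn_ord (tag a); lia.
  by rewrite [LHS]v0 [RHS]v0.
have := single_summand bf bs bu bl all_i; move: hm.
by case: (m i) => [|[|[|[|[|d]]]]] // _; tauto.
Qed.
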